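(* Let $X_n$ be the number of increments of the initial cluster during the parking procedure of a uniformly random parking function of size $n$, and $X_{n,j}$ the number of increments of amount $j$. Let $C_n$ be the number of edge-cuts needed to isolate the root in the random edge-cutting procedure started with a uniformly random Cayley-tree of size $n$, and $C_{n,j}$ the number of subtrees of size $j$ cut off in this procedure. Then $X_n$ and $C_n$ have the same distribution, and $X_{n,j}$ and $C_{n,j}$ have the same distribution for $1\le j\le n-1$. Moreover, $X_n/\sqrt{n}$ converges in distribution to a Rayleigh distribution with parameter $1$ as $n\to\infty$. With $\lambda_{n,j}=\frac{\sqrt{n}\,j^{j-1}}{j!\,e^{j}}$, as $n\to\infty$, for every fixed $s\ge1$, \[ \mathbb{E}\big(X_{n,j}^{\underline{s}}\big)=\lambda_{n,j}^s\,2^{s/2}\,\Gamma\big(\tfrac{s}{2}+1\big)(1+o(1))\quad\text{for } j=j(n)=o(n), \] and $\mathbb{E}(X_{n,j}^{\underline{s}})=O(\lambda_{n,j}^s)$. Let $X$ be Rayleigh distributed with parameter $1$. For $1\le j=j(n)\le n-1$: (i) if $\lambda_{n,j}\to\infty$, $X_{n,j}/\lambda_{n,j}$ converges in distribution, with convergence of all moments, to $X$; (ii) if $\lambda_{n,j}\to\rho\in[0,\infty)$, $X_{n,j}$ converges in distribution, with convergence of all moments, to $Y\sim\mathrm{MPo}(\rho X)$.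
   Context: Parking procedure: spaces $1,\dots,n$, initially empty; drivers $1,\dots,n$ with preferred spaces $s_1,\dots,s_n\in\{1,\dots,n\}$ arrive in order, driver $k$ parks at the first free space among $s_k,s_k+1,\dots,n$; $(s_1,\dots,s_n)$ is a parking function if all drivers park (there are $(n+1)^{n-1}$ of them). The initial cluster is the maximal run of consecutive occupied spaces starting at space $1$; step $k$ is an increment of amount $j\ge1$ if its size increases by $j$ at step $k$. A Cayley-tree of size $n$ is a rooted unordered tree on vertex set $\{1,\dots,n\}$. Edge-cutting procedure: repeatedly choose an edge of the current tree uniformly at random, remove it, discard the part not containing the root, until only the root remains. The Rayleigh distribution with parameter $1$ has density $xe^{-x^2/2}$, $x\ge0$. $x^{\underline{s}}=x(x-1)\cdots(x-s+1)$. For non-negative $X$ and $\rho\ge0$, $Y\sim\mathrm{MPo}(\rho X)$ means $\mathbb{P}\{Y=\ell\}=\frac{\rho^\ell}{\ell!}\mathbb{E}(X^\ell e^{-\rho X})$ (point mass at $0$ if $\rho=0$). ''Convergence of all moments'' refers to non-negative integer moments.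
   Formalization: The equality in law is proved with a shifted index: X_{n-1} and C_n, and X_{n-1,j} and C_{n,j} for 1≤j≤n-1, have the same distribution; as written with X_n and C_n it fails (X_1=1 but C_1=0). *)

(* Defs.v *)
From HB Require Import structures.
From mathcomp Require Import all_boot all_order all_algebra.
From mathcomp Require Import all_classical all_reals all_analysis.
Set Implicit Arguments. Unset Strict Implicit. Unset Printing Implicit Defensive.
Import Order.TTheory GRing.Theory Num.Theory.
Import numFieldNormedType.Exports.
Local Open Scope classical_set_scope.
Local Open Scope ring_scope.

(* Parking procedure.  Spaces and preferences are 0-indexed:          *)
(* space i (0 <= i < n) stands for space i+1 of the paper.             *)

(* first free space among p, p+1, ..., n-1 given the occupied list O;
   returns n if there is none (the driver fails to park). *)
Definition park_spot (n : nat) (O : seq nat) (p : nat) : nat :=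
  (p + find (fun i => (p + i)%N \notin O) (iota 0 (n - p)))%N.

Definition occupied (n : nat) (s : seq nat) : seq nat :=
  foldl (fun O p => let q := park_spot n O p in
                    if (q < n)%N then rcons O q else O) [::] s.

Definition is_parking_function (n : nat) (s : seq nat) : bool :=
  [&& size s == n, all (fun p => p < n)%N s &
      all (fun k => park_spot n (occupied n (take k s)) (nth 0%N s k) < n)%N
          (iota 0 n)].

Definition init_cluster (n : nat) (O : seq nat) : nat :=
  find (fun i => i \notin O) (iota 0 n).

Definition cluster_incr (n : nat) (s : seq nat) (k : nat) : nat :=
  (init_cluster n (occupied n (take k.+1 s)) -
   init_cluster n (occupied n (take k s)))%N.

Definition Xstat (n : nat) (s : seq nat) : nat :=
  count (fun k => 0 < cluster_incr n s k)%N (iota 0 n).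
Definition Xjstat (n j : nat) (s : seq nat) : nat :=
  count (fun k => cluster_incr n s k == j) (iota 0 n).

Definition parking_functions (n : nat) : {set n.-tuple 'I_n} :=
  [set t : n.-tuple 'I_n | is_parking_function n (map val t)].

Definition pf_law (R : realType) (n : nat) (stat : seq nat -> nat) (k : nat) : R :=
  #|[set t in parking_functions n | stat (map val t) == k]|%:R /
  #|parking_functions n|%:R.

Definition lawX (R : realType) (n k : nat) : R := pf_law R n (Xstat n) k.
Definition lawXj (R : realType) (n j k : nat) : R := pf_law R n (Xjstat n j) k.

(* A Cayley tree of size n is encoded by its root r : 'I_n and its     *)
(* parent map par (par r = r); edges are {v, par v} for v <> r, and    *)
(* every vertex reaches r by iterating par.                           *)

Definition cayley_trees (n : nat) : {set 'I_n * {ffun 'I_n -> 'I_n}} :=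
  [set t : 'I_n * {ffun 'I_n -> 'I_n} | (t.2 t.1 == t.1) && [forall u, iter n t.2 u == t.1]].

Definition in_subtree (n : nat) (par : {ffun 'I_n -> 'I_n}) (v u : 'I_n) : bool :=
  [exists k : 'I_n.+1, iter k par u == v].

(* Distribution of the sequence of sizes of the subtrees cut off, when the
   edge-cutting procedure is run on the tree with vertex set S (root r,
   parent map par): a finite list of (probability, outcome) pairs.  At each
   step an edge {v, par v} (v in S, v <> r) is chosen uniformly, and the
   subtree of v (not containing the root) is discarded. *)
Fixpoint cut_dist (R : realType) (n : nat) (r : 'I_n) (par : {ffun 'I_n -> 'I_n})
    (fuel : nat) (S : {set 'I_n}) : seq (R * seq nat) :=
  match fuel with
  | 0%N => [:: (1, [::])]
  | fuel'.+1 =>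
    let E := [seq v <- enum S | v != r] in
    if E is [::] then [:: (1, [::])] else
    flatten [seq let T := [set u in S | in_subtree par v u] in
               [seq (wc.1 / (size E)%:R, #|T| :: wc.2)
               | wc <- cut_dist R r par fuel' (S :\: T)]
            | v <- E]
  end.

Definition cut_law (R : realType) (n : nat) (stat : seq nat -> nat) (k : nat) : R :=
  (\sum_(t in cayley_trees n)
     \sum_(wc <- cut_dist R t.1 t.2 n [set: 'I_n])
        (if stat wc.2 == k then wc.1 else 0)) / #|cayley_trees n|%:R.

Definition lawC (R : realType) (n k : nat) : R := cut_law R n size k.
Definition lawCj (R : realType) (n j k : nat) : R :=
  cut_law R n (fun c => count (pred1 j) c) k.

Definition rayleigh_pdf (R : realType) (x : R) : R := x * expR (- (x ^+ 2) / 2).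

Definition rayleigh_cdf (R : realType) (x : R) : R :=
  \int[lebesgue_measure]_(t in `[0, x]) rayleigh_pdf t.

Definition rayleigh_moment (R : realType) (s : nat) : R :=
  \int[lebesgue_measure]_(t in `[0, +oo[) (t ^+ s * rayleigh_pdf t).

Definition Gamma (R : realType) (a : R) : R :=
  \int[lebesgue_measure]_(t in `]0, +oo[) (powR t (a - 1) * expR (- t)).

Definition mpo_pmf (R : realType) (rho : R) (l : nat) : R :=
  rho ^+ l / l`!%:R *
  \int[lebesgue_measure]_(t in `[0, +oo[) (t ^+ l * expR (- (rho * t)) * rayleigh_pdf t).

Definition mpo_cdf (R : realType) (rho : R) (x : R) : R :=
  limn (fun N => \sum_(l < N | l%:R <= x) mpo_pmf rho l).

Definition mpo_moment (R : realType) (rho : R) (s : nat) : R :=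
  limn (fun N => \sum_(l < N) l%:R ^+ s * mpo_pmf rho l).

(* convergence in distribution: G n x is the distribution function of the
   n-th variable, F the limiting distribution function *)
Definition cvg_in_dist (R : realType) (G : nat -> R -> R) (F : R -> R) : Prop :=
  forall x : R, {for x, continuous F} -> G n x @[n --> \oo] --> F x.

Definition lam (R : realType) (n j : nat) : R :=
  Num.sqrt n%:R * (j%:R ^+ j.-1) / (j`!%:R * expR j%:R).

Definition fact_moment (R : realType) (n j s : nat) : R :=
  \sum_(k < n.+1) (k ^_ s)%:R * lawXj R n j k.

(* Main.v *)
(** The first n drivers of a parking function of size n+1 leave one hole, the
    words on its two sides are independent, and the last driver, by filling the
    hole, adds to the initial cluster the hole and all that follows it; cutting
    a random edge splits a random Cayley tree into two independent trees. Both
    decompositions give the same recursion, hence the equality in law.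

    With T the tree function and a = 1 / (1 - T), the recursion makes the
    generating function of the (s+1)-st factorial moments equal to
    (s+1) a tau times that of the s-th ones, tau being the part of T carried by
    the counted sizes, up to a term that is smaller by a factor n^(1/4),
    uniformly in the set of counted sizes. The main term is s! tau^s a^s (a - 1).
    For all sizes tau = T, and T a = a - 1 with the differential equation of T
    shows that the limits m_s of the normalised moments satisfy
    m_(s+2) = (s+2) m_s. Together with m_0 = 1 and log-convexity this determines
    them, and the moments of the Rayleigh law have the same properties. For a
    single size, tau is a monomial and the same coefficients of powers of a occur.

    The distribution functions follow from the moments: Taylor's formula gives
    the Laplace transform, and 1 - (1 - e^(-at))^b approximates the indicator
    function of an interval [0, x]; for the mixed Poisson law the inequalities
    of Bonferroni express the probabilities by factorial moments. *)

Require Import Defs.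
From HB Require Import structures.
From mathcomp Require Import all_boot all_order all_algebra.
From mathcomp Require Import all_classical all_reals all_analysis measurable_realfun.
From mathcomp Require Import zify ring lra.
Import Order.TTheory GRing.Theory Num.Theory.
Import numFieldNormedType.Exports.
Set Implicit Arguments. Unset Strict Implicit. Unset Printing Implicit Defensive.

Local Open Scope nat_scope.

(** * Parking functions *)

Lemma park_spot_spec n O p (q := park_spot n O p) : p <= n ->
  [/\ p <= q, q <= n, forall i, p <= i < q -> i \in O & q < n -> q \notin O].
Proof.
move=> pn; rewrite /q /park_spot; set P := (fun i => _); set s := iota _ _.
have fs : find P s <= n - p by rewrite -[X in _ <= X](size_iota 0) find_size.
split; first lia.
- lia.
- move=> i /andP[pi iq].
  have /(before_find 0) : i - p < find P s by lia.
  rewrite nth_iota; last lia.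
  by rewrite /P add0n subnKC // => /negbFE.
- move=> qn; have hs : has P s by rewrite has_find size_iota; lia.
  have := nth_find 0 hs; rewrite nth_iota; last lia.
  by rewrite add0n.
Qed.

Lemma park_spot_eq n O p q : p <= q <= n ->
  (forall i, p <= i < q -> i \in O) -> (q < n -> q \notin O) ->
  park_spot n O p = q.
Proof.
move=> /andP[pq qn] Hin Hq.
have [|h1 h2 h3 h4] := @park_spot_spec n O p; first lia.
case: (ltngtP (park_spot n O p) q) => // h.
  by have := h4; rewrite Hin ?h1 //; lia.
by have := Hq; rewrite h3 ?pq //; lia.
Qed.

Lemma init_clusterE n O : init_cluster n O = park_spot n O 0.
Proof. by rewrite /init_cluster /park_spot add0n subn0. Qed.

Lemma occupied_rcons n s p (q := park_spot n (occupied n s) p) :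
  occupied n (rcons s p) =
  if q < n then rcons (occupied n s) q else occupied n s.
Proof. by rewrite /occupied -cats1 foldl_cat. Qed.

Lemma park_spot_ge n O p : p <= park_spot n O p.
Proof. exact: leq_addr. Qed.

Lemma park_spot_free n O p : park_spot n O p < n -> park_spot n O p \notin O.
Proof.
move=> h; have hp : p <= n by apply/ltnW/(leq_ltn_trans _ h)/park_spot_ge.
by have [_ _ _] := park_spot_spec O hp; apply.
Qed.

Lemma occupied_lt n s i : i \in occupied n s -> i < n.
Proof.
elim/last_ind: s => // s p IH; rewrite occupied_rcons.
by case: ifP => // h; rewrite mem_rcons inE => /predU1P[->|].
Qed.

Lemma occupied_sub n s p i : i \in occupied n s -> i \in occupied n (rcons s p).
Proof.
by rewrite occupied_rcons; case: ifP => // _ iO; rewrite mem_rcons inE iO orbT.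
Qed.

Lemma occupied_uniq n s : uniq (occupied n s).
Proof.
elim/last_ind: s => // s p IH; rewrite occupied_rcons.
by case: ifP => // h; rewrite rcons_uniq IH park_spot_free.
Qed.

Lemma size_occupied_bound n s : size (occupied n s) <= n.
Proof.
rewrite -[X in _ <= X](size_iota 0); apply: uniq_leq_size; first exact: occupied_uniq.
by move=> x /occupied_lt xn; rewrite mem_iota.
Qed.

Lemma size_occupied_le n s : size (occupied n s) <= size s.
Proof.
elim/last_ind: s => // s p IH; rewrite occupied_rcons size_rcons.
by case: ifP => _; rewrite ?size_rcons //; lia.
Qed.

Definition all_park n s := size (occupied n s) == size s.

Lemma all_park_rcons n s p :
  all_park n (rcons s p) = all_park n s && (park_spot n (occupied n s) p < n).
Proof.
rewrite /all_park occupied_rcons size_rcons; have := size_occupied_le n s.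
by case: ifP => _; rewrite ?size_rcons ?eqSS ?andbT ?andbF //; lia.
Qed.

Definition left_word k (w : seq nat) := [seq p <- w | p < k].
Definition right_word k (w : seq nat) := [seq p - k.+1 | p <- [seq p <- w | k < p]].

Lemma left_word_rcons k w p :
  left_word k (rcons w p) = if p < k then rcons (left_word k w) p else left_word k w.
Proof. by rewrite /left_word filter_rcons. Qed.

Lemma right_word_rcons k w p :
  right_word k (rcons w p) =
  if k < p then rcons (right_word k w) (p - k.+1) else right_word k w.
Proof. by rewrite /right_word filter_rcons; case: ifP; rewrite ?map_rcons. Qed.

Section Split.
Variables (N k : nat) (ltkN : k < N).
Let m := N - k.+1.

Definition splits (O Ol Or : seq nat) :=
  [/\ k \notin O, forall i, i < k -> (i \in O) = (i \in Ol),
   forall i, i < m -> (k.+1 + i \in O) = (i \in Or) & size O = size Ol + size Or].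

Lemma park_spot_left O Ol Or p : splits O Ol Or -> p <= k ->
  park_spot N O p = park_spot k Ol p.
Proof.
case=> kO hl _ _ pk; have [h1 h2 h3 h4] := park_spot_spec Ol pk.
apply: park_spot_eq; first lia.
  by move=> i ij; rewrite hl; [exact: h3|lia].
move=> _; case: (ltngtP (park_spot k Ol p) k) h4; [|lia|by move=> ->].
by move=> h4 /(_ isT); rewrite hl.
Qed.

Lemma park_spot_right O Ol Or p : splits O Ol Or -> k < p < N ->
  park_spot N O p = k.+1 + park_spot m Or (p - k.+1).
Proof.
case=> kO _ hr _ pk; have [|h1 h2 h3 h4] := @park_spot_spec m Or (p - k.+1).
  by rewrite /m; lia.
have mE : m = N - k.+1 by [].
move: h1 h2 h3 h4; set q := park_spot m _ _ => h1 h2 h3 h4.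
apply: park_spot_eq; first lia.
  move=> i ij; have -> : i = k.+1 + (i - k.+1) by lia.
  by rewrite hr; [apply: h3|]; lia.
by move=> h; rewrite hr; [apply: h4|]; lia.
Qed.

Let occ_splits w := splits (occupied N w) (occupied k (left_word k w))
  (occupied m (right_word k w)).

Lemma occupied_splits w : all (ltn^~ N) w -> k \notin w ->
  all_park k (left_word k w) -> occ_splits w.
Proof.
elim/last_ind: w => [|w p IH]; first by split.
rewrite all_rcons mem_rcons inE negb_or => /andP[pN wN] /andP[kp kw].
rewrite /occ_splits left_word_rcons right_word_rcons !occupied_rcons.
case: (ltngtP p k) kp => // pk _.
  rewrite all_park_rcons => /andP[okw qk]; have [kO hl hr hs] := IH wN kw okw.
  rewrite (park_spot_left (And4 kO hl hr hs)) ?(ltnW pk) // (ltn_trans qk ltkN).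
  rewrite occupied_rcons qk; move: qk; set q := park_spot _ _ _ => qk.
  split; rewrite ?size_rcons ?hs //.
  + by rewrite mem_rcons inE (negPf kO) orbF; apply/negP => /eqP; lia.
  + by move=> i ik; rewrite !mem_rcons !inE hl.
  + move=> i im; rewrite mem_rcons inE hr //.
    by case: eqP => // ?; lia.
move=> okw; have [kO hl hr hs] := IH wN kw okw.
rewrite (park_spot_right (And4 kO hl hr hs)) ?pk //.
rewrite occupied_rcons; set q := park_spot _ _ _.
have -> : (k.+1 + q < N) = (q < m) by rewrite /m; lia.
case: ifP => qm //; split; rewrite ?size_rcons ?hs ?addnS //.
+ by rewrite mem_rcons inE (negPf kO) orbF; apply/negP => /eqP; lia.
+ by move=> i ik; rewrite mem_rcons inE hl //; case: eqP => // ?; lia.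
+ by move=> i im; rewrite !mem_rcons !inE hr // eqn_add2l.
Qed.

Lemma occupied_free w : all (ltn^~ N) w -> k \notin occupied N w ->
  k \notin w /\ all_park k (left_word k w).
Proof.
elim/last_ind: w => [//|w p IH].
rewrite all_rcons => /andP[pN wN] kO'.
have kO := contra (@occupied_sub N w p k) kO'.
have [kw okw] := IH wN kO; have S := occupied_splits wN kw okw.
move: kO'; rewrite occupied_rcons mem_rcons inE negb_or kw andbT left_word_rcons.
case: (ltngtP p k) => pk.
- rewrite (park_spot_left S (ltnW pk)) all_park_rcons okw /= => h; split=> //.
  have [_ h2 _ _] := park_spot_spec (occupied k (left_word k w)) (ltnW pk).
  by rewrite ltn_neqAle h2 andbT; apply: contra h => /eqP->; rewrite ltkN mem_rcons inE eqxx.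
- by [].
- rewrite pk (_ : park_spot N (occupied N w) k = k); last first.
    by apply: park_spot_eq; rewrite ?leqnn ?(ltnW ltkN) // => i /andP[/leq_ltn_trans h /h]; rewrite ltnn.
  by rewrite ltkN mem_rcons inE eqxx.
Qed.

Lemma init_cluster_left O Ol Or : splits O Ol Or ->
  init_cluster N O = init_cluster k Ol.
Proof. by move=> S; rewrite !init_clusterE; apply: (park_spot_left S). Qed.

End Split.

Definition cluster_count (J : pred nat) n s :=
  count (fun i => J (cluster_incr n s i)) (iota 0 (size s)).

Lemma cluster_count_rcons J n s p : cluster_count J n (rcons s p) =
  cluster_count J n s + J (init_cluster n (occupied n (rcons s p)) -
                         init_cluster n (occupied n s)).
Proof.
rewrite /cluster_count size_rcons -addn1 iotaD add0n count_cat /= addn0.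
congr (_ + _).
  apply: eq_in_count => i; rewrite mem_iota add0n /= => h.
  by rewrite /cluster_incr -!cats1 !takel_cat //; lia.
rewrite /cluster_incr take_oversize ?size_rcons //.
by rewrite -cats1 takel_cat // take_size.
Qed.

Lemma cluster_count_left J N k w : J 0 = false -> k < N -> all (ltn^~ N) w ->
  k \notin occupied N w ->
  cluster_count J N w = cluster_count J k (left_word k w).
Proof.
move=> J0 kN; elim/last_ind: w => [//|w p IH].
rewrite all_rcons => /andP[pN wN] kO'.
have kO := contra (@occupied_sub N w p k) kO'.
rewrite cluster_count_rcons (IH wN kO).
have wN' : all (ltn^~ N) (rcons w p) by rewrite all_rcons pN.
have [kw ok] := occupied_free kN wN kO; have S := occupied_splits kN wN kw ok.
have [kw' ok'] := occupied_free kN wN' kO'; have S' := occupied_splits kN wN' kw' ok'.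
rewrite (init_cluster_left kN S) (init_cluster_left kN S') left_word_rcons.
by case: ifP => _; rewrite ?cluster_count_rcons // subnn J0 addn0.
Qed.

Definition parking_word n s := (size s == n) && all_park n s.

Lemma parking_wordE n s : all (ltn^~ n) s ->
  is_parking_function n s = parking_word n s.
Proof.
move=> sn; rewrite /is_parking_function /parking_word sn /=; case: eqP => //= ss.
rewrite -{}ss /all_park; move: {1 2 3 5}(size s) => n'.
elim/last_ind: s {sn} => [|s p IH]; first by rewrite /= eqxx.
have E := all_park_rcons n' s p; rewrite /all_park in E; rewrite E -IH.
rewrite size_rcons -addn1 iotaD all_cat add0n /= andbT.
rewrite nth_rcons ltnn eqxx -cats1 takel_cat // take_size; congr (_ && _).
apply: eq_in_all => i; rewrite mem_iota add0n /= => h.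
by rewrite nth_cat h takel_cat // ltnW.
Qed.

Lemma parking_word_full n s i : parking_word n s -> i < n -> i \in occupied n s.
Proof.
case/andP=> /eqP ss /eqP so iN.
have [||_ h] := @uniq_min_size _ (occupied n s) (iota 0 n) (occupied_uniq n s).
- by move=> x /occupied_lt h; rewrite mem_iota.
- by rewrite size_iota so ss.
by rewrite h mem_iota.
Qed.

(* k is the space left free by the first n drivers; everyone before it forms
   a parking function of its own, and so does everyone after it. *)
Definition hole_word n k w := [&& k \notin w, parking_word k (left_word k w) &
  parking_word (n - k) (right_word k w)].

Lemma size_left_right k w : k \notin w ->
  size (left_word k w) + size (right_word k w) = size w.
Proof.
move=> kw; rewrite /left_word /right_word size_map !size_filter.
rewrite -(count_predC (ltn^~ k) w); congr (_ + _); apply: eq_in_count => p pw.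
by rewrite /= -leqNgt ltn_neqAle; case: eqP => // E; rewrite E pw in kw.
Qed.

Lemma hole_wordP n k w : all (ltn^~ n.+1) w -> size w = n -> k < n.+1 ->
  all_park n.+1 w && (k \notin occupied n.+1 w) = hole_word n k w.
Proof.
move=> wn sw kn; apply/idP/idP.
  case/andP=> okw kO; have [kw okl] := occupied_free kn wn kO.
  have S := occupied_splits kn wn kw okl; rewrite subSS in S.
  have [_ _ _ so] := S.
  have ss := size_left_right kw; have sr := size_occupied_le (n-k) (right_word k w).
  have sl : size (occupied k (left_word k w)) = size (left_word k w) := eqP okl.
  have sw' : size (occupied n.+1 w) = size w := eqP okw.
  have hl := size_occupied_bound k (left_word k w).
  have hr := size_occupied_bound (n-k) (right_word k w).
  rewrite /hole_word kw /parking_word okl andbT /all_park /=.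
  rewrite {}sl in so hl *; move: ss sr so sw sw' hl hr kn; clear.
  do ![move: (size _)] => *; apply/and3P; split; apply/eqP; lia.
case/and3P=> kw /andP[/eqP sl okl] /andP[/eqP sr okr].
have S := occupied_splits kn wn kw okl; rewrite subSS in S.
case: S => kO _ _ so; rewrite kO andbT /all_park so (eqP okl) (eqP okr).
by rewrite size_left_right.
Qed.

Lemma hole_park_spot n k w p : all (ltn^~ n.+1) w -> size w = n -> k < n.+1 ->
  hole_word n k w -> p < n.+1 ->
  (park_spot n.+1 (occupied n.+1 w) p < n.+1) = (p <= k).
Proof.
move=> wn sw kn H pn; have := H; rewrite -hole_wordP // => /andP[ok kO].
case/and3P: H => kw pwl pwr.
have S := occupied_splits kn wn kw (proj2 (andP pwl)).
case: (leqP p k) => pk.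
  rewrite (park_spot_left kn S pk).
  have [_ h _ _] := park_spot_spec (occupied k (left_word k w)) pk; lia.
rewrite subSS in S; case: S => _ _ hr _.
rewrite (@park_spot_eq _ _ _ n.+1) ?ltnn //; first lia.
move=> i ip; have -> : i = k.+1 + (i - k.+1) by lia.
by rewrite hr ?(parking_word_full pwr) //; lia.
Qed.

Lemma cluster_count_hole J n k w p : J 0 = false ->
  all (ltn^~ n.+1) w -> size w = n -> k < n.+1 ->
  hole_word n k w -> p <= k ->
  cluster_count J n.+1 (rcons w p) =
    cluster_count J k (left_word k w) + J (n.+1 - k).
Proof.
move=> J0 wn sw kn H pk; have := H; rewrite -hole_wordP // => /andP[ok kO].
rewrite cluster_count_rcons (cluster_count_left J0 kn wn kO).
congr (_ + J (_ - _)).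
  rewrite init_clusterE (@park_spot_eq _ _ _ n.+1) ?ltnn ?leqnn // => i ni.
  apply: parking_word_full => //; rewrite /parking_word size_rcons sw eqxx.
  rewrite all_park_rcons ok (hole_park_spot wn sw kn) //; lia.
case/and3P: H => kw pwl pwr.
rewrite (init_cluster_left kn (occupied_splits kn wn kw (proj2 (andP pwl)))).
rewrite init_clusterE; apply: park_spot_eq; rewrite ?ltnn ?leqnn // => i.
exact: parking_word_full.
Qed.

Local Open Scope ring_scope.

Fixpoint words (A : seq nat) (m : nat) : seq (seq nat) :=
  if m is m'.+1 then [seq a :: w | a <- A, w <- words A m'] else [:: [::]].

Lemma mem_words A m w : (w \in words A m) = (size w == m) && all (mem A) w.
Proof.
elim: m w => [|m IH] [|b w] //=.
  by apply/negP => /allpairsP[[x y] /= [_ _ ?]].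
rewrite eqSS; apply/allpairsP/idP => [[[x y] /= [xA]]|].
  by rewrite IH => /andP[sy ay] [-> ->]; rewrite sy xA.
case/and3P=> sw bA wA; exists (b, w) => /=; split => //.
by rewrite IH sw.
Qed.

Section Words.
Variable K : comNzRingType.
Implicit Types (F : seq nat -> K) (A : seq nat).

Lemma big_iota0 N (G : nat -> K) : \sum_(a <- iota 0 N) G a = \sum_(a < N) G a.
Proof. by rewrite -(big_mkord xpredT) /index_iota subn0. Qed.

Lemma big_words_cons A m F : \sum_(w <- words A m.+1) F w =
  \sum_(a <- A) \sum_(w <- words A m) F (a :: w).
Proof. by rewrite /= big_allpairs_dep. Qed.

Lemma big_words_rcons A m F : \sum_(w <- words A m.+1) F w =
  \sum_(w <- words A m) \sum_(p <- A) F (rcons w p).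
Proof.
elim: m F => [|m IH] F.
  by rewrite big_words_cons /= big_seq1; apply: eq_bigr => a _; rewrite big_seq1.
rewrite big_words_cons [RHS]big_words_cons.
by apply: eq_bigr => a _; rewrite IH.
Qed.

Lemma big_tuple_words N m F :
  \sum_(t : m.-tuple 'I_N) F (map val t) = \sum_(w <- words (iota 0 N) m) F w.
Proof.
elim: m F => [|m IH] F.
  rewrite (big_pred1 [tuple]) /= ?big_seq1 // => t.
  by symmetry; apply/eqP; rewrite tuple0; apply: val_inj.
rewrite big_words_cons big_iota0.
under [RHS]eq_bigr do rewrite -IH.
rewrite pair_big /= (reindex (fun p : 'I_N * m.-tuple 'I_N => [tuple of p.1 :: p.2])) /=.
  by apply: eq_bigr.
exists (fun t : m.+1.-tuple 'I_N => (thead t, [tuple of behead t])) => [[a t] _|t _] /=.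
  by congr pair; apply: val_inj.
by rewrite -tuple_eta.
Qed.

Lemma shuffle k b n (g1 g2 : seq nat -> K) :
  \sum_(w <- words (iota 0 (k + b.+1)) n | k \notin w)
     g1 (left_word k w) * g2 (right_word k w) =
  \sum_(i < n.+1) 'C(n, i)%:R * ((\sum_(u <- words (iota 0 k) i) g1 u) *
     (\sum_(v <- words (iota 0 b) (n - i)) g2 v)).
Proof.
elim: n g1 g2 => [|n IH] g1 g2.
  by rewrite big_ord1 bin0 mul1r !big_seq1 /= big_cons big_nil /= addr0.
pose S1 g i := \sum_(u <- words (iota 0 k) i) g u : K.
pose S2 g i := \sum_(v <- words (iota 0 b) i) g v : K.
rewrite big_mkcond big_words_cons; set W := words _ n; rewrite iotaD big_cat /= big_cons.
rewrite [X in _ + (X + _)]big1 ?add0r; last by move=> w _; rewrite inE eqxx.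
have -> : \sum_(a <- iota 0 k) \sum_(w <- W)
   (if k \notin a :: w then g1 (left_word k (a :: w)) * g2 (right_word k (a :: w)) else 0)
   = \sum_(i < n.+1) 'C(n, i)%:R * (S1 g1 i.+1 * S2 g2 (n - i)%N).
  rewrite /S1.
  under [RHS]eq_bigr do rewrite big_words_cons mulr_suml mulr_sumr.
  rewrite [RHS]exchange_big /=; rewrite big_seq [RHS]big_seq; apply: eq_bigr => a.
  rewrite mem_iota add0n /= => ak.
  rewrite -(IH (fun u => g1 (a :: u)) g2) [RHS]big_mkcond -/W /=.
  apply: eq_bigr => w _; rewrite inE /left_word /right_word /= ak.
  by rewrite negb_or (gtn_eqF ak) /= ltnNge (ltnW ak).
have -> : \sum_(a <- iota (0+k).+1 b) \sum_(w <- W)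
   (if k \notin a :: w then g1 (left_word k (a :: w)) * g2 (right_word k (a :: w)) else 0)
   = \sum_(i < n.+1) 'C(n, i)%:R * (S1 g1 i * S2 g2 (n - i).+1).
  rewrite /S2.
  under [RHS]eq_bigr do rewrite big_words_cons !mulr_sumr.
  rewrite [RHS]exchange_big /= add0n -[k.+1]addn0 iotaDl big_map.
  apply: eq_bigr => a _.
  rewrite -(IH g1 (fun u => g2 (a :: u))) [RHS]big_mkcond -/W /=.
  apply: eq_bigr => w _; rewrite inE /left_word /right_word /=.
  have h : (k < k.+1 + a)%N by lia.
  by rewrite negb_or h (ltn_eqF h) /= ltnNge (ltnW h) /= addKn.
rewrite -/(S1 g1 _) [RHS](eq_bigr (fun i : 'I_n.+2 =>
  'C(n.+1, i)%:R * (S1 g1 i * S2 g2 (n.+1 - i)%N))) //.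
rewrite [RHS]big_ord_recl bin0 subn0.
rewrite [X in _ = _ + X](eq_bigr (fun i : 'I_n.+1 =>
    'C(n, i.+1)%:R * (S1 g1 i.+1 * S2 g2 (n - i)%N) +
    'C(n, i)%:R * (S1 g1 i.+1 * S2 g2 (n - i)%N))); last first.
  by move=> i _; rewrite lift0 binS subSS natrD mulrDl.
rewrite big_split /= [X in _ = _ + (X + _)]big_ord_recr /= bin_small // mul0r addr0.
rewrite [X in _ + X = _]big_ord_recl /= bin0 subn0.
rewrite addrC -addrA; congr (_ + _).
congr (_ + _); apply: eq_bigr => i _; rewrite /bump leq0n add1n; congr (_ * (_ * S2 _ _)).
by have := ltn_ord i; lia.
Qed.

End Words.

Section ParkingSum.
Variables (K : comNzRingType) (J : pred nat).
Hypothesis J0 : J 0%N = false.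

Definition parking_sum n (f : nat -> K) :=
  \sum_(w <- words (iota 0 n) n | parking_word n w) f (cluster_count J n w).

Lemma exists_hole n w : all_park n.+1 w -> size w = n ->
  exists2 k0, (k0 < n.+1)%N & forall k, (k < n.+1)%N ->
    (k \notin occupied n.+1 w) = (k == k0).
Proof.
move=> /eqP ok sw; set O := occupied _ _ in ok *; rewrite {}sw in ok.
have uO : uniq O := occupied_uniq _ _.
have : ~~ all (mem O) (iota 0 n.+1).
  apply/allP => h; have := uniq_leq_size (iota_uniq 0 n.+1) h.
  by rewrite size_iota ok ltnn.
case/allPn => k0; rewrite mem_iota add0n /= => k0n k0O; exists k0 => // k kn.
case: eqP => [->//|/eqP kk0]; apply/negbTE/negP => kO.
have U : uniq [:: k, k0 & O] by rewrite /= inE negb_or kk0 kO k0O uO.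
have := @uniq_leq_size _ _ (iota 0 n.+1) U; rewrite size_iota [size _]/= ok.
move=> h; suff : (n.+2 <= n.+1)%N by rewrite ltnn.
apply: h => x; rewrite mem_iota !inE add0n /= => /or3P[/eqP->|/eqP->|/occupied_lt] //.
Qed.

Lemma parking_sum_rec n (f : nat -> K) : parking_sum n.+1 f =
  \sum_(k < n.+1) 'C(n, k)%:R * k.+1%:R * parking_sum (n - k)%N (fun=> 1) *
     parking_sum k (fun c => f (c + J (n.+1 - k)%N)%N).
Proof.
rewrite /parking_sum big_mkcond big_words_rcons.
transitivity (\sum_(w <- words (iota 0 n.+1) n) \sum_(k < n.+1 | hole_word n k w)
   k.+1%:R * f (cluster_count J k (left_word k w) + J (n.+1 - k)%N)%N).
  rewrite !big_seq; apply: eq_bigr => w; rewrite mem_words => /andP[/eqP sw wn].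
  have {}wn : all (ltn^~ n.+1) w.
    by apply: sub_all wn => x; rewrite [mem _ _](mem_iota 0 n.+1 x).
  case okw: (all_park n.+1 w); last first.
    rewrite !big1 // => [k|p _].
      by rewrite -hole_wordP // okw.
    by rewrite /parking_word all_park_rcons okw andbF.
  have [k0 k0n hk0] := exists_hole okw sw.
  have H k : (k < n.+1)%N -> hole_word n k w = (k == k0).
    by move=> kn; rewrite -hole_wordP // okw hk0.
  rewrite big_iota0 [RHS](big_pred1 (Ordinal k0n)) /=; last by move=> k; rewrite H.
  have Hk0 : hole_word n k0 w by rewrite H ?eqxx.
  rewrite -big_mkcond /= (eq_bigl (fun p : 'I_n.+1 => (p <= k0)%N)); last first.
    move=> p /=; rewrite /parking_word size_rcons sw eqxx all_park_rcons okw.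
    by rewrite (hole_park_spot wn sw k0n).
  under eq_bigr => p pk do rewrite (cluster_count_hole J0 wn sw k0n Hk0 pk).
  by rewrite (big_ord_narrow_leq (k0n : (k0 <= n)%N)) sumr_const card_ord mulr_natl.
under eq_bigr do rewrite big_mkcond /=.
rewrite exchange_big /=; apply: eq_bigr => k _.
pose g1 u := if parking_word k u then
   k.+1%:R * f (cluster_count J k u + J (n.+1 - k)%N)%N else 0.
pose g2 v : K := if parking_word (n - k)%N v then 1 else 0.
transitivity (\sum_(w <- words (iota 0 (k + (n - k).+1)) n | (k : nat) \notin w)
     g1 (left_word k w) * g2 (right_word k w)).
  have -> : (k + (n - k).+1 = n.+1)%N by have := ltn_ord k; lia.
  rewrite [RHS]big_mkcond; apply: eq_bigr => w _; rewrite /g1 /g2 /hole_word.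
  by case: (_ \notin _); case: (parking_word _ _); case: (parking_word _ _);
    rewrite /= ?mulr0 ?mul0r ?mulr1.
rewrite shuffle (bigD1 k) //= [X in _ + X]big1 ?addr0; last first.
  move=> i ik; rewrite [X in _ * (X * _)]big_seq big1 ?mul0r ?mulr0 // => u.
  rewrite mem_words => /andP[/eqP su _]; rewrite /g1 /parking_word su.
  by case: eqP => // E; move: ik; rewrite -val_eqE /= E eqxx.
rewrite /g1 /g2 -big_mkcond /= -big_mkcond /= -mulr_sumr; ring.
Qed.

End ParkingSum.

(** * Edge cutting *)

Lemma in_subtreeE n (par : {ffun 'I_n -> 'I_n}) v u :
  in_subtree par v u = fconnect par u v.
Proof.
apply/existsP/idP => [[k /eqP <-]|h]; first exact: fconnect_iter.
have hk : (findex par u v < n.+1)%N.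
  rewrite ltnS; apply/ltnW/(leq_trans (findex_max h)).
  by rewrite -[X in (_ <= X)%N](card_ord n) max_card.
by exists (Ordinal hk) => /=; rewrite iter_findex.
Qed.

Section Trees.
Variables (n : nat).
Local Notation V := 'I_n.
Implicit Types (S T : {set V}) (par : {ffun V -> V}) (t : V * {ffun V -> V}).

(* Rooted trees on the vertex set S; the parent map is the identity outside S, so that a tree has a single encoding. *)
Definition tree_on S t := [&& t.1 \in S, t.2 t.1 == t.1,
  [forall u in S, (t.2 u \in S) && fconnect t.2 u t.1] &
  [forall u in ~: S, t.2 u == u]].

Lemma tree_onP S r par : reflect
  [/\ r \in S, par r = r, forall u, u \in S -> par u \in S,
      forall u, u \in S -> fconnect par u r & forall u, u \notin S -> par u = u]
  (tree_on S (r, par)).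
Proof.
apply: (iffP and4P) => /= -[rS].
  move=> /eqP rr /forall_inP h /forall_inP h'; split => // u uS.
  - by case/andP: (h u uS).
  - by case/andP: (h u uS).
  - by apply/eqP/h'; rewrite inE.
move=> rr h1 h2 h3; split=> //; first exact/eqP.
  by apply/forall_inP => u uS; rewrite h1 ?h2.
by apply/forall_inP => u; rewrite inE => /h3 ->.
Qed.

Lemma iter_fix (f : V -> V) x k : f x = x -> iter k f x = x.
Proof. by move=> fx; elim: k => //= k ->. Qed.

Lemma connect_fix (f : V -> V) x y : f x = x -> fconnect f x y -> y = x.
Proof. by move=> fx /iter_findex <-; rewrite iter_fix. Qed.

Lemma cayley_treesE t : (t \in cayley_trees n) = tree_on [set: V] t.
Proof.
case: t => r par; rewrite inE /=; apply/andP/tree_onP.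
  move=> [/eqP rr /forallP h]; split=> // u; rewrite ?inE //.
  by move=> _; rewrite -(eqP (h u)) fconnect_iter.
move=> [_ rr _ h _]; split; first exact/eqP.
apply/forallP => u; have c := h u (finset.in_setT u).
have hk : (findex par u r <= n)%N.
  apply/ltnW/(leq_trans (findex_max c)).
  by rewrite -[X in (_ <= X)%N](card_ord n) max_card.
have -> : iter n par u = iter (n - findex par u r) par (iter (findex par u r) par u).
  by rewrite -iterD subnK.
by rewrite iter_findex // iter_fix.
Qed.

Lemma fconnect_unfold (f : V -> V) u v : u != v -> fconnect f u v ->
  fconnect f (f u) v.
Proof.
move=> uv /iter_findex; case: (findex f u v) => [/= E|k].
  by rewrite E eqxx in uv.
by rewrite iterSr => <-; rewrite fconnect_iter.
Qed.

Lemma fconnect_agree (f g : V -> V) (A : {pred V}) v :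
  (forall u, u \in A -> u != v -> f u = g u) ->
  (forall u, u \in A -> u != v -> f u \in A) ->
  forall u, u \in A -> fconnect f u v -> fconnect g u v.
Proof.
move=> fg fA u uA /iter_findex; move: (findex f u v) => k.
elim: k u uA => [|k IH] u uA; first by move=> /= ->.
case: (eqVneq u v) => [->//|uv]; rewrite iterSr => h.
apply: connect_trans (_ : fconnect g u (f u)) _.
  by rewrite fg // fconnect1.
exact: IH (fA _ uA uv) h.
Qed.

Definition branch S par v := [set u in S | fconnect par u v].

Section Bijection.
Variables (S T : {set V}).
Hypothesis TS : T \subset S.

Let I1 : finType := ((V * {ffun V -> V}) * V)%type.
Let I2 : finType := ((V * {ffun V -> V}) * ((V * {ffun V -> V}) * V))%type.

Definition graft (j : I2) : I1 := let: ((v, p1), ((r, p2), u)) := j in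
  ((r, [ffun x => if x == v then u else if x \in T then p1 x else p2 x]), v).
Definition ungraft (i : I1) : I2 := let: ((r, par), v) := i in
  ((v, [ffun x => if (x \in T) && (x != v) then par x else x]),
   ((r, [ffun x => if x \in S :\: T then par x else x]), par v)).

Definition cut_pair (i : I1) := [&& tree_on S i.1, i.2 \in S :\ i.1.1 &
  branch S i.1.2 i.2 == T].
Definition graft_triple (j : I2) := [&& tree_on T j.1, tree_on (S :\: T) j.2.1 &
  j.2.2 \in S :\: T].

Lemma cut_pair_ungraft i : cut_pair i ->
  graft_triple (ungraft i) /\ graft (ungraft i) = i.
Proof.
case: i => -[r par] v /and3P[/= /tree_onP[rS rr hS hr hid]].
rewrite !inE => /andP[vr vS] /eqP ET.
have memT u : (u \in T) = (u \in S) && fconnect par u v by rewrite -ET inE.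
have vT : v \in T by rewrite memT vS /=.
have rT : r \notin T.
  by rewrite memT rS; apply: contra vr => /(connect_fix rr) ->.
have vv : par v \notin T.
  rewrite memT hS //=; apply/negP => /iter_findex; set k := findex _ _ _ => hk.
  have it m : iter (m * k.+1) par v = v.
    by elim: m => // m IH; rewrite mulSn iterD IH iterSr.
  have := iter_findex (hr v vS); set k' := findex _ _ _ => hk'.
  have := it k'; rewrite mulnS addnC iterD hk' iter_fix // => E.
  by rewrite E eqxx in vr.
have up u : u \in S -> u \notin T -> par u \notin T.
  move=> uS; apply: contra; rewrite !memT uS hS //= => h.
  exact: connect_trans (fconnect1 _ _) h.
have down u : u \in T -> u != v -> par u \in T.
  by rewrite !memT => /andP[uS h] uv; rewrite hS //= fconnect_unfold.
split.
  apply/and3P; split=> /=.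
  - apply/tree_onP; split=> //.
    + by rewrite ffunE eqxx andbF.
    + by move=> u uT; rewrite ffunE uT /=; case: eqVneq => //= uv; apply: down.
    + move=> u uT; apply: (@fconnect_agree par _ (mem T)) => //.
      * by move=> x xT xv; rewrite ffunE xT xv.
      * by have := uT; rewrite memT => /andP[].
    + by move=> u /negPf uT; rewrite ffunE uT.
  - apply/tree_onP; split=> //.
    + by rewrite inE rT.
    + by rewrite ffunE rr if_same.
    + by move=> u uST; rewrite ffunE uST; move: uST; rewrite !inE => /andP[? ?]; rewrite up ?hS.
    + move=> u uST; apply: (@fconnect_agree par _ (mem (S :\: T))) => //.
      * by move=> x xT xv; rewrite ffunE xT.
      * by move=> x; rewrite !inE => /andP[? ?] _; rewrite up ?hS.
      * by apply: hr; move: uST; rewrite inE => /andP[].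
    + by move=> u /negPf uT; rewrite ffunE uT.
  - by rewrite inE vv hS.
rewrite /graft /=; congr (_, _, _); apply/ffunP => x; rewrite !ffunE.
case: eqVneq => [->//|xv]; case xT: (x \in T); rewrite ?andbT //= inE xT /=.
by case: ifP => // /negbT /hid.
Qed.

Lemma graft_triple_graft j : graft_triple j ->
  cut_pair (graft j) /\ ungraft (graft j) = j.
Proof.
case: j => -[v p1] [[r p2] w] /and3P[/=].
move=> /tree_onP[vT vv hT hv hidT] /tree_onP[rS rr hS hr hid] wS.
set par := [ffun x => _].
have parv : par v = w by rewrite ffunE eqxx.
have parT u : u \in T -> u != v -> par u = p1 u by move=> h /negPf h'; rewrite ffunE h h'.
have parS u : u \notin T -> par u = p2 u.
  by move=> h; rewrite ffunE (negPf h); case: eqP => // E; rewrite E vT in h.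
have TS' u : u \in T -> u \in S by exact: (fintype.subsetP TS).
have ST u : u \in S :\: T -> u \in S by rewrite inE => /andP[].
have STn u : u \in S :\: T -> u \notin T by rewrite inE => /andP[].
have cS u : u \in S :\: T -> fconnect par u r.
  move=> uS; apply: (@fconnect_agree p2 _ (mem (S :\: T))) => //.
  - by move=> x xS _; rewrite parS ?STn.
  - by move=> x xS _; apply: hS.
  - exact: hr.
have cT u : u \in T -> fconnect par u v.
  move=> uT; apply: (@fconnect_agree p1 _ (mem T)) => //.
  - by move=> x xT xv; rewrite parT.
  - by move=> x xT _; apply: hT.
  - exact: hv.
have itS u k : u \in S :\: T -> iter k par u \in S :\: T.
  elim: k u => // k IH u uS; rewrite iterSr IH // parS ?STn //; exact: hS.
have rv : v != r by apply: contraTneq vT => ->; apply: STn.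
split.
  apply/and3P; split=> /=.
  - apply/tree_onP; split.
    + exact: ST.
    + by rewrite parS ?STn.
    + move=> u uS; case: (boolP (u \in T)) => uT.
        case: (eqVneq u v) => [->|uv]; first by rewrite parv ST.
        by rewrite parT // TS' // hT.
      by rewrite parS // ST // hS // inE uT.
    + move=> u uS; case: (boolP (u \in T)) => uT; last by rewrite cS // inE uT.
      apply: connect_trans (cT u uT) _.
      apply: connect_trans (fconnect1 _ _) _.
      by rewrite parv cS.
    + move=> u uS; have uT : u \notin T by apply: contra uS => /TS'.
      by rewrite parS // hid // inE negb_and uS orbT.
  - by rewrite !inE rv TS'.
  - apply/eqP/finset.setP => u; rewrite inE; case: (boolP (u \in T)) => uT.
      by rewrite TS' ?cT.
    apply/negbTE/negP => /andP[uS /iter_findex E].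
    have := itS u (findex par u v); rewrite E !inE uT uS vT => /(_ isT).
    by [].
rewrite /ungraft /=; congr ((_, _), ((_, _), _)) => //.
- apply/ffunP => x; rewrite ffunE.
  case: (boolP (x \in T)) => xT /=; last by rewrite hidT.
  by case: eqVneq => [->//|xv]; rewrite parT.
- apply/ffunP => x; rewrite ffunE; case: ifP => xS; last by rewrite hid // xS.
  by rewrite parS // STn.
Qed.

Lemma sum_cut_pair (K : comNzRingType) (G : V -> {ffun V -> V} -> K) :
  (forall r par par', tree_on (S :\: T) (r, par') ->
     {in S :\: T, par =1 par'} -> G r par = G r par') ->
  \sum_(i | cut_pair i) G i.1.1 i.1.2 =
  #|[set t | tree_on T t]|%:R * #|S :\: T|%:R * \sum_(t | tree_on (S :\: T) t) G t.1 t.2.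
Proof.
move=> HG; rewrite (reindex_onto graft ungraft); last first.
  by move=> i /cut_pair_ungraft[].
rewrite (eq_bigl graft_triple); last first.
  move=> j; apply/andP/idP => [[h /eqP <-]|/graft_triple_graft[h ->]].
    by case: (cut_pair_ungraft h).
  by rewrite eqxx.
rewrite (eq_bigr (fun j : I2 => 1 * (G j.2.1.1 j.2.1.2 * 1))); last first.
  move=> [[v p1] [[r p2] u]] /= /and3P[/= /tree_onP[vT _ _ _ _] h uS].
  rewrite mul1r mulr1; apply: HG => // x; rewrite inE => /andP[xT xS].
  by rewrite ffunE (negPf xT); case: eqP => // E; rewrite E vT in xT.
transitivity (\sum_(t | tree_on T t) \sum_(q : (V * {ffun V -> V}) * V |
    tree_on (S :\: T) q.1 && (q.2 \in S :\: T)) (1 * (G q.1.1 q.1.2 * 1))).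
  by rewrite pair_big /=; apply: eq_bigl => -[[v p1] [[r p2] u]].
transitivity (\sum_(t | tree_on T t) (\sum_(t' | tree_on (S :\: T) t')
    \sum_(u in S :\: T) (G t'.1 t'.2))).
  apply: eq_bigr => t _; rewrite pair_big /=; apply: eq_bigr => q _.
  by rewrite mul1r mulr1.
under eq_bigr do under eq_bigr do rewrite sumr_const -mulr_natl.
rewrite (eq_bigl (mem [set t | tree_on T t])) => [|t]; last by rewrite [RHS]inE.
by rewrite sumr_const -[LHS]mulr_natl -mulrA -mulr_sumr.
Qed.

End Bijection.

Variables (R : realType) (J : pred nat).
Hypothesis J0 : J 0%N = false.

Definition cut_mean (S : {set V}) r par fuel (f : nat -> R) :=
  \sum_(wc <- cut_dist R r par fuel S) wc.1 * f (count J wc.2).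

Lemma cut_mean_single S r par fuel f : S :\ r = finset.set0 ->
  cut_mean S r par fuel f = f 0%N.
Proof.
move=> S0; rewrite /cut_mean; case: fuel => [|fuel] /=.
  by rewrite big_seq1 mul1r.
have -> : [seq v <- enum S | v != r] = [::].
  apply/eqP; rewrite -[_ == _]negbK -has_filter; apply/hasPn => v.
  rewrite mem_enum => vS; apply/negP => /= vr.
  have : v \in S :\ r by rewrite !inE vr vS.
  by rewrite S0 inE.
by rewrite big_seq1 mul1r.
Qed.

Lemma cut_meanS S r par fuel f : S :\ r != finset.set0 ->
  cut_mean S r par fuel.+1 f = (#|S :\ r|%:R)^-1 * \sum_(v in S :\ r)
    cut_mean (S :\: branch S par v) r par fuel
       (fun c => f (J #|branch S par v| + c)%N).
Proof.
move=> S0; rewrite /cut_mean /=.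
set E := [seq v <- enum S | v != r].
have EE : perm_eq E (enum (S :\ r)).
  apply: uniq_perm; [by rewrite filter_uniq // enum_uniq|exact: enum_uniq|move=> v].
  by rewrite mem_filter !mem_enum !inE.
have sE : size E = #|S :\ r| by rewrite (perm_size EE) -cardE.
have : E != [::] by rewrite -size_eq0 sE cards_eq0.
rewrite -sE; move: EE sE; move: E; case=> [//|v0 E] EE sE _.
rewrite big_flatten big_map (perm_big _ EE) /= big_enum mulr_sumr.
apply: eq_bigr => v _.
have -> : [set u in S | in_subtree par v u] = branch S par v.
  by apply/finset.setP => u; rewrite !inE in_subtreeE.
rewrite big_map mulr_sumr; apply: eq_bigr => wc _ /=.
by rewrite mulrCA mulrA.
Qed.

Lemma cut_mean1 S r par fuel : cut_mean S r par fuel (fun=> 1) = 1.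
Proof.
elim: fuel S => [|fuel IH] S; first by rewrite /cut_mean /= big_seq1 mulr1.
case: (eqVneq (S :\ r) finset.set0) => [S0|S0]; first by rewrite cut_mean_single.
rewrite cut_meanS //; under eq_bigr do rewrite IH.
by rewrite sumr_const mulVf // pnatr_eq0 cards_eq0.
Qed.

Lemma cut_mean_agree S r par par' fuel f :
  (forall u, u \in S -> par' u \in S) -> {in S, par =1 par'} ->
  cut_mean S r par fuel f = cut_mean S r par' fuel f.
Proof.
elim: fuel S f => [//|fuel IH] S f hS hp.
case: (eqVneq (S :\ r) finset.set0) => [S0|S0]; first by rewrite !cut_mean_single.
have bE v : branch S par v = branch S par' v.
  apply/finset.setP => u; rewrite !inE; case uS: (u \in S) => //=.
  apply/idP/idP; apply: (@fconnect_agree _ _ (mem S)) => // x xS _.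
  - exact: hp.
  - by rewrite hp ?hS.
  - by rewrite hp.
  - exact: hS.
rewrite !cut_meanS //; congr (_ * _); apply: eq_bigr => v _; rewrite bE.
apply: IH => u; rewrite inE => /andP[uT uS]; last exact: hp.
rewrite inE hS // andbT; move: uT; rewrite !inE uS hS //=; apply: contra => h.
exact: connect_trans (fconnect1 _ _) h.
Qed.

Definition cut_sum fuel S f := \sum_(t | tree_on S t) cut_mean S t.1 t.2 fuel f.

Lemma cut_sum1 fuel S : cut_sum fuel S (fun=> 1) = #|[set t | tree_on S t]|%:R.
Proof.
rewrite /cut_sum; under eq_bigr do rewrite cut_mean1.
rewrite (eq_bigl (mem [set t | tree_on S t])) => [|t]; last by rewrite [RHS]inE.
by rewrite sumr_const.
Qed.

Lemma cut_sum_rec fuel S f : (1 < #|S|)%N ->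
  (#|S|.-1)%:R * cut_sum fuel.+1 S f =
  \sum_(T : {set V} | T \subset S) #|[set t | tree_on T t]|%:R *
    #|S :\: T|%:R * cut_sum fuel (S :\: T) (fun c => f (J #|T| + c)%N).
Proof.
move=> S1.
pose G T r par := cut_mean (S :\: T) r par fuel (fun c => f (J #|T| + c)%N).
transitivity (\sum_(t | tree_on S t) \sum_(v in S :\ t.1) G (branch S t.2 v) t.1 t.2).
  rewrite /cut_sum mulr_sumr; apply: eq_bigr => -[r par] /tree_onP[rS _ _ _ _] /=.
  have cS : #|S :\ r| = #|S|.-1 by rewrite (cardsD1 r S) rS.
  have S0 : S :\ r != finset.set0 by rewrite -cards_eq0 cS; case: #|S| S1 => [|[]].
  by rewrite cut_meanS // cS mulrA divff ?mul1r // -cS pnatr_eq0 cards_eq0.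
rewrite pair_big_dep /=.
rewrite (partition_big (fun i => branch S i.1.2 i.2) (fun T => T \subset S)) /=; last first.
  by move=> i _; apply/fintype.subsetP => u; rewrite inE => /andP[].
apply: eq_bigr => T TS; rewrite /cut_sum -(sum_cut_pair TS (G := G T)); last first.
  move=> r par par' /tree_onP[_ _ h _ _] hp; exact: cut_mean_agree.
rewrite (eq_bigl (cut_pair S T)); last by move=> i; rewrite /cut_pair -andbA.
by apply: eq_bigr => i /and3P[_ _ /eqP->].
Qed.

Lemma cut_sum_single fuel S f : #|S| = 1%N -> cut_sum fuel S f = f 0%N.
Proof.
move=> /eqP/finset.cards1P[r ->]; rewrite /cut_sum (big_pred1 (r, [ffun x => x])) /=.
  by rewrite cut_mean_single //; apply/finset.setP => u; rewrite !inE andNb.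
move=> [r' par] /=; apply/tree_onP/eqP => [[]|[-> ->]].
  rewrite inE => /eqP -> rr _ _ h; congr pair; apply/ffunP => u; rewrite ffunE.
  by case: (eqVneq u r) => [->//|ur]; apply: h; rewrite inE.
by split=> [||u|u|u _]; rewrite ?inE ?ffunE // => /eqP->.
Qed.

Lemma cut_sum_chain (F : nat -> (nat -> R) -> R) :
  (forall m f g, f =1 g -> F m f = F m g) ->
  (forall f, F 1%N f = f 0%N) ->
  (forall m f, (1 < m)%N -> (m.-1)%:R * F m f = \sum_(1 <= i < m)
     'C(m, i)%:R * F i (fun=> 1) * (m - i)%:R * F (m - i)%N (fun c => f (c + J i)%N)) ->
  forall fuel S f, (0 < #|S| <= fuel.+1)%N -> cut_sum fuel S f = F #|S| f.
Proof.
move=> Fext F1 Frec; elim=> [|fuel IH] S f /andP[S0 Sf].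
  have S1 : #|S| = 1%N by lia.
  by rewrite cut_sum_single // S1 F1.
case: (ltnP 1 #|S|) => S1; last first.
  have {}S1 : #|S| = 1%N by lia.
  by rewrite cut_sum_single // S1 F1.
have nz : (#|S|.-1)%:R != 0 :> R by rewrite pnatr_eq0; lia.
apply: (mulfI nz); rewrite cut_sum_rec // Frec //.
pose H i := F i (fun=> 1) * (#|S| - i)%:R * F (#|S| - i)%N (fun c => f (c + J i)%N).
transitivity (\sum_(T : {set V} | (T \subset S) && (0 < #|T| < #|S|)%N) H #|T|).
  rewrite [RHS]big_mkcondr /=; apply: eq_bigr => T TS.
  have cD : #|S :\: T| = (#|S| - #|T|)%N by rewrite finset.cardsD (finset.setIidPr TS).
  case: ifP => hT.
    have hT' : (0 < #|T| <= fuel.+1)%N.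
      by case/andP: hT => T0 /leq_trans /(_ Sf); rewrite ltnS T0.
    have hD : (0 < #|S :\: T| <= fuel.+1)%N.
      case/andP: hT => T0 TS'; rewrite cD subn_gt0 TS' /= leq_subLR.
      by apply: leq_trans Sf _; rewrite -[fuel.+2]add1n leq_add2r.
    rewrite -(cut_sum1 fuel) (IH _ _ hT') (IH _ _ hD) cD.
    by rewrite /H; congr (_ * _); apply: Fext => c; rewrite addnC.
  move/negbT: hT; rewrite negb_and -!leqNgt leqn0 => /orP[|hT].
    rewrite cards_eq0 => /eqP->.
    rewrite (_ : [set t | _] = finset.set0) ?cards0 ?mul0r //.
    by apply/finset.setP => -[r par]; rewrite inE [RHS]inE; apply/tree_onP => -[]; rewrite inE.
  by move: hT; rewrite -subn_eq0 cD => /eqP->; rewrite mulr0 mul0r.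
rewrite (partition_big (fun T : {set V} => inord #|T| : 'I_(#|S|.+1)) xpredT) //=.
rewrite (eq_bigr (fun i : 'I_(#|S|.+1) => if (0 < i < #|S|)%N then 'C(#|S|, i)%:R * H i else 0)).
  rewrite -(big_mkord xpredT (fun i => if (0 < i < #|S|)%N then 'C(#|S|, i)%:R * H i else 0)).
  rewrite big_ltn //= add0r big_nat_recr //= ltnn andbF addr0.
  by apply: eq_big_nat => i /andP[-> ->]; rewrite /H !mulrA.
move=> i _; rewrite (eq_bigl (fun T : {set V} => (T \in [set A : {set V} | A \subset S & #|A| == i]) && (0 < i < #|S|)%N)).
  case: ifP => hi; last by rewrite big1 // => T; rewrite andbF.
  under eq_bigl do rewrite andbT.
  rewrite (eq_bigr (fun=> H i)) => [|T]; last by rewrite inE => /andP[_ /eqP->].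
  by rewrite sumr_const cards_draws mulr_natl.
move=> T; rewrite inE -andbA; case TS: (T \subset S) => //=.
have := subset_leq_card TS => hT; rewrite -val_eqE /= inordK ?ltnS //.
by case: eqP => [->|]; rewrite ?andbT ?andbF.
Qed.

End Trees.

Section Laws.
Variable (R : realType).
Implicit Types (J : pred nat) (f h : nat -> R).

Definition positive_jump : pred nat := fun i => (0 < i)%N.

(* The factor m: there are m^(m-1) rooted trees of size m, but only m^(m-2)
   parking functions of size m-1. *)
Definition chain J m f : R := m%:R * parking_sum J m.-1 f.

Lemma parking_sum_ext J n f g : f =1 g -> parking_sum J n f = parking_sum J n g.
Proof. by move=> fg; apply: eq_bigr. Qed.

Lemma parking_sum_linear J n (I : Type) (r : seq I) (c : I -> R) (f : I -> nat -> R) :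
  parking_sum J n (fun k => \sum_(i <- r) c i * f i k) =
  \sum_(i <- r) c i * parking_sum J n (f i).
Proof. by rewrite /parking_sum exchange_big /=; apply: eq_bigr => i _; rewrite mulr_sumr. Qed.

Lemma chain_ext J m f g : f =1 g -> chain J m f = chain J m g.
Proof. by move=> fg; rewrite /chain (parking_sum_ext _ _ fg). Qed.

Lemma chain1 J f : chain J 1 f = f 0%N.
Proof. by rewrite /chain mul1r /parking_sum /= big_cons big_nil /= addr0. Qed.

Lemma bin_swap m i : (0 < i < m)%N ->
  'C(m, i)%:R * (i * (m - i))%:R = (m * m.-1)%:R * 'C(m.-2, i.-1)%:R :> R.
Proof.
case: i m => [//|i] [|[|m]] //; rewrite ltnS /= => im.
rewrite -!natrM; congr (_ %:R).
have h1 := mul_bin_diag m.+2 i; have h2 := mul_bin_down m.+1 i; rewrite /= in h1 h2.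
by rewrite subSS -[RHS]mulnA h2 [RHS]mulnCA h1; ring.
Qed.

Lemma chain_rec J m f : J 0%N = false -> (1 < m)%N -> (m.-1)%:R * chain J m f =
  \sum_(1 <= i < m) 'C(m, i)%:R * chain J i (fun=> 1) * (m - i)%:R *
     chain J (m - i)%N (fun c => f (c + J i)%N).
Proof.
move=> J0; case: m => [|[|n]] // _; rewrite /chain /= parking_sum_rec // !mulr_sumr.
rewrite big_add1 /= big_mkord (reindex_inj rev_ord_inj) /=; apply: eq_bigr => i _.
have -> : (n.+1 - i.+1 = n - i)%N by [].
have hi : (i <= n)%N by rewrite -ltnS.
have -> : (n.+1 - (n - i) = i.+1)%N by lia.
have -> : (n - (n - i) = i)%N by lia.
have -> : ((n - i).+1 = n.+1 - i)%N by lia.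
have -> : (n.+2 - i.+1).-1 = (n - i)%N by lia.
have -> : (n.+2 - i.+1 = n.+1 - i)%N by lia.
have := @bin_swap n.+2 i.+1; rewrite /= => /(_ (ltac:(lia))).
rewrite subSS bin_sub // !natrM => E.
set A := parking_sum _ _ _; set B := parking_sum _ _ _.
transitivity ((n.+2%:R * n.+1%:R * 'C(n, i)%:R) * (n.+1 - i)%:R * (A * B)); first ring.
rewrite -E; ring.
Qed.

Lemma cut_sumE J n fuel (S : {set 'I_n}) f : J 0%N = false ->
  (0 < #|S| <= fuel.+1)%N -> cut_sum J fuel S f = chain J #|S| f.
Proof.
move=> J0 hS; apply: cut_sum_chain hS => //.
- by move=> m f1 f2; apply: chain_ext.
- by move=> f1; apply: chain1.
- by move=> m f1 m1; apply: chain_rec.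
Qed.

Definition pmean J n f : R := parking_sum J n f / parking_sum J n (fun=> 1).

Lemma sum_parking_functions n (F : seq nat -> R) :
  \sum_(t in parking_functions n) F (map val t) =
  \sum_(w <- words (iota 0 n) n | parking_word n w) F w.
Proof.
rewrite [RHS]big_mkcond -big_tuple_words big_mkcond /=; apply: eq_bigr => t _.
rewrite inE parking_wordE //; apply/allP => x /mapP[y _ ->]; exact: ltn_ord.
Qed.

Lemma pf_lawE J n stat k : (forall w, size w = n -> stat w = cluster_count J n w) ->
  pf_law R n stat k = pmean J n (fun c => (c == k)%:R).
Proof.
move=> Hs; rewrite /pf_law /pmean; congr (_ / _); last first.
  by rewrite -sumr_const; apply: (sum_parking_functions n (fun=> 1)).
rewrite -sumr_const.
under eq_bigl do rewrite inE.
rewrite big_mkcondr /=.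
rewrite (sum_parking_functions n (fun w => if stat w == k then 1 else 0)).
apply: eq_bigr => w /andP[/eqP sw _]; rewrite Hs //; by case: eqP.
Qed.

Lemma lawXE n k : lawX R n k = pmean positive_jump n (fun c => (c == k)%:R).
Proof. by apply: pf_lawE => w sw; rewrite /cluster_count sw. Qed.

Lemma lawXjE n j k : lawXj R n j k = pmean (pred1 j) n (fun c => (c == k)%:R).
Proof. by apply: pf_lawE => w sw; rewrite /cluster_count sw. Qed.

Lemma cluster_count_le J n w : (cluster_count J n w <= size w)%N.
Proof. by rewrite /cluster_count -[X in (_ <= X)%N](size_iota 0) count_size. Qed.

Lemma sum_pmean J n h :
  \sum_(k < n.+1) h k * pmean J n (fun c => (c == k)%:R) = pmean J n h.
Proof.
rewrite /pmean; under eq_bigr do rewrite mulrA.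
rewrite -mulr_suml; congr (_ / _).
rewrite -(parking_sum_linear J n _ (fun k : 'I_n.+1 => h k) (fun k c => (c == k)%:R)).
rewrite /parking_sum big_seq_cond [RHS]big_seq_cond; apply: eq_bigr => w /and3P[_ /eqP sw _].
have hc : (cluster_count J n w < n.+1)%N by rewrite ltnS -[X in (_ <= X)%N]sw cluster_count_le.
rewrite (bigD1 (Ordinal hc)) //= eqxx mulr1 big1 ?addr0 // => i.
by rewrite -val_eqE /= eq_sym => /negPf->; rewrite mulr0.
Qed.

Lemma cut_lawE J n stat k : J 0%N = false -> (0 < n)%N ->
  (forall (t : 'I_n * {ffun 'I_n -> 'I_n}) wc, wc \in cut_dist R t.1 t.2 n [set: 'I_n] -> stat wc.2 = count J wc.2) ->
  cut_law R n stat k = pmean J n.-1 (fun c => (c == k)%:R).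
Proof.
move=> J0 n0 Hs.
have cT : #|[set: 'I_n]| = n by rewrite finset.cardsT card_ord.
have E f : cut_sum J n [set: 'I_n] f = chain J n f.
  by rewrite cut_sumE // cT ?n0 /=.
have n0' : n%:R != 0 :> R by rewrite pnatr_eq0 -lt0n.
rewrite /cut_law; transitivity (chain J n (fun c => (c == k)%:R) / chain J n (fun=> 1)); last first.
  by rewrite /chain /pmean -mulf_div divff // mul1r.
rewrite -!E cut_sum1; congr (_ / _%:R); last first.
  by apply: eq_card => t; rewrite cayley_treesE inE.
apply: eq_big => [t|t _]; first exact: cayley_treesE.
rewrite /cut_mean !big_seq; apply: eq_bigr => wc hwc; rewrite (Hs t) //.
by case: eqP; rewrite ?mulr1 ?mulr0.
Qed.

Lemma cut_dist_positive n r (par : {ffun 'I_n -> 'I_n}) fuel S wc :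
  wc \in cut_dist R r par fuel S -> all positive_jump wc.2.
Proof.
elim: fuel S wc => [|fuel IH] S wc /=; first by rewrite inE => /eqP->.
have [E|[v0 [E EE]]] : [seq v <- enum S | v != r] = [::] \/ exists v0 E, [seq v <- enum S | v != r] = v0 :: E.
- by case: [seq v <- enum S | v != r] => [|v0 E]; [left|right; exists v0, E].
- by rewrite E inE => /eqP->.
rewrite {1}EE => /flattenP[s /mapP[v vE ->] /mapP[wc' /IH h ->]] /=; rewrite h andbT.
rewrite /positive_jump card_gt0; apply/finset.set0Pn; exists v.
rewrite inE in_subtreeE connect0 andbT.
by move: vE; rewrite mem_filter mem_enum => /andP[].
Qed.

Lemma lawX_lawC n k : (0 < n)%N -> lawX R n.-1 k = lawC R n k.
Proof.
move=> n0; rewrite lawXE /lawC (@cut_lawE positive_jump) // => t wc /cut_dist_positive.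
by rewrite all_count => /eqP->.
Qed.

Lemma lawXj_lawCj n j k : (0 < j < n)%N -> lawXj R n.-1 j k = lawCj R n j k.
Proof.
move=> /andP[j0 jn]; rewrite lawXjE /lawCj (@cut_lawE (pred1 j)) //.
- by case: j j0 {jn}.
- exact: leq_ltn_trans jn.
Qed.

End Laws.

(** * Power series and Abel's identity *)

(* A copy of [nat -> K] whose product is the Cauchy one, not the pointwise one. *)
Definition fps (K : comNzRingType) := nat -> K.

Section Series.
Variable K : comNzRingType.
Local Notation S := (fps K).
Implicit Types u v w : S.

HB.instance Definition _ := GRing.Zmodule.copy S (nat -> K).

Definition cauchy u v : S := fun n => \sum_(i < n.+1) u i * v (n - i)%N.
Definition series_one : S := fun n => (n == 0%N)%:R.

Lemma cauchy_poly u v N m : (m < N)%N ->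
  cauchy u v m = ((\poly_(i < N) u i) * (\poly_(i < N) v i))`_m.
Proof.
move=> mN; rewrite coefM; apply: eq_bigr => i _.
have := ltn_ord i; rewrite ltnS => im; rewrite !coef_poly.
by rewrite (leq_ltn_trans im mN) (leq_ltn_trans (leq_subr _ _) mN).
Qed.

Lemma cauchyC : commutative cauchy.
Proof. by move=> u v; apply/funext => n; rewrite !(cauchy_poly _ _ (ltnSn n)) mulrC. Qed.

Lemma cauchyA : associative cauchy.
Proof.
move=> u v w; apply/funext => n.
have E x y z : cauchy x (cauchy y z) n = ((\poly_(i < n.+1) x i) *
    ((\poly_(i < n.+1) y i) * (\poly_(i < n.+1) z i)))`_n.
  rewrite [RHS]coefM; apply: eq_bigr => i _; rewrite coef_poly ltn_ord.
  by rewrite (@cauchy_poly _ _ n.+1) // ltnS leq_subr.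
by rewrite E [cauchy _ w]cauchyC E mulrA [in RHS]mulrC.
Qed.

Lemma cauchy1 : left_id series_one cauchy.
Proof.
move=> u; apply/funext => n; rewrite /cauchy big_ord_recl big1 ?addr0.
  by rewrite /series_one mul1r subn0.
by move=> i _; rewrite /series_one mul0r.
Qed.

Lemma cauchyDl : left_distributive cauchy +%R.
Proof.
move=> u v w; apply/funext => n.
rewrite -[RHS]/(cauchy u w n + cauchy v w n) /cauchy -big_split.
by apply: eq_bigr => i _; rewrite mulrDl.
Qed.

Lemma series_one_neq0 : series_one != 0 :> S.
Proof.
apply/eqP => /(congr1 (fun f : S => f 0%N)); rewrite /series_one eqxx.
by move/eqP; rewrite (negPf (oner_neq0 _)).
Qed.

HB.instance Definition _ := GRing.Zmodule_isComNzRing.Build S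
  cauchyA cauchyC cauchy1 cauchyDl series_one_neq0.

Lemma mulsE u v n : (u * v) n = \sum_(i < n.+1) u i * v (n - i)%N.
Proof. by []. Qed.
Lemma ones n : (1 : S) n = (n == 0%N)%:R. Proof. by []. Qed.
Lemma addsE u v n : (u + v) n = u n + v n. Proof. by []. Qed.
Lemma oppsE u n : (- u) n = - u n. Proof. by []. Qed.
Lemma natsE u k n : (u *+ k) n = u n *+ k.
Proof. by elim: k => [|k IH]; rewrite ?mulr0n // !mulrS addsE IH. Qed.

Definition sderiv u : S := fun n => n%:R * u n.

Lemma sderivM u v : sderiv (u * v) = sderiv u * v + u * sderiv v.
Proof.
apply/funext => n; rewrite addsE !mulsE /sderiv mulsE mulr_sumr -big_split.
apply: eq_bigr => i _ /=; have hi : (i <= n)%N by rewrite -ltnS.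
have -> : n%:R = i%:R + (n - i)%:R :> K by rewrite -natrD subnKC.
ring.
Qed.

Lemma sderivX u k : sderiv (u ^+ k.+1) = u ^+ k * sderiv u *+ k.+1.
Proof.
elim: k => [|k IH]; first by rewrite expr1 expr0 mul1r.
rewrite exprS sderivM IH -[in RHS]mulr_natl [in RHS]mulrSr exprS -mulr_natl; ring.
Qed.

End Series.

Section Abel.
Variable R : realType.

Lemma alternating_binomial_sum n m : (m < n)%N ->
  \sum_(k < n.+1) 'C(n, k)%:R * (-1) ^+ k * k%:R ^+ m = 0 :> R.
Proof.
elim/ltn_ind: m n => -[|m] IH n mn.
  transitivity ((1 - 1) ^+ n : R); last by rewrite subrr expr0n; case: n mn.
  rewrite exprDn; apply: eq_bigr => k _.
  by rewrite expr0 expr1n mulr1 mul1r mulr_natl.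
case: n mn => // n mn; rewrite big_ord_recl /= expr0n /= mulr0 add0r.
transitivity (- n.+1%:R * \sum_(k < n.+1) 'C(n, k)%:R * (-1) ^+ k * (1 + k%:R) ^+ m : R).
  rewrite mulr_sumr; apply: eq_bigr => k _; rewrite /bump leq0n add1n.
  have E : n.+1%:R * 'C(n, k)%:R = k.+1%:R * 'C(n.+1, k.+1)%:R :> R.
    by rewrite -!natrM mul_bin_diag.
  have K1 : k.+1%:R = k%:R + 1 :> R by rewrite natr1.
  rewrite [_ ^+ m.+1]exprS exprS [1 + _]addrC.
  transitivity (- (n.+1%:R * 'C(n, k)%:R) * (-1) ^+ k * (k%:R + 1) ^+ m : R); last ring.
  rewrite E K1; ring.
under eq_bigr do rewrite exprDn mulr_sumr.
rewrite exchange_big /= big1 ?mulr0 // => i _.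
under eq_bigr do rewrite expr1n mul1r mulrnAr -mulr_natl.
rewrite -mulr_sumr IH ?mulr0 //.
by have := ltn_ord i; lia.
Qed.

Definition abel_poly n : {poly R} :=
  \sum_(k < n) ('C(n, k.+1)%:R * k.+1%:R ^+ k) *: ('X - k.+1%:R%:P) ^+ (n - k.+1).

Lemma poly_eq_deriv (p q : {poly R}) : p^`() = q^`() -> p.[0] = q.[0] -> p = q.
Proof.
move=> d0 h0; apply/eqP; rewrite -subr_eq0; set r := p - q.
have r0 : r^`() = 0 by rewrite derivB d0 subrr.
have h : r.[0] = 0 by rewrite hornerD hornerN h0 subrr.
apply/eqP/polyP => -[|i]; first by rewrite coef0 -horner_coef0.
have /(congr1 (fun s : {poly R} => s`_i)) := r0; rewrite coef_deriv !coef0 => /eqP.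
by rewrite mulrn_eq0 /= => /eqP.
Qed.

Lemma abel_polyE n : (0 < n)%N -> abel_poly n = n%:R *: 'X ^+ n.-1.
Proof.
elim: n => // -[|n] IH _.
  by rewrite /abel_poly big_ord1 !expr0 binn mulr1.
apply: poly_eq_deriv.
  rewrite derivZ derivXn /= /abel_poly raddf_sum /= big_ord_recr /=.
  have D1 : (1 : {poly R})^`() = 0 by rewrite -polyC1 derivC.
  rewrite subnn expr0 derivZ D1 scaler0 addr0.
  transitivity (n.+2%:R *: abel_poly n.+1).
    rewrite /abel_poly scaler_sumr; apply: eq_bigr => k _.
    have := ltn_ord k; rewrite ltnS => kn.
    rewrite derivZ deriv_exp derivXsubC mul1r -[X in _ *: X = _]scaler_nat !scalerA; congr (_ *: _ ^+ _); last lia.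
    have E := mul_bin_down n.+2 k.+1; rewrite /= in E.
    transitivity ((n.+2 - k.+1)%:R * 'C(n.+2, k.+1)%:R * k.+1%:R ^+ k : R); first ring.
    by rewrite -natrM -E natrM mulrA.
  by rewrite IH // !scaler_nat.
rewrite hornerZ hornerXn expr0n /= mulr0 /abel_poly horner_sum.
transitivity ((-1) ^+ n.+2 * \sum_(k < n.+3) 'C(n.+2, k)%:R * (-1) ^+ k * k%:R ^+ n.+1 : R); last first.
  by rewrite alternating_binomial_sum ?mulr0.
rewrite [in RHS]big_ord_recl /= expr0n /= mulr0 add0r mulr_sumr.
apply: eq_bigr => k _; rewrite /bump leq0n add1n hornerZ horner_exp !hornerE /= ?sub0r.
have kn : (k.+1 <= n.+2)%N by exact: ltn_ord.
rewrite [(- k.+1%:R) ^+ _]exprNn.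
have -> : (-1) ^+ n.+2 = (-1) ^+ k.+1 * (-1) ^+ (n.+2 - k.+1) :> R.
  by rewrite -exprD subnKC.
have -> : k.+1%:R ^+ n.+1 = k.+1%:R ^+ k * k.+1%:R ^+ (n.+2 - k.+1) :> R.
  by rewrite -exprD; congr (_ ^+ _); lia.
have E : (-1) ^+ k.+1 * (-1) ^+ k.+1 = 1 :> R by rewrite -expr2 sqrr_sign.
transitivity ((-1) ^+ k.+1 * (-1) ^+ k.+1 * ('C(n.+2, k.+1)%:R * k.+1%:R ^+ k * ((-1) ^+ (n.+2 - k.+1) * k.+1%:R ^+ (n.+2 - k.+1))) : R); last ring.
by rewrite E mul1r.
Qed.

Lemma abel_sum n : (0 < n)%N ->
  \sum_(k < n) 'C(n, k.+1)%:R * k.+1%:R ^+ k * (n - k.+1)%:R ^+ (n - k.+1) = n%:R ^+ n :> R.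
Proof.
move=> n0; have := congr1 (fun p => p.[n%:R]) (abel_polyE n0).
rewrite hornerZ hornerXn -exprS prednK // => <-; rewrite /abel_poly horner_sum.
apply: eq_bigr => k _; rewrite hornerZ horner_exp !hornerE natrB //.
Qed.

(* The tree function T and 1 / (1 - T). *)
Definition ser_t : fps R := fun n => if n is m.+1 then n%:R ^+ m / n`!%:R else 0.
Definition ser_a : fps R := fun n => n%:R ^+ n / n`!%:R.

Lemma fact_neq0 n : n`!%:R != 0 :> R. Proof. by rewrite pnatr_eq0 -lt0n fact_gt0. Qed.

Lemma bin_fact_div n k : (k <= n)%N -> 'C(n, k)%:R = n`!%:R / (k`!%:R * (n - k)`!%:R) :> R.
Proof. by move=> kn; rewrite -natrM -(bin_fact kn) natrM mulfK // natrM mulf_neq0 ?fact_neq0. Qed.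

Lemma ser_a0 : ser_a 0%N = 1. Proof. by rewrite /ser_a expr0 fact0 divr1. Qed.

Lemma ser_ta : ser_t * ser_a = ser_a - 1.
Proof.
apply/funext => -[|n]; rewrite addsE oppsE ones.
  by rewrite mulsE big_ord1 mul0r ser_a0 subrr.
rewrite subr0 mulsE big_ord_recl mul0r add0r /ser_a -(abel_sum (ltn0Sn n)) mulr_suml.
apply: eq_bigr => k _; rewrite /= /bump leq0n add1n.
have kn : (k.+1 <= n.+1)%N by exact: ltn_ord.
rewrite (bin_fact_div kn) -!mulrA; have := fact_neq0 n.+1; have := fact_neq0 k.+1.
have := fact_neq0 (n.+1 - k.+1); move=> h1 h2 h3; field.
by rewrite h1 h2 h3.
Qed.

Lemma sderiv_t : sderiv ser_t = ser_a - 1.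
Proof.
apply/funext => -[|n]; rewrite /sderiv addsE oppsE ones.
  by rewrite mul0r ser_a0 subrr.
by rewrite subr0 /ser_t /ser_a mulrA -exprS.
Qed.

Lemma sderiv_a : sderiv ser_a = ser_a ^+ 3 - ser_a ^+ 2.
Proof.
have E := congr1 (@sderiv R) ser_ta.
have D1 : sderiv (1 : fps R) = 0.
  by apply/funext => -[|n]; rewrite /sderiv ones ?mul0r ?mulr0.
have Dsub (u v : fps R) : sderiv (u - v) = sderiv u - sderiv v.
  by apply/funext => n; rewrite /sderiv !addsE !oppsE mulrBr.
rewrite sderivM Dsub D1 subr0 sderiv_t in E.
have h : ser_a * (1 - ser_t) = 1 by rewrite mulrBr mulr1 [_ * ser_t]mulrC ser_ta; ring.
transitivity (ser_a * (1 - ser_t) * sderiv ser_a); first by rewrite h mul1r.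
have -> : ser_a * (1 - ser_t) * sderiv ser_a = ser_a * (sderiv ser_a - ser_t * sderiv ser_a) by ring.
rewrite -{1}E; ring.
Qed.

Lemma ser_aX_rec s N : N%:R * (ser_a ^+ s.+1) N =
  s.+1%:R * ((ser_a ^+ s.+3) N - (ser_a ^+ s.+2) N).
Proof.
rewrite -[LHS]/(sderiv (ser_a ^+ s.+1) N) sderivX natsE sderiv_a -[LHS]mulr_natl; congr (_ * _).
have -> : ser_a ^+ s * (ser_a ^+ 3 - ser_a ^+ 2) = ser_a ^+ s.+3 - ser_a ^+ s.+2.
  by rewrite mulrBr -!exprD !addnS addn0.
by rewrite addsE oppsE.
Qed.


End Abel.

(** * Growth of the tree series *)

Lemma eq_imp_le (R : numDomainType) (x y : R) : x = y -> x <= y.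
Proof. by move=> ->. Qed.

Section ExpBounds.
Variable R : realType.
Implicit Types x y z : R.

Lemma ge0_derive_le (f df : R -> R) y :
  (forall x, is_derive x 1 f (df x)) -> (forall x, 0 <= x -> 0 <= df x) ->
  0 <= y -> f 0 <= f y.
Proof.
move=> fdf df0 y0.
have [|c /itvP c0y E] := MVT_segment y0 (fun x _ => fdf x).
  by apply: derivable_within_continuous => x _; apply: ex_derive.
by rewrite -subr_ge0 E mulr_ge0 ?subr0 // df0 // c0y.
Qed.

Lemma sinh_ge z : 0 <= z -> 2 * z <= expR z - expR (- z).
Proof.
move=> z0; pose f x : R := expR x - expR (- x) - 2 * x.
have := @ge0_derive_le f (fun x => expR x + expR (- x) - 2) z.
rewrite /f oppr0 mulr0 !subrr subr_ge0; apply=> // [x|x _].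
  by apply: is_derive_eq; rewrite /GRing.scale /=; ring.
rewrite expRN; have := expR_gt0 x; set e := expR x => e0.
have -> : e + e^-1 - 2 = (e - 1) ^+ 2 / e by field; rewrite gt_eqF.
by rewrite divr_ge0 ?sqr_ge0 // ltW.
Qed.

Lemma expR_le_pade y : 0 <= y -> (1 - y / 2) * expR y <= 1 + y / 2.
Proof.
move=> y0; pose f x : R := 1 + x / 2 - (1 - x / 2) * expR x.
have := @ge0_derive_le f (fun x => (1 - expR x * (1 - x)) / 2) y.
rewrite /f mul0r addr0 subr0 mul1r expR0 subrr subr_ge0; apply=> // [x|x _].
  by apply: is_derive_eq; rewrite /GRing.scale /=; lra.
rewrite divr_ge0 // subr_ge0 -[leRHS](expRxMexpNx_1 x) ler_pM2l ?expR_gt0 //.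
by have := expR_ge1Dx (- x).
Qed.

End ExpBounds.

Section TreeSeries.
Variable R : realType.
Local Notation a := (ser_a R).
Local Notation e := (expR 1 : R).

Definition alpha n : R := a n * expR (- n%:R).

Lemma ser_a_gt0 n : 0 < a n.
Proof.
rewrite /ser_a divr_gt0 ?ltr0n ?fact_gt0 //.
by case: n => [|n]; rewrite ?expr0 // exprn_gt0 // ltr0n.
Qed.

Lemma alpha_gt0 n : 0 < alpha n.
Proof. by rewrite mulr_gt0 ?ser_a_gt0 ?expR_gt0. Qed.

Lemma alphaS n : alpha n.+2 = alpha n.+1 * ((n.+2%:R / n.+1%:R) ^+ n.+1 / e).
Proof.
have n1 : (n.+1%:R : R) != 0 by rewrite pnatr_eq0.
have n2 : (n.+2%:R : R) != 0 by rewrite pnatr_eq0.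
have h := fact_neq0 R n.+1; have he : e != 0 by rewrite gt_eqF ?expR_gt0.
have hp : n.+1%:R ^+ n.+1 != 0 :> R by rewrite expf_neq0.
have Ea : a n.+2 = n.+2%:R ^+ n.+1 / n.+1`!%:R.
  rewrite /ser_a factS natrM exprS; move: h n2; set u := n.+2%:R; set v := _`!%:R => h n2.
  by rewrite invfM mulrACA divff // mul1r.
have -> : alpha n.+2 = n.+2%:R ^+ n.+1 / n.+1`!%:R * (expR (- n.+1%:R) / e).
  rewrite /alpha Ea; congr (_ * _).
  by rewrite -expRN -expRD; congr expR; rewrite -[n.+2%:R]natr1; ring.
rewrite /alpha /ser_a [in RHS]expr_div_n.
move: h hp; set u := n.+1%:R ^+ _; set v := _`!%:R; set w := n.+2%:R ^+ _; set E := expR (- _) => h hp.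
by field; rewrite h he hp.
Qed.

Lemma alpha0 : alpha 0 = 1.
Proof. by rewrite /alpha ser_a0 mul1r oppr0 expR0. Qed.

Lemma alpha1 : alpha 1 = e^-1.
Proof. by rewrite /alpha /ser_a expr1n factS fact0 muln1 divr1 mul1r expRN. Qed.

Lemma alpha_up n : alpha n.+1 ^+ 2 * n.+1%:R <= alpha n.+2 ^+ 2 * n.+2%:R.
Proof.
rewrite alphaS; set x : R := n.+1%:R; have x0 : 0 < x by rewrite ltr0n.
have -> : n.+2%:R = x + 1 :> R by rewrite /x natr1.
have E := @expR_le_pade R (2 / (2 * x + 1)) (ltac:(by rewrite divr_ge0 //; lra)).
have {}E : expR (2 / (2 * x + 1)) <= (x + 1) / x.
  have h : 0 < x / (2 * x + 1) * 2 by rewrite mulr_gt0 ?divr_gt0 //; lra.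
  rewrite -(ler_pM2l h); apply: le_trans (_ : _ <= 1 + 2 / (2 * x + 1) / 2) _.
    apply: le_trans E; apply: eq_imp_le; field; lra.
  by apply: eq_imp_le; field; apply/andP; split; lra.
have {}E : e ^+ 2 <= ((x + 1) / x) ^+ (2 * n.+1)%N.+1.
  apply: le_trans (_ : expR (2 / (2 * x + 1)) ^+ (2 * n.+1)%N.+1 <= _); last first.
    by apply: lerXn2r E; rewrite nnegrE ?expR_ge0 // divr_ge0 //; lra.
  rewrite -expRM_natl -expRM_natl -[(2 * _)%N.+1%:R]natr1 natrM -/x ler_expR.
  by rewrite mulr1 mulrCA divff ?mulr1 //; apply: lt0r_neq0; lra.
have -> (c d : R) : (c * (d / e)) ^+ 2 * (x + 1) = c ^+ 2 * (d ^+ 2 * (x + 1) / e ^+ 2).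
  by field; rewrite gt_eqF ?expR_gt0.
rewrite ler_pM2l ?exprn_gt0 ?alpha_gt0 // ler_pdivlMr ?exprn_gt0 ?expR_gt0 //.
move: E; rewrite [X in _ <= X -> _]exprSr mulnC exprM => E; rewrite mulrC -ler_pdivlMr //.
by rewrite -mulrA.
Qed.

Lemma alpha_down n : alpha n.+1 ^+ 2 * n.+2%:R <= alpha n ^+ 2 * n.+1%:R.
Proof.
case: n => [|n].
  rewrite alpha0 alpha1 exprVn expr1n mulr1.
  rewrite ler_pdivrMl ?exprn_gt0 ?expR_gt0 // mulr1.
  have := expR_ge1Dx (1 : R) => h; rewrite expr2; nra.
rewrite alphaS; set x : R := n.+1%:R; have x0 : 0 < x by rewrite ltr0n.
have -> : n.+2%:R = x + 1 :> R by rewrite /x natr1.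
have -> : n.+3%:R = x + 2 :> R by rewrite -[n.+3%:R]natr1 -[n.+2%:R]natr1 -/x; ring.
have E1 : ((x + 1) / x) <= expR ((2 * x + 1) / (2 * x * (x + 1))).
  have u1 : 1 <= (x + 1) / x by rewrite ler_pdivlMr //; lra.
  have u0 : 0 < (x + 1) / x := lt_le_trans ltr01 u1.
  rewrite -[leLHS](lnK u0) ler_expR.
  have := sinh_ge (ln_ge0 u1); rewrite expRN lnK // => h.
  rewrite -(ler_pM2l (ltr0n R 2)); apply: le_trans h _.
  by apply: eq_imp_le; field; apply/andP; split; lra.
have E2 : (x + 2) / (x + 1) <= expR ((x + 1)^-1).
  apply: le_trans (expR_ge1Dx _); apply: eq_imp_le; field; lra.
have E : ((x + 1) / x) ^+ (n.+1 * 2)%N * ((x + 2) / (x + 1)) <= e ^+ 2.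
  apply: le_trans (_ : expR ((2 * x + 1) / (2 * x * (x + 1))) ^+ (n.+1 * 2)%N * expR ((x + 1)^-1) <= _).
    apply: ler_pM => //; rewrite ?exprn_ge0 ?divr_ge0 //; try lra.
    by apply: lerXn2r E1; rewrite nnegrE ?expR_ge0 // divr_ge0 //; lra.
  rewrite -!expRM_natl -expRD ler_expR natrM -/x.
  apply: eq_imp_le; field; apply/andP; split; lra.
have -> (c d : R) : (c * (d / e)) ^+ 2 * (x + 2) = c ^+ 2 * (d ^+ 2 * (x + 2) / e ^+ 2).
  by field; rewrite gt_eqF ?expR_gt0.
rewrite ler_pM2l ?exprn_gt0 ?alpha_gt0 // ler_pdivrMr ?exprn_gt0 ?expR_gt0 //.
rewrite exprM mulrA in E; rewrite [leRHS]mulrC -ler_pdivrMr; lra.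
Qed.

Lemma alpha_le k : alpha k ^+ 2 * k.+1%:R <= 1.
Proof.
elim: k => [|k IH]; last exact: le_trans (alpha_down k) IH.
by rewrite alpha0 expr1n mulr1.
Qed.

Lemma alpha_ge k : e^-1 ^+ 2 <= alpha k.+1 ^+ 2 * k.+1%:R.
Proof.
elim: k => [|k IH]; last exact: le_trans IH (alpha_up k).
by rewrite alpha1 mulr1.
Qed.

Definition Qn n : R := Num.sqrt n.+1%:R.

Lemma Qn_gt0 n : 0 < Qn n. Proof. by rewrite sqrtr_gt0. Qed.
Lemma Qn_ge0 n : 0 <= Qn n. Proof. exact: sqrtr_ge0. Qed.
Lemma Qn_ge1 n : 1 <= Qn n.
Proof. by rewrite -[leLHS]sqrtr1 ler_sqrt // ler1n. Qed.
Lemma Qn_sqr n : Qn n ^+ 2 = n.+1%:R. Proof. by rewrite sqr_sqrtr. Qed.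
Lemma Qn_le m n : (m <= n)%N -> Qn m <= Qn n.
Proof. by move=> mn; rewrite ler_sqrt // ler_nat. Qed.

Lemma alpha_Qn_le k : alpha k * Qn k <= 1.
Proof.
have h : 0 <= alpha k * Qn k by rewrite mulr_ge0 ?ltW ?alpha_gt0 ?Qn_gt0.
by rewrite -(expr_le1 (n := 2)) // exprMn Qn_sqr alpha_le.
Qed.

Lemma alpha_Qn_ge k : e^-1 <= alpha k * Qn k.
Proof.
have h : 0 <= alpha k * Qn k by rewrite mulr_ge0 ?ltW ?alpha_gt0 ?Qn_gt0.
rewrite -(@ler_pXn2r _ 2) ?nnegrE ?invr_ge0 ?expR_ge0 // exprMn Qn_sqr.
case: k {h} => [|k].
  rewrite alpha0 expr1n mulr1 exprVn invf_le1 ?exprn_gt0 ?expR_gt0 //.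
  by rewrite -expRM_natl -[leLHS]expR0 ler_expR mulr1.
apply: le_trans (alpha_ge k) _; rewrite ler_pM2l ?exprn_gt0 ?alpha_gt0 //.
by rewrite ler_nat.
Qed.

Lemma ser_aE n : a n = alpha n * expR n%:R.
Proof. by rewrite /alpha -mulrA -expRD addNr expR0 mulr1. Qed.

Lemma ser_a_le n : a n <= expR n%:R / Qn n.
Proof.
rewrite ser_aE mulrC ler_pM2l ?expR_gt0 // -[_^-1]mul1r.
by rewrite ler_pdivlMr ?Qn_gt0 // alpha_Qn_le.
Qed.

Lemma expR_le_ser_a n : expR n%:R <= e * Qn n * a n.
Proof.
rewrite ser_aE mulrA ler_peMl ?expR_ge0 // -mulrA [Qn n * _]mulrC.
by rewrite -ler_pdivrMl ?expR_gt0 // mulr1 alpha_Qn_ge.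
Qed.

End TreeSeries.

Section Convolution.
Variable R : realType.
Implicit Types u v w : fps R.
Local Notation a := (ser_a R).
Local Notation e := (expR 1 : R).
Local Notation Q := (Qn R).

Lemma smul_ge0 u v n : (forall k, 0 <= u k) -> (forall k, 0 <= v k) -> 0 <= (u * v) n.
Proof. by move=> hu hv; rewrite mulsE; apply: sumr_ge0 => i _; rewrite mulr_ge0. Qed.

Lemma sX_ge0 u s n : (forall k, 0 <= u k) -> 0 <= (u ^+ s) n.
Proof.
move=> hu; elim: s n => [|s IH] n; first by rewrite expr0 ones ler0n.
by rewrite exprS smul_ge0.
Qed.

Lemma ser_a_ge0 n : 0 <= a n. Proof. exact/ltW/ser_a_gt0. Qed.

Lemma ser_a1 n : (a - 1) n = if n is 0%N then 0 else a n.
Proof. by rewrite addsE oppsE ones; case: n => [|n]; rewrite ?ser_a0 ?subrr ?subr0. Qed.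

Lemma ser_a1_bounds n : 0 <= (a - 1) n <= a n.
Proof. by rewrite ser_a1; case: n => [|n]; rewrite ?ser_a_ge0 ?lexx. Qed.

Lemma ser_a1_ge0 n : 0 <= (a - 1) n.
Proof. by case/andP: (ser_a1_bounds n). Qed.

Lemma sum_invQ n : \sum_(i < n.+1) (Q i)^-1 <= 2 * Q n.
Proof.
elim: n => [|n IH]; first by rewrite big_ord1 /Qn sqrtr1 invr1; lra.
rewrite big_ord_recr /=; apply: le_trans (lerD IH _) _; first exact: lexx.
have E : Q n.+1 ^+ 2 = Q n ^+ 2 + 1 by rewrite !Qn_sqr natr1.
have h0 := Qn_gt0 R n; have h1 := Qn_gt0 R n.+1; have h := @Qn_le R n n.+1 (leqnSn n).
rewrite -lerBrDl -(ler_pM2l h1) divff ?gt_eqF //; nra.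
Qed.

Lemma sum_rev_invQ n : \sum_(i < n.+1) (Q (n - i)%N)^-1 <= 2 * Q n.
Proof.
rewrite (reindex_inj rev_ord_inj) /= (eq_bigr (fun i : 'I_n.+1 => (Q i)^-1)) ?sum_invQ //.
by move=> i _; rewrite subSS subKn // -ltnS.
Qed.

Definition rn n : R := Num.sqrt (Q n).
Lemma rn_gt0 n : 0 < rn n. Proof. by rewrite sqrtr_gt0 Qn_gt0. Qed.
Lemma rn_sqr n : rn n ^+ 2 = Q n. Proof. by rewrite sqr_sqrtr ?ltW ?Qn_gt0. Qed.
Lemma rn_ge1 n : 1 <= rn n.
Proof. by rewrite -[leLHS]sqrtr1 ler_sqrt ?Qn_ge0 // Qn_ge1. Qed.
Lemma rn_le m n : (m <= n)%N -> rn m <= rn n.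
Proof. by move=> mn; rewrite ler_sqrt ?Qn_ge0 // Qn_le. Qed.

Lemma sum_invQ2 n : \sum_(i < n.+1) (Q i ^+ 2)^-1 <= 4 * rn n.
Proof.
elim: n => [|n IH].
  by rewrite big_ord1 /rn /Qn !sqrtr1 expr1n invr1; lra.
rewrite big_ord_recr /=; apply: le_trans (lerD IH _) _; first exact: lexx.
have E : rn n.+1 ^+ 4 = rn n ^+ 4 + 1.
  by rewrite -[4%N]/(2 * 2)%N !exprM !rn_sqr !Qn_sqr natr1.
have h0 := rn_gt0 n; have h1 := rn_ge1 n.+1; have h := @rn_le n n.+1 (leqnSn n).
rewrite -rn_sqr -exprM -lerBrDl -mulrBr.
move: E h0 h1 h; set x := rn n; set y := rn n.+1 => E x0 y1 xy.
have y0 : 0 < y by lra.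
rewrite -(ler_pM2l (exprn_gt0 4 y0)) divff ?gt_eqF ?exprn_gt0 //.
have E1 : 1 = (y - x) * ((y + x) * (y ^+ 2 + x ^+ 2)) :> R.
  transitivity (y ^+ 4 - x ^+ 4); [by rewrite E; ring|ring].
rewrite [leLHS]E1.
have -> : y ^+ 4 * (4 * (y - x)) = (y - x) * (y ^+ 4 * 4) by ring.
apply: ler_wpM2l; first by rewrite subr_ge0.
have k1 : (y + x) * (y ^+ 2 + x ^+ 2) <= (y + y) * (y ^+ 2 + y ^+ 2).
  apply: ler_pM; rewrite ?addr_ge0 ?sqr_ge0 ?(ltW x0) ?(ltW y0) ?lerD2l //.
  by rewrite ler_pXn2r // nnegrE ltW.
apply: le_trans k1 _; have -> : (y + y) * (y ^+ 2 + y ^+ 2) = y ^+ 3 * 4 by ring.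
by rewrite ler_pM2r // [leRHS]exprSr ler_peMr // exprn_ge0 // ltW.
Qed.

Lemma Qn_split n (i : 'I_n.+1) : Q i ^+ 2 + Q (n - i)%N ^+ 2 = n.+2%:R.
Proof.
rewrite !Qn_sqr -natrD; congr (_%:R); have := ltn_ord i; lia.
Qed.

Lemma sum_invQQ n : \sum_(i < n.+1) (Q i * Q (n - i)%N)^-1 <= 4.
Proof.
have n2 : (0 : R) < n.+2%:R by rewrite ltr0n.
have Qp := Qn_gt0 R.
apply: le_trans (_ : \sum_(i < n.+1) Q n / n.+2%:R * ((Q i)^-1 + (Q (n - i)%N)^-1) <= _).
  apply: ler_sum => i _; have E := Qn_split i.
  have hi : Q i <= Q n by apply: Qn_le; rewrite -ltnS.
  have hj : Q (n - i)%N <= Q n by apply: Qn_le; apply: leq_subr.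
  rewrite -E in n2 *; have := Qp i; have := Qp (n - i)%N.
  move: hi hj n2; set x := Q i; set y := Q (n - i)%N; set q := Q n => hi hj n2 y0 x0.
  have -> : q / (x ^+ 2 + y ^+ 2) * (x^-1 + y^-1) = (q * x + q * y) / (x ^+ 2 + y ^+ 2) / (x * y).
    by field; rewrite !gt_eqF.
  rewrite -[leLHS]mul1r ler_pM2r ?invr_gt0 ?mulr_gt0 // ler_pdivlMr // mul1r.
  nra.
rewrite -mulr_sumr big_split /=.
have h := sum_invQ n; have h' := sum_rev_invQ n; have q0 := Qp n.
apply: le_trans (_ : Q n / n.+2%:R * (2 * Q n + 2 * Q n) <= _).
  by apply: ler_wpM2l; [rewrite divr_ge0 // ltW|exact: lerD].
have -> : Q n / n.+2%:R * (2 * Q n + 2 * Q n) = 4 * (Q n ^+ 2 / n.+2%:R).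
  by field; rewrite gt_eqF.
rewrite -[leRHS]mulr1 ler_pM2l // ler_pdivrMr // mul1r Qn_sqr ler_nat //.
Qed.

Lemma sum_invQQ2 n : \sum_(i < n.+1) (Q (n - i)%N * Q i ^+ 2)^-1 <= 6 * rn n / Q n.
Proof.
have n2 : (0 : R) < n.+2%:R by rewrite ltr0n.
have Qp := Qn_gt0 R.
apply: le_trans (_ : \sum_(i < n.+1) (Q n / n.+2%:R * (Q i ^+ 2)^-1 +
    n.+2%:R^-1 * (Q (n - i)%N)^-1) <= _).
  apply: ler_sum => i _; have E := Qn_split i.
  have hj : Q (n - i)%N <= Q n by apply: Qn_le; apply: leq_subr.
  rewrite -E in n2 *; have := Qp i; have := Qp (n - i)%N.
  move: hj n2; set x := Q i; set y := Q (n - i)%N; set q := Q n => hj n2 y0 x0.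
  have -> : q / (x ^+ 2 + y ^+ 2) / x ^+ 2 + (x ^+ 2 + y ^+ 2)^-1 / y =
     (q * y + x ^+ 2) / (x ^+ 2 + y ^+ 2) / (y * x ^+ 2).
    by field; rewrite !gt_eqF.
  rewrite -[leLHS]mul1r ler_pM2r ?invr_gt0 ?mulr_gt0 ?exprn_gt0 // ler_pdivlMr // mul1r.
  nra.
rewrite big_split /= -!mulr_sumr.
have h := sum_rev_invQ n; have h' := sum_invQ2 n; have q0 := Qp n; have r1 := rn_ge1 n.
apply: le_trans (_ : Q n / n.+2%:R * (4 * rn n) + n.+2%:R^-1 * (2 * Q n) <= _).
  by apply: lerD; apply: ler_wpM2l => //; rewrite ?invr_ge0 ?divr_ge0 ?ltW.
have -> : Q n / n.+2%:R * (4 * rn n) + n.+2%:R^-1 * (2 * Q n) = (4 * rn n + 2) * Q n ^+ 2 / n.+2%:R / Q n.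
  by field; rewrite !gt_eqF.
rewrite ler_pM2r ?invr_gt0 // ler_pdivrMr // Qn_sqr.
by apply: ler_pM; rewrite ?ler_nat //; lra.
Qed.

Lemma ser_aa_le n : (a * a) n <= 4 * expR n%:R.
Proof.
rewrite mulsE mulrC; apply: le_trans (_ : expR n%:R * \sum_(i < n.+1) (Q i * Q (n - i)%N)^-1 <= _).
  rewrite mulr_sumr; apply: ler_sum => i _.
  have -> : expR n%:R / (Q i * Q (n - i)%N) = (expR i%:R / Q i) * (expR (n - i)%:R / Q (n - i)%N).
    by rewrite mulf_div -expRD -natrD subnKC // -ltnS.
  by apply: ler_pM; rewrite ?ser_a_ge0 ?ser_a_le.
by rewrite ler_pM2l ?expR_gt0 // sum_invQQ.
Qed.

Lemma ser_aa_leQ n : (a * a) n <= 4 * e * (Q n * a n).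
Proof.
apply: le_trans (ser_aa_le n) _; rewrite -mulrA ler_pM2l // mulrA.
exact: expR_le_ser_a.
Qed.

Lemma ser_aaQ_le n : \sum_(i < n.+1) a i / Q i * a (n - i)%N <= 6 * e * (rn n * a n).
Proof.
apply: le_trans (_ : expR n%:R * \sum_(i < n.+1) (Q (n - i)%N * Q i ^+ 2)^-1 <= _).
  rewrite mulr_sumr; apply: ler_sum => i _.
  have -> : expR n%:R / (Q (n - i)%N * Q i ^+ 2) = (expR i%:R / Q i / Q i) * (expR (n - i)%:R / Q (n - i)%N).
    rewrite mulrAC mulf_div -expRD -natrD subnKC; last by rewrite -ltnS.
    by field; rewrite !gt_eqF ?Qn_gt0.
  apply: ler_pM; [|exact: ser_a_ge0| |exact: ser_a_le].
    by rewrite divr_ge0 ?ser_a_ge0 ?Qn_ge0.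
  by rewrite ler_pM2r ?invr_gt0 ?Qn_gt0 ?ser_a_le.
apply: le_trans (_ : expR n%:R * (6 * rn n / Q n) <= _).
  by rewrite ler_pM2l ?expR_gt0 // sum_invQQ2.
apply: le_trans (_ : e * Q n * a n * (6 * rn n / Q n) <= _).
  by apply: ler_wpM2r (expR_le_ser_a R n); rewrite ?divr_ge0 ?mulr_ge0 ?ltW ?Qn_gt0 ?rn_gt0.
by apply: eq_imp_le; field; rewrite gt_eqF ?Qn_gt0.
Qed.

Lemma ser_aX_le s n : (a ^+ s.+1) n <= (4 * e) ^+ s * Q n ^+ s * a n.
Proof.
elim: s n => [|s IH] n; first by rewrite expr1 !expr0 !mul1r.
rewrite exprS mulrC mulsE.
apply: le_trans (_ : \sum_(i < n.+1) ((4 * e) ^+ s * Q n ^+ s) * (a i * a (n - i)%N) <= _).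
  apply: ler_sum => i _; rewrite [leRHS]mulrA; apply: ler_wpM2r; first exact: ser_a_ge0.
  apply: le_trans (IH i) _; apply: ler_wpM2r; first exact: ser_a_ge0.
  apply: ler_wpM2l; first by rewrite exprn_ge0 // mulr_ge0 // expR_ge0.
  by apply: lerXn2r; rewrite ?nnegrE ?Qn_ge0 // Qn_le // -ltnS.
rewrite -mulr_sumr -mulsE; set c := _ * Q n ^+ s.
apply: le_trans (_ : c * (4 * e * (Q n * a n)) <= _).
  apply: ler_wpM2l (ser_aa_leQ n); apply: mulr_ge0; apply: exprn_ge0.
    by rewrite mulr_ge0 // expR_ge0.
  exact: Qn_ge0.
by rewrite /c !exprS; apply: eq_imp_le; ring.
Qed.

End Convolution.

(** * Factorial moments *)

Section ChainSeries.
Variables (R : realType) (J : pred nat).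
Hypothesis J0 : J 0%N = false.
Local Notation a := (ser_a R).
Local Notation t := (ser_t R).

Definition ser_chain (f : nat -> R) : fps R := fun m => chain J m f / m`!%:R.

Lemma ser_chain0 f : ser_chain f 0%N = 0.
Proof. by rewrite /ser_chain /chain !mul0r. Qed.

Lemma ser_chain1 f : ser_chain f 1%N = f 0%N.
Proof. by rewrite /ser_chain chain1 factS fact0 muln1 divr1. Qed.

Lemma ser_t1 : t 1%N = 1.
Proof. by rewrite /ser_t expr0 factS fact0 muln1 divr1. Qed.

Lemma ser_chain_rec0 m f : (0 < m)%N -> (m.-1)%:R * ser_chain f m =
  \sum_(i < m.+1) ser_chain (fun=> 1) i *
    ((m - i)%:R * ser_chain (fun c => f (c + J i)%N) (m - i)%N).
Proof.
case: m => // m _; rewrite big_ord_recl ser_chain0 mul0r add0r big_ord_recr /=.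
rewrite subnn mul0r mulr0 addr0.
case: m => [|m]; first by rewrite mul0r big_ord0.
have C := @chain_rec R J m.+2 f J0 isT; rewrite [_.-1]/= in C.
rewrite {1}/ser_chain mulrA C mulr_suml big_add1 big_mkord.
apply: eq_bigr => i _; rewrite /bump leq0n add1n /ser_chain.
have im : (i.+1 <= m.+2)%N by have := ltn_ord i; lia.
rewrite (bin_fact_div R im); have := fact_neq0 R i.+1; have := fact_neq0 R (m.+2 - i.+1).
have := fact_neq0 R m.+2; move=> h1 h2 h3; field.
by rewrite h1 h2 h3.
Qed.

Lemma ser_chain_one : ser_chain (fun=> 1) = t.
Proof.
apply/funext => m; elim/ltn_ind: m => -[|[|m]] IH.
- by rewrite ser_chain0.
- by rewrite ser_chain1 ser_t1.
have nz : (m.+2.-1)%:R != 0 :> R by rewrite pnatr_eq0.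
apply: (mulfI nz); rewrite ser_chain_rec0 //.
have := congr1 (fun u : fps R => u m.+2) (ser_ta R).
rewrite addsE oppsE ones subr0 mulsE big_ord_recr /= subnn ser_a0 mulr1 => E.
have Et : a m.+2 = m.+2%:R * t m.+2 by rewrite /ser_a /ser_t exprS mulrA.
have -> : m.+1%:R * t m.+2 = a m.+2 - t m.+2.
  by rewrite Et -[m.+2%:R]natr1; ring.
rewrite -E addrK big_ord_recr /= subnn mul0r mulr0 addr0.
apply: eq_bigr => i _ /=; case: (posnP i) => [->|i0]; first by rewrite ser_chain0 !mul0r.
have i2 : (i < m.+2)%N := ltn_ord i.
rewrite !IH //; last lia.
have : (0 < m.+2 - i)%N by lia.
by case: (m.+2 - i)%N => // k _; rewrite /ser_t /ser_a exprS !mulrA.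
Qed.

Lemma ser_chain_ge0 f m : (forall c, 0 <= f c) -> 0 <= ser_chain f m.
Proof.
move=> f0; rewrite /ser_chain /chain divr_ge0 // mulr_ge0 //.
by apply: sumr_ge0 => w _.
Qed.

Lemma ser_chain_linear f g k m :
  ser_chain (fun c => f c + k * g c) m = ser_chain f m + k * ser_chain g m.
Proof.
rewrite /ser_chain /chain.
have -> : parking_sum J m.-1 (fun c => f c + k * g c) = parking_sum J m.-1 f + k * parking_sum J m.-1 g.
  by rewrite /parking_sum mulr_sumr -big_split.
ring.
Qed.

Lemma ser_chain_ext f g : f =1 g -> ser_chain f = ser_chain g.
Proof. by move=> fg; apply/funext => m; rewrite /ser_chain (chain_ext _ _ fg). Qed.

Definition jump_series : fps R := fun i => if J i then t i else 0.
Local Notation tau := jump_series.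

Definition ff s : nat -> R := fun c => (c ^_ s)%:R.

(* Coefficient n+1 is [ser_a] times the s-th factorial moment of the count for
   parking functions of size n: see [pmean_ser]. *)
Definition xser s : fps R := sderiv (ser_chain (ff s)).

Lemma ff_incr s (b : bool) c : ff s.+1 (c + b)%N = ff s.+1 c + (b%:R * s.+1%:R) * ff s c.
Proof.
case: b; last by rewrite addn0 mul0r mul0r addr0.
rewrite mul1r addn1 /ff ffactSS -natrM -natrD; congr (_%:R).
case: (leqP s c) => sc; last by rewrite !ffact_small ?muln0 // ltnW.
by rewrite ffactnSr mulnC [(s.+1 * _)%N]mulnC -mulnDr; congr (_ * _)%N; lia.
Qed.

Lemma ser_t_jump i : t i * (J i)%:R = tau i.
Proof. by rewrite /tau; case: (J i); rewrite ?mulr1 ?mulr0. Qed.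

Lemma xser_rec s : xser s.+1 - ser_chain (ff s.+1) =
  t * xser s.+1 + (tau * xser s) *+ s.+1.
Proof.
apply/funext => m; rewrite addsE oppsE addsE natsE.
case: m => [|m].
  by rewrite !mulsE !big_ord1 /xser /sderiv subnn ser_chain0 !(mulr0, mul0r) mul0rn subr0 addr0 /=.
transitivity (m.+1.-1%:R * ser_chain (ff s.+1) m.+1).
  have E : m.+1%:R = m%:R + 1 :> R by rewrite natr1.
  by rewrite /xser /sderiv E /=; ring.
rewrite ser_chain_rec0 // ser_chain_one !mulsE -sumrMnl -big_split /=.
apply: eq_bigr => i _; rewrite -ser_t_jump.
rewrite (ser_chain_ext (ff_incr s (J i))) ser_chain_linear /xser /sderiv.
rewrite -mulr_natl; ring.
Qed.

Lemma ser_a_inv : a * (1 - t) = 1.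
Proof. by rewrite mulrBr mulr1 [a * t]mulrC ser_ta; ring. Qed.

Lemma xser0 : xser 0 = a - 1.
Proof.
by rewrite /xser (ser_chain_ext (g := fun=> 1)) ?ser_chain_one ?sderiv_t //.
Qed.

Lemma xserS s : xser s.+1 = a * ser_chain (ff s.+1) + (a * tau * xser s) *+ s.+1.
Proof.
have E := xser_rec s.
have -> : xser s.+1 = a * (1 - t) * xser s.+1 by rewrite ser_a_inv mul1r.
have -> : a * (1 - t) * xser s.+1 = a * (xser s.+1 - ser_chain (ff s.+1)
   - t * xser s.+1 + ser_chain (ff s.+1)) by ring.
rewrite E -[_ *+ s.+1]mulr_natl -[in RHS]mulr_natl; ring.
Qed.

(* The solution of the recursion [xserS] without its first term. *)
Definition vser s : fps R := (tau ^+ s * a ^+ s * (a - 1)) *+ s`!.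

Lemma vserS s : vser s.+1 = (a * tau * vser s) *+ s.+1.
Proof.
rewrite /vser mulrnAr -mulrnA mulnC -factS; congr (_ *+ _); rewrite !exprS.
move: (tau ^+ s) (a ^+ s) (a - 1) => u v w; ring.
Qed.

Definition user s : fps R := xser s - vser s.

Lemma xserE s n : xser s n = vser s n + user s n.
Proof. by rewrite /user addsE oppsE addrC subrK. Qed.

Lemma user0 : user 0 = 0.
Proof. by rewrite /user /vser xser0 !expr0 fact0 !mul1r subrr. Qed.

Lemma userS s : user s.+1 = a * ser_chain (ff s.+1) + (a * tau * user s) *+ s.+1.
Proof. by rewrite /user xserS vserS mulrBr mulrnBl addrA. Qed.

Lemma tau_ge0 i : 0 <= tau i.
Proof.
rewrite /tau; case: (J i) => //; case: i => [|i] //=.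
Qed.

Lemma xser_ge0 s m : 0 <= xser s m.
Proof. by rewrite /xser /sderiv mulr_ge0 // ser_chain_ge0 // => c; rewrite ler0n. Qed.

Lemma ser_chain_ff_le s m : ser_chain (ff s) m <= 2 * (xser s m / Qn R m ^+ 2).
Proof.
rewrite /xser /sderiv Qn_sqr; case: m => [|m].
  by rewrite ser_chain0 mulr0 mul0r mulr0.
have h := @ser_chain_ge0 (ff s) m.+1 (fun c => ler0n _ _).
rewrite mulrA ler_pdivlMr ?ltr0n // mulrA [leLHS]mulrC; apply: ler_wpM2r => //.
by rewrite -natrM ler_nat; lia.
Qed.

Lemma xser1 s : (0 < s)%N -> xser s 1%N = 0.
Proof. by case: s => // s _; rewrite /xser /sderiv ser_chain1 /ff /= mulr0. Qed.

End ChainSeries.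

Section Perturbation.
Variable R : realType.
Local Notation a := (ser_a R).
Local Notation e := (expR 1 : R).
Local Notation Q := (Qn R).
Local Notation r := (rn R).

Lemma rn_unbounded (B : R) : exists n0, forall n, (n0 <= n)%N -> B <= r n.
Proof.
have [k hk] : exists k : nat, `|B| <= k%:R.
  by exists (Num.bound `|B|); apply/ltW/archi_boundP.
exists (k ^ 4)%N => n hn; apply: le_trans (ler_norm B) (le_trans hk _).
rewrite -(@ler_pXn2r _ 4) ?nnegrE ?(ltW (rn_gt0 R n)) //.
have -> : r n ^+ 4 = n.+1%:R by rewrite -[4%N]/(2 * 2)%N exprM rn_sqr Qn_sqr.
by rewrite -natrX ler_nat; apply: leq_trans hn (leqnSn n).
Qed.

Lemma bounded_rec (A B : R) : 0 <= A -> 0 <= B ->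
  exists2 M, 0 <= M & forall P : nat -> R -> Prop,
    (forall n M1 M2, M1 <= M2 -> P n M1 -> P n M2) ->
    (forall n M1, 0 <= M1 -> (forall k, (k < n)%N -> P k M1) -> P n (A + B * M1 / r n)) ->
    forall n, P n M.
Proof.
move=> A0 B0; pose L := fix L i := if i is i'.+1 then A + (B + 1) * L i' else 2 * A.
have L0 i : 0 <= L i by elim: i => [|i IH] /=; rewrite ?addr_ge0 ?mulr_ge0 ?addr_ge0.
have LS i : L i <= L i.+1 by rewrite /= mulrDl mul1r addrA lerDr addr_ge0 // mulr_ge0.
have L2A i : 2 * A <= L i by elim: i => [|i IH]; [exact: lexx|exact: le_trans IH (LS i)].
have [n0 hn0] := rn_unbounded (2 * B).
exists (L n0) => // P mono step n.
have small i m : (m < i)%N -> P m (L i).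
  elim: i m => // i IH m mi.
  apply: (mono _ (A + B * L i / r m)); last first.
    by apply: step => // k km; apply: IH; apply: leq_trans km _.
  rewrite /= lerD2l mulrDl mul1r; apply: le_trans (_ : B * L i <= _).
    by rewrite ler_piMr ?mulr_ge0 // invf_le1 ?rn_gt0 ?rn_ge1.
  by rewrite lerDl.
elim/ltn_ind: n => n IH; case: (ltnP n n0) => hn; first exact: small.
apply: (mono _ (A + B * L n0 / r n)); last exact: step.
have h : B * L n0 / r n <= L n0 / 2.
  rewrite ler_pdivrMr ?rn_gt0 // mulrAC ler_pdivlMr //.
  by rewrite mulrAC mulrC ler_wpM2l // mulrC hn0.
have := L2A n0; move: h; move: (L n0) (B * _ / _) => x y; lra.
Qed.

(* The only feature of the set J of counted sizes that enters the estimates; g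
   is 1 when all sizes are counted, and [jump_rate j] when only j is. *)
Definition admissible (J : pred nat) (g : R) := [/\ J 0%N = false, 0 <= g &
  forall n, (a * jump_series R J * a) n <= 4 * e * g * (Q n * a n)].

Lemma ser_a_mul (u : fps R) n : (a * u) n = \sum_(k < n) u k * a (n - k)%N + u n.
Proof. by rewrite mulrC mulsE big_ord_recr /= subnn ser_a0 mulr1. Qed.

Lemma smul_le_const (w u u' : fps R) (c : R) n : (forall k, 0 <= w k) ->
  (forall k, (k <= n)%N -> u k <= c * u' k) -> (w * u) n <= c * (w * u') n.
Proof.
move=> w0 h; rewrite !mulsE mulr_sumr; apply: ler_sum => i _.
by rewrite mulrCA; apply: ler_wpM2l => //; apply: h; apply: leq_subr.
Qed.

Section Fixed.
Variables (J : pred nat) (g : R).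
Hypothesis adm : admissible J g.
Local Notation tau := (jump_series R J).

Lemma J0 : J 0%N = false. Proof. by case: adm. Qed.
Lemma g_ge0 : 0 <= g. Proof. by case: adm. Qed.

Lemma atau_ge0 k : 0 <= (a * tau) k.
Proof. by apply: smul_ge0 => ?; [exact: ser_a_ge0|exact: tau_ge0]. Qed.

Definition W s n := g ^+ s * Q n ^+ s * a n.

Lemma W_ge0 s n : 0 <= W s n.
Proof.
by rewrite /W !mulr_ge0 ?exprn_ge0 ?g_ge0 ?ser_a_ge0 ?Qn_ge0.
Qed.

Lemma atau_le s n (u : fps R) c : 0 <= c ->
  (forall k, (k <= n)%N -> u k <= c * (g ^+ s * Q n ^+ s) * a k) ->
  (a * tau * u) n <= 4 * e * c * W s.+1 n.
Proof.
move=> c0 h; apply: le_trans (smul_le_const atau_ge0 h) _.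
case: adm => _ g0 H; apply: le_trans (_ : c * (g ^+ s * Q n ^+ s) * (4 * e * g * (Q n * a n)) <= _).
  by apply: ler_wpM2l (H n); rewrite !mulr_ge0 ?exprn_ge0 ?Qn_ge0.
by rewrite /W !exprS; apply: eq_imp_le; ring.
Qed.

End Fixed.

Lemma Qn_exp_le s k n : (k <= n)%N -> Q k ^+ s <= Q n ^+ s.
Proof.
by move=> kn; apply: lerXn2r; rewrite ?nnegrE ?Qn_ge0 // Qn_le.
Qed.

Lemma vser_le s : exists2 K, 0 <= K & forall J g, admissible J g ->
  forall n, vser R J s n <= K * W g s n.
Proof.
elim: s => [|s [K K0 IH]].
  exists 1 => // J g adm n; rewrite /W /vser !expr0 fact0 !mul1r.
  by case/andP: (ser_a1_bounds R n).
exists (4 * e * K * s.+1%:R); first by rewrite !mulr_ge0 ?expR_ge0.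
move=> J g adm n; rewrite vserS natsE -[leLHS]mulr_natr [leRHS]mulrAC; apply: ler_wpM2r => //.
apply: (atau_le adm) => // k kn; apply: le_trans (IH J g adm k) _.
rewrite /W [leLHS]mulrA; apply: ler_wpM2r; first exact: ser_a_ge0.
apply: ler_wpM2l => //; apply: ler_wpM2l; last exact: Qn_exp_le.
by rewrite exprn_ge0 // (g_ge0 adm).
Qed.

Lemma user_ge0 J s n : J 0%N = false -> 0 <= user R J s n.
Proof.
move=> J0; elim: s n => [|s IH] n; first by rewrite user0.
rewrite userS // addsE natsE addr_ge0 ?mulrn_wge0 //.
  by apply: smul_ge0 => k; [exact: ser_a_ge0|apply: ser_chain_ge0 => c; exact: ler0n].
apply: smul_ge0 => // k; apply: smul_ge0 => i; [exact: ser_a_ge0|exact: tau_ge0].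
Qed.

Lemma chain_sum_le J g s n M : admissible J g -> 0 <= M ->
  (forall k, (k < n)%N -> xser R J s.+1 k <= M * W g s.+1 k) ->
  \sum_(k < n) ser_chain J (ff R s.+1) k * a (n - k)%N <= 12 * e * M * W g s.+1 n / r n.
Proof.
move=> adm M0 h; have g0 := g_ge0 adm.
apply: le_trans (_ : 2 * M * (g ^+ s.+1 * Q n ^+ s) * \sum_(k < n.+1) a k / Q k * a (n - k)%N <= _).
  rewrite mulr_sumr big_ord_recr /= -[leLHS]addr0; apply: lerD; last first.
    by rewrite !mulr_ge0 ?exprn_ge0 ?invr_ge0 ?ser_a_ge0 ?Qn_ge0.
  apply: ler_sum => k _; rewrite [leRHS]mulrA; apply: ler_wpM2r; first exact: ser_a_ge0.
  apply: le_trans (ser_chain_ff_le R (J0 adm) s.+1 k) _.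
  apply: le_trans (_ : 2 * (M * (g ^+ s.+1 * (Q n ^+ s * Q k) * a k) / Q k ^+ 2) <= _); last first.
    by apply: eq_imp_le; field; rewrite gt_eqF ?Qn_gt0.
  rewrite ler_pM2l // ler_pM2r ?invr_gt0 ?exprn_gt0 ?Qn_gt0 //.
  apply: le_trans (h k (ltn_ord k)) _; rewrite /W; apply: ler_wpM2l => //.
  apply: ler_wpM2r; first exact: ser_a_ge0.
  apply: ler_wpM2l; first exact: exprn_ge0.
  rewrite exprSr; apply: ler_wpM2r; first exact: Qn_ge0.
  by rewrite Qn_exp_le // ltnW.
apply: le_trans (_ : 2 * M * (g ^+ s.+1 * Q n ^+ s) * (6 * e * (r n * a n)) <= _).
  by apply: ler_wpM2l (ser_aaQ_le R n); rewrite !mulr_ge0 ?exprn_ge0 ?Qn_ge0.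
rewrite /W [Q n ^+ s.+1]exprSr; move: (Q n ^+ s) => qs; rewrite -(rn_sqr R n).
by apply: eq_imp_le; field; rewrite gt_eqF ?rn_gt0.
Qed.

Lemma user_le s : exists2 K, 0 <= K & forall J g, admissible J g ->
  forall n, user R J s n <= K * W g s n / r n.
Proof.
elim: s => [|s [K' K'0 IH]].
  by exists 0 => // J g adm n; rewrite user0 ?(J0 adm) // !mul0r.
have [Kv Kv0 hv] := vser_le s.+1.
have T J g n : admissible J g -> (a * jump_series R J * user R J s) n *+ s.+1 <=
    4 * e * K' * s.+1%:R * (W g s.+1 n / r n).
  move=> adm; have J00 := J0 adm; have g0 := g_ge0 adm.
  rewrite -[leLHS]mulr_natr [leRHS]mulrAC; apply: ler_wpM2r => //.
  case: s IH hv => [|s] IH hv.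
    rewrite user0 // mulr0 -[0 n]/0.
    apply: mulr_ge0; first by rewrite !mulr_ge0 // expR_ge0.
    by apply: divr_ge0; [exact: (W_ge0 adm)|exact/ltW/rn_gt0].
  have rp := rn_gt0 R n.
  have := @atau_le J g adm s.+1 n (user R J s.+1) (K' / r n).
  rewrite divr_ge0 ?(ltW rp) // => /(_ isT) H.
  apply: le_trans (H _) _; last first.
    by apply: eq_imp_le; field; rewrite gt_eqF.
  move=> k kn; apply: le_trans (IH J g adm k) _.
  rewrite /W; have rk := rn_gt0 R k.
  have -> : K' * (g ^+ s.+1 * Q k ^+ s.+1 * a k) / r k = K' * g ^+ s.+1 * a k * (Q k ^+ s * r k).
    by rewrite [Q k ^+ s.+1]exprSr; move: (Q k ^+ s) => qs; rewrite -(rn_sqr R k); field; rewrite gt_eqF.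
  have -> : K' / r n * (g ^+ s.+1 * Q n ^+ s.+1) * a k = K' * g ^+ s.+1 * a k * (Q n ^+ s * r n).
    by rewrite [Q n ^+ s.+1]exprSr; move: (Q n ^+ s) => qs; rewrite -(rn_sqr R n); field; rewrite gt_eqF.
  apply: ler_wpM2l; first by rewrite !mulr_ge0 ?exprn_ge0 ?ser_a_ge0.
  by apply: ler_pM; rewrite ?exprn_ge0 ?Qn_ge0 ?(ltW rk) ?Qn_exp_le ?rn_le.
have [||M M0 HM] := @bounded_rec (2 * Kv + 8 * e * K' * s.+1%:R) (24 * e).
- by apply: addr_ge0; rewrite ?mulr_ge0 // expR_ge0.
- by apply: mulr_ge0; rewrite // expR_ge0.
have xle J g : admissible J g -> forall n, xser R J s.+1 n <= M * W g s.+1 n.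
  move=> adm; apply: (HM (fun n M => xser R J s.+1 n <= M * W g s.+1 n)).
    by move=> n M1 M2 M12 /le_trans; apply; apply: ler_wpM2r => //; apply: W_ge0; exact: adm.
  move=> n M1 M10 h; have rp := rn_gt0 R n; have r1 := rn_ge1 R n.
  have W0 : 0 <= W g s.+1 n by apply: W_ge0; exact: adm.
  case: (leqP n 1) => n1.
    have -> : xser R J s.+1 n = 0.
      by case: n n1 {h rp r1 W0} => [|[|//]] _; rewrite ?xser1 // /xser /sderiv mul0r.
    by rewrite mulr_ge0 // !addr_ge0 ?mulr_ge0 ?invr_ge0 ?expR_ge0 ?(ltW rp).
  have E := xserE R J s.+1 n.
  have c2 : ser_chain J (ff R s.+1) n <= xser R J s.+1 n / 2.
    rewrite ler_pdivlMr // /xser /sderiv mulrC; apply: ler_wpM2r.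
      by apply: ser_chain_ge0 => c; exact: ler0n.
    by rewrite ler_nat.
  have S := chain_sum_le adm M10 h; have V := hv J g adm n; have T' := T J g n adm.
  move: (E); rewrite userS ?(J0 adm) // addsE natsE ser_a_mul => E'.
  have T2 : 4 * e * K' * s.+1%:R * (W g s.+1 n / r n) <= 4 * e * K' * s.+1%:R * W g s.+1 n.
    apply: ler_wpM2l; first by rewrite !mulr_ge0 ?expR_ge0.
    by rewrite ler_piMr // invf_le1.
  have -> : (2 * Kv + 8 * e * K' * s.+1%:R + 24 * e * M1 / r n) * W g s.+1 n =
    2 * (Kv * W g s.+1 n) + 2 * (4 * e * K' * s.+1%:R * W g s.+1 n) + 2 * (12 * e * M1 * W g s.+1 n / r n).
    by field; rewrite gt_eqF.
  lra.
exists (12 * e * M + 2 * M + 4 * e * K' * s.+1%:R).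
  by rewrite !addr_ge0 ?mulr_ge0 ?expR_ge0.
move=> J g adm n; have rp := rn_gt0 R n; have r1 := rn_ge1 R n.
have W0 : 0 <= W g s.+1 n by apply: W_ge0; exact: adm.
rewrite userS ?(J0 adm) // addsE natsE ser_a_mul.
have S := @chain_sum_le J g s n M adm M0 (fun k _ => xle J g adm k).
have T' := T J g n adm.
have C : ser_chain J (ff R s.+1) n <= 2 * M * W g s.+1 n / r n.
  apply: le_trans (ser_chain_ff_le R (J0 adm) s.+1 n) _.
  rewrite -[leRHS]mulrA -[leRHS]mulrA ler_pM2l // mulrA.
  apply: ler_pM; rewrite ?xser_ge0 ?invr_ge0 ?exprn_ge0 ?Qn_ge0 ?xle //.
  rewrite lef_pV2 ?posrE ?exprn_gt0 ?Qn_gt0 // -rn_sqr -exprM.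
  by rewrite exprS ler_peMr ?(ltW rp) // exprn_ege1.
have -> : (12 * e * M + 2 * M + 4 * e * K' * s.+1%:R) * W g s.+1 n / r n =
  12 * e * M * W g s.+1 n / r n + 2 * M * W g s.+1 n / r n + 4 * e * K' * s.+1%:R * (W g s.+1 n / r n).
  by field; rewrite gt_eqF.
lra.
Qed.

End Perturbation.

Local Open Scope classical_set_scope.
Local Open Scope ring_scope.

Section NullSequences.
Variable R : realType.
Implicit Types u v : nat -> R.

Lemma cvg_dominated u v (l : R) : (\forall n \near \oo, `|u n - l| <= v n) ->
  v n @[n --> \oo] --> (0 : R) -> u n @[n --> \oo] --> l.
Proof.
move=> h /cvgrPdist_lt hv; apply/cvgrPdist_lt => eps eps0.
have := hv _ eps0; apply: filterS2 h => n h1; rewrite sub0r normrN => h2.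
by rewrite distrC (le_lt_trans h1) // (le_lt_trans (ler_norm _)).
Qed.

Lemma cvg_of_sub_null u v (l : R) : v n @[n --> \oo] --> l ->
  (u n - v n) @[n --> \oo] --> (0 : R) -> u n @[n --> \oo] --> l.
Proof.
move=> hv huv; rewrite -[l]add0r (_ : u = (fun n => (u n - v n) + v n)).
  exact: cvgD.
by apply/funext => n; rewrite subrK.
Qed.

Lemma cvg_bounded_mul0 u v (C : R) : (\forall n \near \oo, `|u n| <= C) ->
  v n @[n --> \oo] --> (0 : R) -> (u n * v n) @[n --> \oo] --> (0 : R).
Proof.
move=> h hv; apply: (@cvg_dominated _ (fun n => C * `|v n|)).
  apply: filterS h => n h; rewrite subr0 normrM.
  by apply: ler_wpM2r.
by rewrite -(mulr0 C) -(normr0 R); apply: cvgM; [exact: cvg_cst|exact: cvg_norm].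
Qed.

Lemma cvg_near_bounded u (l : R) : u n @[n --> \oo] --> l ->
  \forall n \near \oo, `|u n| <= `|l| + 1.
Proof.
move=> /cvgrPdist_lt /(_ 1 ltr01); apply: filterS => n h.
have -> : u n = l - (l - u n) by ring.
by apply: le_trans (ler_normB _ _) _; rewrite lerD2l ltW.
Qed.

End NullSequences.

(* A log-convex sequence with moments(s+2) = (s+2) moments(s) is pinned down
   by its value at 0, in the way Wallis' product pins down pi. *)
Section Pinning.
Variables (R : realType) (mu : nat -> R) (A : nat -> nat -> R).
Hypothesis mu0 : mu 0%N = 1.
Hypothesis mu1 : 0 < mu 1%N.
Hypothesis muSS : forall s, mu s.+2 = s.+2%:R * mu s.
Hypothesis mu_convex : forall s, mu s.+1 ^+ 2 <= mu s * mu s.+2.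
Hypothesis A0 : forall n, A 0%N n = 1.
Hypothesis A_ge0 : forall s n, 0 <= A s n.
Hypothesis ASS : forall s, (A s.+2 n - s.+2%:R * A s n) @[n --> \oo] --> (0 : R).
Hypothesis A_convex : forall s n, A s.+1 n ^+ 2 <= A s n * A s.+2 n.

Fixpoint odd_coef r : R := if r is r'.+1 then (2 * r' + 3)%N%:R * odd_coef r' else 1.

Lemma odd_coef_ge1 r : 1 <= odd_coef r.
Proof. by elim: r => //= r IH; rewrite -[leLHS]mul1r ler_pM // ler1n; lia. Qed.

Lemma mu_gt0 s : 0 < mu s.
Proof.
elim/ltn_ind: s => -[|[|s]] IH; rewrite ?mu0 //.
by rewrite muSS mulr_gt0 // IH.
Qed.

Lemma mu_odd r : mu (2 * r).+1 = odd_coef r * mu 1%N.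
Proof.
elim: r => [|r IH]; first by rewrite muln0 mul1r.
by rewrite mulnS muSS IH /= mulrA; congr (_%:R * _ * _); lia.
Qed.

Lemma A_even r : A (2 * r)%N n @[n --> \oo] --> mu (2 * r)%N.
Proof.
elim: r => [|r IH].
  rewrite muln0 mu0 (_ : A 0%N = fun=> 1); first exact: cvg_cst.
  exact/funext.
rewrite mulnS muSS; apply: (@cvg_of_sub_null _ _ (fun n => (2 * r)%N.+2%:R * A (2 * r)%N n)).
  by apply: cvgM; [exact: cvg_cst|].
exact: ASS.
Qed.

Lemma A1_le n : `|A 1%N n| <= 1 + A 2%N n.
Proof.
have := A_convex 0 n; rewrite A0 mul1r ger0_norm // => h.
have := A_ge0 1 n; have := A_ge0 2 n; nra.
Qed.

Lemma A1_bounded : \forall n \near \oo, `|A 1%N n| <= 4.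
Proof.
have := cvg_near_bounded (@A_even 1); rewrite muln1 muSS mu0 mulr1 => h.
apply: filterS h => n h; apply: le_trans (A1_le n) _.
move: h; rewrite !ger0_norm //; lra.
Qed.

Lemma A_odd r : (A (2 * r).+1 n - odd_coef r * A 1%N n) @[n --> \oo] --> (0 : R).
Proof.
elim: r => [|r IH].
  rewrite muln0 (_ : (fun n => _) = fun=> 0); first exact: cvg_cst.
  by apply/funext => n; rewrite mul1r subrr.
rewrite mulnS (_ : (fun n => _) = fun n =>
  (A (2 * r).+3 n - (2 * r)%N.+3%:R * A (2 * r).+1 n) +
  (2 * r)%N.+3%:R * (A (2 * r).+1 n - odd_coef r * A 1%N n)).
  rewrite -[0]addr0; apply: cvgD; first exact: ASS.
  by rewrite -[X in _ --> X](mulr0 (2 * r)%N.+3%:R); apply: cvgM; [exact: cvg_cst|].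
apply/funext => n /=; rewrite (_ : (2 * r + 3)%N = (2 * r).+3); last lia.
by ring.
Qed.

Lemma A_odd_sqr r r' : (A (2 * r).+1 n * A (2 * r').+1 n -
  odd_coef r * odd_coef r' * A 1%N n ^+ 2) @[n --> \oo] --> (0 : R).
Proof.
pose D r n := A (2 * r).+1 n - odd_coef r * A 1%N n.
rewrite (_ : (fun n => _) = fun n => D r n * D r' n +
  (A 1%N n * (odd_coef r' * D r n) + A 1%N n * (odd_coef r * D r' n))); last first.
  by apply/funext => n; rewrite /D; ring.
have c0 c r1 : (c * D r1 n) @[n --> \oo] --> (0 : R).
  by rewrite -(mulr0 c); apply: cvgM; [exact: cvg_cst|exact: A_odd].
rewrite -[0]addr0; apply: cvgD.
  by rewrite -[0](mulr0 (0 : R)); apply: cvgM; exact: A_odd.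
by rewrite -[0]addr0; apply: cvgD; apply: cvg_bounded_mul0 A1_bounded _; exact: c0.
Qed.

Lemma A1_sqr : (A 1%N n ^+ 2) @[n --> \oo] --> mu 1%N ^+ 2.
Proof.
apply/cvgrPdist_lt => eps eps0.
have [r hr] : exists r : nat, mu 1%N ^+ 2 <= eps / 2 * (2 * r + 2)%N%:R.
  exists (Num.bound (mu 1%N ^+ 2 / eps)).
  have /archi_boundP : 0 <= mu 1%N ^+ 2 / eps by rewrite divr_ge0 ?sqr_ge0 // ltW.
  rewrite ltr_pdivrMr //; set b := Num.bound _; rewrite natrD natrM => /ltW h.
  apply: le_trans h _; nra.
pose c := odd_coef r; have c1 : 1 <= c := odd_coef_ge1 r.
pose d := eps / 8.
have d0 : 0 < d by rewrite /d divr_gt0.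
pose m := mu (2 * r)%N; have m0 : 0 < m := mu_gt0 _.
have E2 : mu (2 * r).+2 = (2 * r + 2)%N%:R * m by rewrite muSS addn2.
have h1 : A (2 * r)%N n * A (2 * r).+2 n @[n --> \oo] --> m * mu (2 * r).+2.
  apply: cvgM; first exact: A_even.
  by have := @A_even r.+1; rewrite mulnS.
have h2 : A (2 * r).+2 n ^+ 2 @[n --> \oo] --> mu (2 * r).+2 ^+ 2.
  rewrite expr2 (_ : (fun n => _) = fun n => A (2 * r).+2 n * A (2 * r).+2 n).
    by have := @A_even r.+1; rewrite mulnS => h; apply: cvgM.
  by apply/funext => n; rewrite expr2.
have h3 := @A_odd_sqr r r; have h4 := @A_odd_sqr r r.+1.
move/cvgrPdist_lt: h1 => /(_ _ d0) h1; move/cvgrPdist_lt: h2 => /(_ _ d0) h2.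
move/cvgrPdist_lt: h3 => /(_ _ d0) h3; move/cvgrPdist_lt: h4 => /(_ _ d0) h4.
have U0 := mu_convex (2 * r); have L0 := mu_convex (2 * r).+1.
near=> n.
have := A_convex (2 * r) n; have := A_convex (2 * r).+1 n.
have : `|m * mu (2 * r).+2 - A (2 * r)%N n * A (2 * r).+2 n| < d by near: n.
have : `|mu (2 * r).+2 ^+ 2 - A (2 * r).+2 n ^+ 2| < d by near: n.
have : `|0 - (A (2 * r).+1 n * A (2 * r).+1 n - odd_coef r * odd_coef r * A 1%N n ^+ 2)| < d by near: n.
have : `|0 - (A (2 * r).+1 n * A (2 * r.+1).+1 n - odd_coef r * odd_coef r.+1 * A 1%N n ^+ 2)| < d by near: n.
move: U0 L0; rewrite (_ : mu (2 * r).+3 = mu (2 * r.+1).+1); last by rewrite mulnS.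
rewrite !mu_odd E2 -/m (_ : A (2 * r).+3 n = A (2 * r.+1).+1 n); last by rewrite mulnS.
move: hr; rewrite [odd_coef r.+1]/= -/c (_ : (2 * r + 3)%N%:R = (2 * r + 2)%N%:R + 1 :> R); last first.
  by rewrite natr1; congr (_%:R); lia.
have N2 : 2 <= (2 * r + 2)%N%:R :> R by rewrite ler_nat; lia.
move: N2; set N : R := (2 * r + 2)%N%:R; rewrite !ltr_norml.
set x := A 1%N n ^+ 2; set y := mu 1%N ^+ 2.
move=> N2 hr U0 L0 /andP[p1 p2] /andP[p3 p4] /andP[p5 p6] /andP[p7 p8] q1 q2.
have u1 : c ^+ 2 * x <= N * m ^+ 2 + 2 * d by nra.
have l1 : N ^+ 2 * m ^+ 2 - 2 * d <= (N + 1) * c ^+ 2 * x by nra.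
have u2 : c ^+ 2 * y <= N * m ^+ 2 by rewrite /y; nra.
have l2 : N ^+ 2 * m ^+ 2 <= (N + 1) * c ^+ 2 * y by rewrite /y; nra.
have c2 : 1 <= c ^+ 2 by rewrite exprn_ege1.
move: c2 u1 l1 u2 l2; set C := c ^+ 2; set M := m ^+ 2 => c2 u1 l1 u2 l2.
have C0 : 0 < C by lra.
have k1 : N * M <= C * y + C * y / N.
  rewrite -(ler_pM2l (_ : 0 < N)); last lra.
  have -> : N * (C * y + C * y / N) = (N + 1) * C * y by field; lra.
  by rewrite mulrA -expr2.
have k3 : C * y / N <= C * (eps / 2).
  by rewrite -mulrA ler_pM2l // ler_pdivrMr //; lra.
have dE : d = eps / 8 by [].
have k4 : C * (x - y) <= C * (eps / 2 + 2 * d).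
  rewrite !mulrDr mulrN; have : 2 * d <= C * (2 * d) by rewrite ler_peMl // mulr_ge0 // ltW.
  lra.
have k5 : (N + 1) * (C * (y - x)) <= (N + 1) * (C * (eps / 2 + 2 * d)).
  have e1 : C * y <= C * (eps / 2) * N.
    by rewrite -[leRHS]mulrA ler_pM2l.
  have e2 : 2 * d <= (N + 1) * (C * (2 * d)).
    rewrite mulrA ler_peMl ?mulr_ge0 ?(ltW d0) //; nra.
  have e3 : N * (C * y) <= N * (N * M) by rewrite ler_pM2l //; lra.
  rewrite !mulrDr mulrN; move: l1 e1 e2 e3; rewrite expr2; nra.
move: k4 k5; rewrite ler_pM2l // ler_pM2l; last lra.
rewrite ler_pM2l // => k4 k5.
by apply/andP; split; lra.
Unshelve. all: by end_near.
Qed.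

Lemma A1_cvg : A 1%N n @[n --> \oo] --> mu 1%N.
Proof.
have h := cvg_comp _ _ A1_sqr (@sqrt_continuous R (mu 1%N ^+ 2)).
rewrite /= sqrtr_sqr ger0_norm ?(ltW mu1) // in h.
rewrite (_ : A 1%N = fun n => Num.sqrt (A 1%N n ^+ 2)) //.
by apply/funext => n; rewrite sqrtr_sqr ger0_norm.
Qed.

Lemma pinned_limit s : A s n @[n --> \oo] --> mu s.
Proof.
elim/ltn_ind: s => -[|[|s]] IH.
- exact: (@A_even 0).
- exact: A1_cvg.
rewrite muSS; apply: (@cvg_of_sub_null _ _ (fun n => s.+2%:R * A s n)).
  by apply: cvgM; [exact: cvg_cst|exact: IH].
exact: ASS.
Qed.

End Pinning.

Section Pmean.
Variable R : realType.
Implicit Types (J : pred nat) (f g : nat -> R).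

Lemma ser_t_gt0 m : (0 < m)%N -> 0 < ser_t R m.
Proof. by case: m => // m _; rewrite /ser_t divr_gt0 ?exprn_gt0 ?ltr0n ?fact_gt0. Qed.

Lemma parking_sum_gt0 J n : J 0%N = false -> 0 < parking_sum J n (fun=> 1 : R).
Proof.
move=> J0; have E1 := congr1 (fun u : fps R => u n.+1) (ser_chain_one R J0).
have := ser_t_gt0 (ltn0Sn n); rewrite -E1 /ser_chain /chain /= pmulr_lgt0 ?invr_gt0 ?ltr0n ?fact_gt0 //.
by rewrite pmulr_rgt0 // ltr0n.
Qed.

Lemma pmean_ser J n f : J 0%N = false ->
  pmean J n f = sderiv (ser_chain J f) n.+1 / ser_a R n.+1.
Proof.
move=> J0; have Et : ser_a R n.+1 = n.+1%:R * ser_t R n.+1 by rewrite /ser_a /ser_t exprS mulrA.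
have E1 := congr1 (fun u : fps R => u n.+1) (ser_chain_one R J0).
have n1 : n.+1%:R != 0 :> R by rewrite pnatr_eq0.
have P := lt0r_neq0 (parking_sum_gt0 n J0); have F := fact_neq0 R n.+1.
rewrite Et -E1 /sderiv /ser_chain /chain /pmean /=.
by move: (n.+1%:R) n1 => u n1; field; rewrite F P n1.
Qed.

Lemma pmean_le J n f g : J 0%N = false -> (forall c, f c <= g c) ->
  pmean J n f <= pmean J n g.
Proof.
move=> J0 fg; rewrite ler_pM2r ?invr_gt0 ?parking_sum_gt0 //.
by apply: ler_sum => w _.
Qed.

Lemma pmean_ge0 J n f : (forall c, 0 <= f c) -> 0 <= pmean J n f.
Proof. by move=> f0; apply: divr_ge0; apply: sumr_ge0. Qed.

Lemma pmean_cst J n (c : R) : J 0%N = false -> pmean J n (fun=> c) = c.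
Proof.
move=> J0; rewrite /pmean [X in X / _](_ : _ = c * parking_sum J n (fun=> 1)).
  by rewrite mulfK // gt_eqF ?parking_sum_gt0.
by rewrite /parking_sum mulr_sumr; apply: eq_bigr => w _; rewrite mulr1.
Qed.

Lemma pmeanD J n f g : pmean J n (fun c => f c + g c) = pmean J n f + pmean J n g.
Proof. by rewrite /pmean -mulrDl; congr (_ / _); rewrite /parking_sum big_split. Qed.

Lemma pmeanZ J n k f : pmean J n (fun c => k * f c) = k * pmean J n f.
Proof. by rewrite /pmean mulrA; congr (_ / _); rewrite /parking_sum mulr_sumr. Qed.

Lemma pmean_ext J n f g : f =1 g -> pmean J n f = pmean J n g.
Proof. by move=> fg; rewrite /pmean (parking_sum_ext _ _ fg). Qed.

Lemma pmean_linear J n (I : Type) (r : seq I) (k : I -> R) (F : I -> nat -> R) :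
  pmean J n (fun c => \sum_(i <- r) k i * F i c) = \sum_(i <- r) k i * pmean J n (F i).
Proof.
rewrite /pmean parking_sum_linear mulr_suml.
by apply: eq_bigr => i _; rewrite mulrA.
Qed.

Lemma pmean_dist_le J n f g h : J 0%N = false -> (forall c, `|f c - g c| <= h c) ->
  `|pmean J n f - pmean J n g| <= pmean J n h.
Proof.
move=> J0 fgh; rewrite -mulN1r -pmeanZ -pmeanD ler_norml -[- pmean _ _ h]mulN1r -pmeanZ.
by apply/andP; split; apply: pmean_le => // c; have := fgh c; rewrite ler_norml !mulN1r => /andP[].
Qed.

Lemma discriminant_le (a b c : R) : 0 <= a ->
  (forall x, 0 <= c - 2 * x * b + x ^+ 2 * a) -> b ^+ 2 <= a * c.
Proof.
move=> a0 h; case: (ltrgt0P a) a0 => [ap _||a0 _] //; last first.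
  case: (eqVneq b 0) => [->|b0]; first by rewrite a0 mul0r expr0n.
  have := h ((c + 1) / (2 * b)); rewrite a0 mulr0 addr0.
  have -> : c - 2 * ((c + 1) / (2 * b)) * b = -1 by field.
  by rewrite lerNr oppr0 leNgt ltr01.
have := h (b / a); have -> : c - 2 * (b / a) * b + (b / a) ^+ 2 * a = (a * c - b ^+ 2) / a.
  by field; rewrite gt_eqF.
by rewrite pmulr_lge0 ?invr_gt0 // subr_ge0.
Qed.

Definition pmoment J n (l : R) s := pmean J n (fun c => (c%:R / l) ^+ s).

Lemma pmoment_ge0 J n l s : 0 <= l -> 0 <= pmoment J n l s.
Proof. by move=> l0; apply: pmean_ge0 => c; rewrite exprn_ge0 // divr_ge0. Qed.

Lemma pmoment_convex J n l s : 0 <= l ->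
  pmoment J n l s.+1 ^+ 2 <= pmoment J n l s * pmoment J n l s.+2.
Proof.
move=> l0; apply: discriminant_le; first exact: pmoment_ge0.
move=> x; rewrite /pmoment -mulNr -!pmeanZ -!pmeanD; apply: pmean_ge0 => c /=.
have -> : (c%:R / l) ^+ s.+2 + - (2 * x) * (c%:R / l) ^+ s.+1 + x ^+ 2 * (c%:R / l) ^+ s =
  (c%:R / l) ^+ s * (c%:R / l - x) ^+ 2 by rewrite !exprS; ring.
by rewrite mulr_ge0 ?sqr_ge0 // exprn_ge0 // divr_ge0.
Qed.

Lemma ffact_le_exp c s : (c ^_ s <= c ^ s)%N.
Proof. by elim: s => // s IH; rewrite ffactnSr expnSr leq_mul // leq_subr. Qed.

Lemma exp_le_ffact c s : (c ^ s.+1 <= c ^_ s.+1 + s.+1 ^ 2 * c ^ s)%N.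
Proof.
elim: s => [|s IH]; first by rewrite expn1 ffactn1 leq_addr.
rewrite expnSr ffactnSr.
have h : (c ^_ s.+1 * c <= c ^_ s.+1 * (c - s.+1) + s.+1 * c ^ s.+1)%N.
  rewrite mulnBr; have := ffact_le_exp c s.+1.
  case: (leqP s.+1 c) => sc h; last by rewrite ffact_small.
  rewrite addnBAC ?leq_mul2l ?sc ?orbT // mulnC [(_ * s.+1)%N]mulnC.
  by rewrite -addnBA ?leq_addr // leq_mul2l h orbT.
apply: leq_trans (leq_mul IH (leqnn c)) _; rewrite mulnDl -[X in (_ + X <= _)%N]mulnA -expnSr.
apply: leq_trans (leq_add h (leqnn _)) _; rewrite -addnA leq_add2l -mulnDl leq_mul2r.
by apply/orP; right; rewrite -!mulnn; nia.
Qed.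

Lemma ff_ge0 s c : 0 <= ff R s c. Proof. exact: ler0n. Qed.

Lemma pmoment_ff J n l s : J 0%N = false -> 0 < l ->
  `|pmoment J n l s.+1 - pmean J n (ff R s.+1) / l ^+ s.+1| <= (s.+1 ^ 2)%:R * pmoment J n l s / l.
Proof.
move=> J0 l0.
have -> : pmean J n (ff R s.+1) / l ^+ s.+1 = pmean J n (fun c => (l ^+ s.+1)^-1 * ff R s.+1 c).
  by rewrite pmeanZ mulrC.
have -> : (s.+1 ^ 2)%:R * pmoment J n l s / l = pmean J n (fun c => (l ^+ s.+1)^-1 * ((s.+1 ^ 2)%:R * c%:R ^+ s)).
  rewrite mulrAC /pmoment -pmeanZ; apply: pmean_ext => c; rewrite expr_div_n exprS.
  by field; rewrite expf_neq0 // gt_eqF.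
apply: pmean_dist_le => // c; have li : 0 <= (l ^+ s.+1)^-1 by rewrite invr_ge0 exprn_ge0 // ltW.
rewrite expr_div_n mulrC -mulrBr normrM (ger0_norm li) ler_wpM2l // ger0_norm.
  by rewrite lerBlDl /ff -!natrX -!natrM -natrD ler_nat exp_le_ffact.
by rewrite subr_ge0 /ff -natrX ler_nat ffact_le_exp.
Qed.

Lemma pmoment_asymp (J : nat -> pred nat) (l : nat -> R) :
  (forall n, J n 0%N = false) ->
  (\forall n \near \oo, 0 < l n) -> ((l n)^-1) @[n --> \oo] --> (0 : R) ->
  (forall s, exists C : R, \forall n \near \oo, `|pmean (J n) n (ff R s) / l n ^+ s| <= C) ->
  forall s, (exists C : R, \forall n \near \oo, `|pmoment (J n) n (l n) s| <= C) /\
    (pmoment (J n) n (l n) s - pmean (J n) n (ff R s) / l n ^+ s) @[n --> \oo] --> (0 : R).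
Proof.
move=> J0 lp linv Fb; elim=> [|s [[C hC] IH]].
  have E n : pmoment (J n) n (l n) 0 = pmean (J n) n (ff R 0) / l n ^+ 0.
    by rewrite /pmoment expr0 divr1; apply: pmean_ext => c; rewrite expr0 /ff ffactn0.
  split; first by have [C hC] := Fb 0%N; exists C; apply: filterS hC => n; rewrite E.
  by apply: cvg_near_cst; apply: nearW => n; rewrite E subrr.
have D : (pmoment (J n) n (l n) s.+1 - pmean (J n) n (ff R s.+1) / l n ^+ s.+1) @[n --> \oo] --> (0 : R).
  apply: (@cvg_dominated _ _ (fun n => (s.+1 ^ 2)%:R * (pmoment (J n) n (l n) s * (l n)^-1))).
    apply: filterS lp => n l0; rewrite subr0 mulrA; exact: pmoment_ff.
  rewrite -(mulr0 ((s.+1 ^ 2)%:R : R)); apply: cvgM; first exact: cvg_cst.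
  exact: (@cvg_bounded_mul0 _ _ _ C hC linv).
split=> //; have [C' hC'] := Fb s.+1; have := cvg_near_bounded D; rewrite normr0 add0r => hD.
exists (1 + C'); apply: filterS2 hC' hD => n h1 h2.
by rewrite -[pmoment _ _ _ _](subrK (pmean (J n) n (ff R s.+1) / l n ^+ s.+1)) (le_trans (ler_normD _ _)) // lerD.
Qed.

End Pmean.

Section AllIncrements.
Variable R : realType.
Local Notation a := (ser_a R).
Local Notation e := (expR 1 : R).
Local Notation Q := (Qn R).

Lemma jump_series_positive : jump_series R positive_jump = ser_t R.
Proof. by apply/funext => -[|n]. Qed.

Lemma admissible_positive : admissible positive_jump (1 : R).
Proof.
split=> // n; rewrite jump_series_positive mulr1 [a * _]mulrC ser_ta mulrBl mul1r.
rewrite addsE oppsE; apply: le_trans (ser_aa_leQ R n).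
by rewrite gerBl ser_a_ge0.
Qed.

Definition msn s n := s`!%:R * (a ^+ s.+1) n.+1 / (Q n ^+ s * a n.+1).

Lemma msn0 n : msn 0 n = 1.
Proof. by rewrite /msn expr1 expr0 fact0 !mul1r divff // gt_eqF // ser_a_gt0. Qed.

Lemma msn_ge0 s n : 0 <= msn s n.
Proof.
apply: divr_ge0; apply: mulr_ge0 => //; first by apply: sX_ge0 => k; exact: ser_a_ge0.
  by rewrite exprn_ge0 // ltW // Qn_gt0.
exact: ser_a_ge0.
Qed.

Lemma msn_rec s n : msn s.+2 n = s.+2%:R * msn s n + s.+2%:R * msn s.+1 n / Q n.
Proof.
have E := ser_aX_rec R s n.+1; rewrite -Qn_sqr in E.
have s1 : s.+1%:R != 0 :> R by rewrite pnatr_eq0.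
have Q0 := lt0r_neq0 (Qn_gt0 R n); have a0 := lt0r_neq0 (ser_a_gt0 R n.+1).
have -> : msn s.+2 n = s.+2%:R * s`!%:R * (s.+1%:R * (a ^+ s.+3) n.+1) / (Q n ^+ s.+2 * a n.+1).
  by rewrite /msn !factS !natrM; field; rewrite a0 expf_neq0.
have -> : s.+1%:R * (a ^+ s.+3) n.+1 = Q n ^+ 2 * (a ^+ s.+1) n.+1 + s.+1%:R * (a ^+ s.+2) n.+1.
  by rewrite E; ring.
rewrite /msn factS natrM !exprS; field.
by rewrite a0 Q0 expf_neq0.
Qed.

Lemma Qn_succ n : Q n.+1 <= 2 * Q n.
Proof.
have h := Qn_gt0 R n; rewrite -(@ler_pXn2r _ 2) ?nnegrE ?mulr_ge0 ?Qn_ge0 ?(ltW h) //.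
by rewrite exprMn !Qn_sqr -natrX -natrM ler_nat; lia.
Qed.

Lemma aX_ratio_le s n : (a ^+ s.+1) n.+1 / (Q n ^+ s * a n.+1) <= (8 * e) ^+ s.
Proof.
have h := Qn_gt0 R n; have a0 := ser_a_gt0 R n.+1.
rewrite ler_pdivrMr ?mulr_gt0 ?exprn_gt0 //.
apply: le_trans (ser_aX_le R s n.+1) _; rewrite [leRHS]mulrA ler_pM2r // -!exprMn.
apply: lerXn2r; rewrite ?nnegrE ?mulr_ge0 ?expR_ge0 ?Qn_ge0 //.
rewrite -mulrA [leRHS](_ : _ = 4 * (e * (2 * Q n))); last ring.
by rewrite ler_pM2l // ler_pM2l ?expR_gt0 // Qn_succ.
Qed.

Lemma msn_le s n : msn s n <= s`!%:R * (8 * e) ^+ s.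
Proof. by rewrite /msn -mulrA; apply: ler_wpM2l => //; exact: aX_ratio_le. Qed.

Lemma invQ_cvg : ((Q n)^-1) @[n --> \oo] --> (0 : R).
Proof.
have h := cvg_comp _ _ (@cvg_harmonic R) (@sqrt_continuous R 0).
rewrite sqrtr0 in h; rewrite (_ : (fun n => _) = fun n => Num.sqrt (harmonic n)) //.
by apply/funext => n; rewrite sqrtrV.
Qed.

Lemma invrn_cvg : ((rn R n)^-1) @[n --> \oo] --> (0 : R).
Proof.
have h := cvg_comp _ _ invQ_cvg (@sqrt_continuous R 0).
rewrite sqrtr0 in h; rewrite (_ : (fun n => _) = fun n => Num.sqrt ((Q n)^-1)) //.
by apply/funext => n; rewrite sqrtrV // ltW ?Qn_gt0.
Qed.

Lemma pmean_positive s : (pmean positive_jump n (ff R s) / Q n ^+ s - msn s n)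
  @[n --> \oo] --> (0 : R).
Proof.
have J0 : positive_jump 0%N = false by [].
case: s => [|s].
  apply: cvg_near_cst; apply: nearW => n; rewrite msn0 expr0 divr1.
  by rewrite (pmean_ext _ _ (g := fun=> 1)) ?pmean_cst ?subrr.
have [K K0 hK] := user_le R s.+1.
pose C := s.+1`!%:R * (s.+2%:R * (8 * e) ^+ s).
apply: (@cvg_dominated _ _ (fun n => K * 2 ^+ s.+1 * (rn R n)^-1 + C * (Q n)^-1)); last first.
  rewrite -[X in _ --> X](_ : K * 2 ^+ s.+1 * 0 + C * 0 = 0); last by rewrite !mulr0 addr0.
  by apply: cvgD; apply: cvgM; try exact: cvg_cst; [exact: invrn_cvg|exact: invQ_cvg].
apply: nearW => n; rewrite subr0 pmean_ser // -[sderiv _]/(xser R positive_jump s.+1).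
have q0 := Qn_gt0 R n; have a0 := ser_a_gt0 R n.+1.
rewrite xserE [vser _ _ _ _ + _]addrC.
have V : vser R positive_jump s.+1 n.+1 = s.+1`!%:R * ((a - 1) ^+ s.+2) n.+1.
  rewrite /vser jump_series_positive -exprMn ser_ta -exprSr natsE mulr_natl //.
have P p m : 0 <= ((a ^+ p.+1) m - ((a - 1) ^+ p.+1) m) <= p.+1%:R * (a ^+ p) m.
  elim: p m => [|p IH] m.
    have -> : (a ^+ 1) m - ((a - 1) ^+ 1) m = (m == 0%N)%:R.
      by rewrite !expr1 addsE oppsE ones; ring.
    by rewrite expr0 mul1r ones ler0n lexx.
  have E : (a ^+ p.+2 - (a - 1) ^+ p.+2) = a * (a ^+ p.+1 - (a - 1) ^+ p.+1) + (a - 1) ^+ p.+1.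
    by rewrite [a ^+ p.+2]exprS [(a - 1) ^+ p.+2]exprS; ring.
  have -> : (a ^+ p.+2) m - ((a - 1) ^+ p.+2) m = (a ^+ p.+2 - (a - 1) ^+ p.+2) m by rewrite addsE oppsE.
  rewrite E addsE; have A k := sX_ge0 p.+1 k (ser_a1_ge0 R).
  have B k : 0 <= (a ^+ p.+1 - (a - 1) ^+ p.+1) k by rewrite addsE oppsE; case/andP: (IH k).
  rewrite addr_ge0 ?A ?smul_ge0 //=; last exact: ser_a_ge0.
  have -> : p.+2%:R = p.+1%:R + 1 :> R by rewrite natr1.
  rewrite mulrDl mul1r; apply: lerD.
    rewrite [X in _ <= _ * X m]exprS; apply: smul_le_const; first exact: ser_a_ge0.
    by move=> k _; rewrite addsE oppsE; case/andP: (IH k).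
  by rewrite -subr_ge0; case/andP: (IH m).
rewrite V; have := P s.+1 n.+1; set x := (a ^+ _) _; set y := ((a - 1) ^+ _) _ => /andP[xy1 xy2].
have -> : (user R positive_jump s.+1 n.+1 + s.+1`!%:R * y) / a n.+1 / Q n ^+ s.+1 - msn s.+1 n =
   user R positive_jump s.+1 n.+1 / a n.+1 / Q n ^+ s.+1 + - (s.+1`!%:R * ((x - y) / a n.+1 / Q n ^+ s.+1)).
  rewrite /msn -/x; have h : Q n ^+ s.+1 != 0 by rewrite expf_neq0 // gt_eqF.
  by field; rewrite h gt_eqF.
apply: le_trans (ler_normB _ _) _; apply: lerD.
  rewrite ger0_norm; last first.
    by rewrite !divr_ge0 ?ser_a_ge0 ?exprn_ge0 ?(ltW q0) ?user_ge0.
  rewrite !ler_pdivrMr ?exprn_gt0 //; apply: le_trans (hK _ _ admissible_positive n.+1) _.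
  rewrite /W expr1n mul1r.
  apply: le_trans (_ : K * ((2 * Q n) ^+ s.+1 * a n.+1) / rn R n <= _); last first.
    by rewrite exprMn; apply: eq_imp_le; field; rewrite gt_eqF ?rn_gt0.
  apply: ler_pM; rewrite ?mulr_ge0 ?invr_ge0 ?exprn_ge0 ?ser_a_ge0 ?(ltW (rn_gt0 _ _)) ?Qn_ge0 //.
    apply: ler_wpM2l => //; rewrite ler_pM2r //; apply: lerXn2r; rewrite ?nnegrE ?Qn_ge0 ?Qn_succ //.
    by rewrite mulr_ge0 // ltW.
  by rewrite lef_pV2 ?posrE ?rn_gt0 // rn_le.
rewrite ger0_norm; last first.
  by rewrite mulr_ge0 // !divr_ge0 ?ser_a_ge0 ?exprn_ge0 ?(ltW q0).
rewrite /C -[leRHS]mulrA; apply: ler_wpM2l => //.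
apply: le_trans (_ : s.+2%:R * ((a ^+ s.+1) n.+1 / (Q n ^+ s * a n.+1)) / Q n <= _); last first.
  rewrite ler_pM2r ?invr_gt0 //; apply: ler_wpM2l => //; exact: aX_ratio_le.
rewrite (_ : _ / Q n = s.+2%:R * (a ^+ s.+1) n.+1 / a n.+1 / Q n ^+ s.+1); last first.
  by rewrite [Q n ^+ s.+1]exprS; field; rewrite !gt_eqF ?exprn_gt0.
by rewrite !ler_pM2r ?invr_gt0 ?exprn_gt0.
Qed.

End AllIncrements.

(** * The Rayleigh distribution *)

Section Rayleigh.
Variable R : realType.
Let mu := @lebesgue_measure R.
Local Notation D := (`[(0 : R), +oo[%classic).
Local Notation pdf := (@rayleigh_pdf R).

Lemma is_derive_continuous (f df : R -> R) : (forall x : R, is_derive x 1 f (df x)) -> continuous f.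
Proof.
move=> h x; apply: differentiable_continuous; apply/derivable1_diffP.
by apply: ex_derive.
Qed.

Lemma cvgy_expN2 (c : R) : 0 < c -> expR (- (x ^+ 2) / c) @[x --> +oo] --> (0 : R).
Proof.
move=> c0; rewrite (_ : (fun x => _) = (fun x => expR (- x)) \o (fun x => x ^+ 2 / c)); last first.
  by apply/funext => x /=; rewrite mulNr.
apply: cvg_comp (@cvgr_expR R).
apply/cvgryPge => A; near=> x.
have x1 : 1 <= x by near: x; apply: nbhs_pinfty_ge; rewrite num_real.
have xA : A * c <= x by near: x; apply: nbhs_pinfty_ge; rewrite num_real.
by rewrite ler_pdivlMr // (le_trans xA) // expr2 ler_peMr // (le_trans ler01).
Unshelve. all: by end_near.
Qed.

Lemma integral_dominating : (\int[mu]_(t in D) (t * expR (- (t ^+ 2) / 4))%:E = 2%:E)%E.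
Proof.
have dF (x : R) : is_derive x 1 (fun t : R => - 2 * expR (- (t ^+ 2) / 4)) (x * expR (- (x ^+ 2) / 4)).
  by apply: is_derive_eq; rewrite /GRing.scale /=; field.
have df (x : R) : is_derive x 1 (fun t : R => t * expR (- (t ^+ 2) / 4))
   (expR (- (x ^+ 2) / 4) - x ^+ 2 / 2 * expR (- (x ^+ 2) / 4)).
  by apply: is_derive_eq; rewrite /GRing.scale /=; field.
rewrite (@ge0_continuous_FTC2y _ _ (fun t : R => - 2 * expR (- (t ^+ 2) / 4)) 0 0).
- by rewrite expr0n /= oppr0 mul0r expR0 mulr1 -EFinB sub0r opprK.
- by move=> x x0; rewrite mulr_ge0 // expR_ge0.
- exact/continuous_subspaceT/(is_derive_continuous df).
- by rewrite -(mulr0 (- 2 : R)); apply: cvgM; [exact: cvg_cst|exact: cvgy_expN2].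
- by move=> x _; apply: ex_derive.
- by apply: cvg_at_right_filter; apply: (is_derive_continuous dF).
- by move=> x _; rewrite derive1E; apply: derive_val.
Qed.

Lemma measurable_D : measurable D. Proof. exact: measurable_itv. Qed.

Lemma D_ge0 t : D t -> 0 <= t.
Proof. by rewrite /= in_itv /= andbT. Qed.

Lemma continuous_measurable_D (f : R -> R) : continuous f -> measurable_fun D f.
Proof. move=> cf; apply: measurable_funTS; exact: continuous_measurable_fun. Qed.

Lemma continuous_expN2 (c : R) : continuous (fun t : R => expR (- (t ^+ 2) / c)).
Proof.
have h (x : R) : is_derive x 1 (fun t : R => expR (- (t ^+ 2) / c)) (- 2 * x / c * expR (- (x ^+ 2) / c)).
  by apply: is_derive_eq; rewrite /GRing.scale /=; ring.
exact: is_derive_continuous h.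
Qed.

Lemma integrable_dominating : mu.-integrable D (EFin \o (fun t => t * expR (- (t ^+ 2) / 4))).
Proof.
apply/integrableP; split.
  apply/measurable_EFinP; apply: continuous_measurable_D => x; apply: cvgM; first exact: cvg_id.
  exact: continuous_expN2.
rewrite (_ : integral _ _ _ = 2%:E) ?ltry // -integral_dominating.
apply: eq_integral => t; rewrite inE => /D_ge0 t0 /=; congr (_%:E).
by rewrite ger0_norm // mulr_ge0 // expR_ge0.
Qed.

Lemma continuous_pdf : continuous pdf.
Proof. by move=> x; apply: cvgM; [exact: cvg_id|exact: continuous_expN2]. Qed.

Lemma pdf_ge0 t : 0 <= t -> 0 <= pdf t.
Proof. by move=> t0; rewrite /rayleigh_pdf mulr_ge0 // expR_ge0. Qed.

(* Below e^(t^2/4), so that the product with the Rayleigh density is dominated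
   by t e^(-t^2/4), which has an explicit primitive. *)
Definition tame (f : R -> R) := continuous f /\
  exists C, forall t, 0 <= t -> `|f t| <= C * expR (t ^+ 2 / 4).

Definition ray (f : R -> R) : R := \int[mu]_(t in D) (f t * pdf t).

Lemma tame_integrable f : tame f -> mu.-integrable D (EFin \o (fun t => f t * pdf t)).
Proof.
move=> [cf [C hC]].
have mD := measurable_D.
apply: (@le_integrable _ _ _ mu D mD _ (fun t => (C%:E * (t * expR (- (t ^+ 2) / 4))%:E)%E)).
- by apply/measurable_EFinP; apply: continuous_measurable_D => x; apply: cvgM; [exact: cf|exact: continuous_pdf].
- move=> t /D_ge0 t0 /=; rewrite lee_fin.
  have p0 := pdf_ge0 t0; have h := hC t t0.
  rewrite normrM (ger0_norm p0); apply: le_trans (ler_norm _).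
  apply: le_trans (ler_wpM2r p0 h) _.
  apply: eq_imp_le.
  have -> : expR (- (t ^+ 2) / 4) = expR (t ^+ 2 / 4) * expR (- (t ^+ 2) / 2).
    by rewrite -expRD; congr expR; field.
  by rewrite /rayleigh_pdf; ring.
- exact: integrableZl integrable_dominating.
Qed.

Lemma tameD f g : tame f -> tame g -> tame (fun t => f t + g t).
Proof.
move=> [cf [C hC]] [cg [C' hC']]; split; first by move=> x; apply: cvgD; [exact: cf|exact: cg].
exists (C + C') => t t0; rewrite mulrDl; apply: le_trans (ler_normD _ _) _.
by apply: lerD; [exact: hC|exact: hC'].
Qed.

Lemma tameZ k f : tame f -> tame (fun t => k * f t).
Proof.
move=> [cf [C hC]]; split; first by move=> x; apply: cvgM; [exact: cvg_cst|exact: cf].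
by exists (`|k| * C) => t t0; rewrite normrM -mulrA ler_wpM2l // hC.
Qed.

Lemma tame_sum (I : Type) (s : seq I) (F : I -> R -> R) :
  (forall i, tame (F i)) -> tame (fun t => \sum_(i <- s) F i t).
Proof.
move=> hF; elim: s => [|i s IH].
  rewrite (_ : (fun t => _) = fun=> 0); last by apply/funext => t; rewrite big_nil.
  split; first by move=> x; exact: cvg_cst.
  by exists 0 => t _; rewrite normr0 mul0r.
rewrite (_ : (fun t => _) = fun t => F i t + \sum_(j <- s) F j t).
  exact: tameD.
by apply/funext => t; rewrite big_cons.
Qed.

Lemma tameM_bounded (f g : R -> R) : continuous g -> (forall t, 0 <= t -> `|g t| <= 1) ->
  tame f -> tame (fun t => f t * g t).
Proof.
move=> cg hg [cf [C hC]]; split; first by move=> x; apply: cvgM; [exact: cf|exact: cg].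
exists C => t t0; rewrite normrM; apply: le_trans (hC t t0).
by rewrite ler_piMr // hg.
Qed.

Lemma expR_ge_pow (x : R) n : 0 <= x -> x ^+ n <= n`!%:R * expR x.
Proof.
move=> x0; case: n => [|n].
  by rewrite expr0 fact0 mul1r -expR0 ler_expR.
have := expR_ge1Dxn n x0; have f0 : (0 : R) < n.+1`!%:R by rewrite ltr0n fact_gt0.
move=> h; rewrite mulrC -ler_pdivrMr //; apply: le_trans h; rewrite lerDr //.
Qed.

Lemma tame_pow s : tame (fun t => t ^+ s).
Proof.
split; first exact: exprn_continuous.
exists (1 + 4 ^+ s * s`!%:R) => t t0.
rewrite ger0_norm ?exprn_ge0 // mulrDl mul1r.
have e1 : 1 <= expR (t ^+ 2 / 4) by rewrite -expR0 ler_expR divr_ge0 // sqr_ge0.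
have := @expR_ge_pow (t ^+ 2 / 4) s (ltac:(by rewrite divr_ge0 // sqr_ge0)) => h.
have h2 : t ^+ (2 * s)%N <= 4 ^+ s * s`!%:R * expR (t ^+ 2 / 4).
  rewrite expr_div_n -exprM ler_pdivrMr ?exprn_gt0 // in h; apply: le_trans h _.
  by apply: eq_imp_le; ring.
apply: le_trans (_ : 1 + t ^+ (2 * s)%N <= _); last exact: lerD.
case: (lerP t 1) => t1.
  by apply: le_trans (exprn_ile1 _ _ _) _ => //; rewrite lerDl exprn_ge0.
apply: le_trans (_ : t ^+ (2 * s)%N <= _); last by rewrite lerDr.
by rewrite ler_eXn2l // mulSn mul1n leq_addr.
Qed.

Lemma tame_cst k : tame (fun=> k).
Proof.
rewrite (_ : (fun=> k) = fun t : R => k * t ^+ 0); first exact/tameZ/tame_pow.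
by apply/funext => t; rewrite expr0 mulr1.
Qed.

Lemma rayD f g : tame f -> tame g -> ray (fun t => f t + g t) = ray f + ray g.
Proof.
move=> tf tg; rewrite /ray -RintegralD ?measurable_D //; try exact: tame_integrable.
by apply: eq_Rintegral => t _; rewrite mulrDl.
Qed.

Lemma rayZ k f : tame f -> ray (fun t => k * f t) = k * ray f.
Proof.
move=> tf; rewrite /ray -RintegralZl ?measurable_D //; last exact: tame_integrable.
by apply: eq_Rintegral => t _; rewrite mulrA.
Qed.

Lemma ray_le (f g : R -> R) : tame f -> tame g -> (forall t, 0 <= t -> f t <= g t) -> ray f <= ray g.
Proof.
move=> tf tg h; apply: le_Rintegral; try exact: tame_integrable; first exact: measurable_D.
by move=> t /D_ge0 t0; rewrite ler_wpM2r ?pdf_ge0 ?h.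
Qed.

Lemma ray_dist_le (f g h : R -> R) : tame f -> tame g -> tame h ->
  (forall t, 0 <= t -> `|f t - g t| <= h t) -> `|ray f - ray g| <= ray h.
Proof.
move=> tf tg th fgh; have tN : tame (fun t => -1 * g t) := tameZ _ tg.
have tNh : tame (fun t => -1 * h t) := tameZ _ th.
rewrite -mulN1r -rayZ // -rayD // ler_norml -[- ray h]mulN1r -rayZ //.
by apply/andP; split; apply: ray_le => //; try exact: tameD;
  move=> t t0; have := fgh t t0; rewrite ler_norml !mulN1r => /andP[].
Qed.

Lemma ray_sum (I : Type) (s : seq I) (F : I -> R -> R) :
  (forall i, tame (F i)) -> ray (fun t => \sum_(i <- s) F i t) = \sum_(i <- s) ray (F i).
Proof.
move=> hF; elim: s => [|i s IH].
  rewrite big_nil (_ : (fun t => _) = fun t => 0 * (t ^+ 0)).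
    by rewrite rayZ ?mul0r //; exact: tame_pow.
  by apply/funext => t; rewrite big_nil mul0r.
rewrite big_cons -IH -rayD //; last exact: tame_sum.
by congr ray; apply/funext => t; rewrite big_cons.
Qed.

Lemma ray_ext (f g : R -> R) : (forall t, 0 <= t -> f t = g t) -> ray f = ray g.
Proof. by move=> h; apply: eq_Rintegral => t; rewrite inE => /D_ge0 t0; rewrite h. Qed.

Definition ray_moment s := ray (fun t => t ^+ s).

Lemma rayleigh_momentE s : rayleigh_moment R s = ray_moment s.
Proof. by []. Qed.

Lemma ray_ge0 (f : R -> R) : (forall t, 0 <= t -> 0 <= f t) -> 0 <= ray f.
Proof.
by move=> h; apply: Rintegral_ge0 => t /D_ge0 t0; rewrite mulr_ge0 ?pdf_ge0 ?h.
Qed.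

Lemma ray_moment_convex s : ray_moment s.+1 ^+ 2 <= ray_moment s * ray_moment s.+2.
Proof.
apply: discriminant_le; first by apply: ray_ge0 => t t0; rewrite exprn_ge0.
move=> x; rewrite /ray_moment -mulNr -!rayZ -?rayD; try by do ?[exact: tame_pow|apply: tameZ|apply: tameD].
apply: ray_ge0 => t t0.
have -> : t ^+ s.+2 + - (2 * x) * t ^+ s.+1 + x ^+ 2 * t ^+ s = t ^+ s * (t - x) ^+ 2.
  by rewrite !exprS; ring.
by rewrite mulr_ge0 ?sqr_ge0 // exprn_ge0.
Qed.

Lemma ray_moment0 : ray_moment 0 = 1.
Proof.
have dF (x : R) : is_derive x 1 (fun t : R => - expR (- (t ^+ 2) / 2)) (pdf x).
  by apply: is_derive_eq; rewrite /rayleigh_pdf /GRing.scale /=; field.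
rewrite /ray_moment /ray; under eq_Rintegral do rewrite expr0 mul1r.
rewrite (@Rintegral_ge0_continuous_FTC2y _ _ (fun t : R => - expR (- (t ^+ 2) / 2)) 0 0).
- by rewrite expr0n /= oppr0 mul0r expR0 sub0r opprK.
- by move=> x x0; exact: pdf_ge0.
- exact/continuous_subspaceT/continuous_pdf.
- by rewrite -[0 in X in _ --> X]oppr0; apply: cvgN; exact: cvgy_expN2.
- by move=> x _; apply: ex_derive.
- by apply: cvg_at_right_filter; apply: (is_derive_continuous dF).
- by move=> x _; rewrite derive1E; apply: derive_val.
Qed.

Lemma ray1 : ray (fun=> 1) = 1.
Proof. by rewrite -[RHS]ray_moment0; apply: ray_ext => t _; rewrite expr0. Qed.

Lemma ray_momentSS s : ray_moment s.+2 = s.+2%:R * ray_moment s.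
Proof.
have [_ [K hK]] := tameZ s.+2%:R (tame_pow s).
have [_ [C hC]] := tame_pow s.+2.
pose e2 (t : R) := expR (- (t ^+ 2) / 2); pose e4 (t : R) := expR (- (t ^+ 2) / 4).
pose F (t : R) := - t ^+ s.+2 * e2 t - 2 * K * e4 t.
pose f (t : R) := t ^+ s.+2 + - s.+2%:R * t ^+ s + K * expR (t ^+ 2 / 4).
have te : tame (fun t : R => expR (t ^+ 2 / 4)).
  split; last by exists 1 => t _; rewrite mul1r ger0_norm // expR_ge0.
  have h (x : R) : is_derive x 1 (fun t : R => expR (t ^+ 2 / 4)) (x / 2 * expR (x ^+ 2 / 4)).
    by apply: is_derive_eq; rewrite /GRing.scale /=; field.
  exact: is_derive_continuous h.
have E4 t : expR (t ^+ 2 / 4) * e2 t = e4 t.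
  by rewrite /e2 /e4 -expRD; congr expR; field.
have dF (x : R) : is_derive x 1 F (f x * pdf x).
  have d2 (y : R) : is_derive y 1 e2 (- y * e2 y).
    by apply: is_derive_eq; rewrite /e2 /GRing.scale /=; field.
  have d4 (y : R) : is_derive y 1 e4 (- y / 2 * e4 y).
    by apply: is_derive_eq; rewrite /e4 /GRing.scale /=; field.
  have dp (y : R) : is_derive y 1 (fun t : R => t ^+ s.+2) (s.+2%:R * y ^+ s.+1).
    rewrite (_ : (fun t : R => t ^+ s.+2) = (id : R -> R) ^+ s.+2); last first.
      by apply/funext => t; rewrite fctE.
    apply: is_derive_eq.
    by rewrite /GRing.scale /= mulr1.
  refine (is_derive_eq (is_deriveB (is_deriveM (is_deriveN (dp x)) (d2 x))
    (is_deriveM (is_derive_cst (2 * K) x 1) (d4 x))) _).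
  by rewrite -[(- _) x]/(- x ^+ s.+2) /f /rayleigh_pdf -/(e2 x) -(E4 x) /GRing.scale /= (exprS x s.+1) (exprS x s); field.
have tf : tame f.
  by apply: tameD; [apply: tameD; [exact: tame_pow|exact/tameZ/tame_pow]|exact: tameZ].
have K1 : ray (fun t : R => expR (t ^+ 2 / 4)) = 2.
  rewrite /ray /Rintegral (_ : integral _ _ _ = 2%:E) // -integral_dominating.
  apply: eq_integral => t _; congr (_%:E); rewrite -/(e4 t) -E4 /rayleigh_pdf -/(e2 t); ring.
have F1 : ray f = 2 * K.
  rewrite /ray (@Rintegral_ge0_continuous_FTC2y _ _ F 0 0).
  - by rewrite /F /e2 /e4 !expr0n /= !oppr0 !mul0r expR0; ring.
  - move=> x x0; rewrite mulr_ge0 ?pdf_ge0 // /f.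
    have := hK x x0; rewrite ger0_norm ?mulr_ge0 ?exprn_ge0 // => h.
    by have : 0 <= x ^+ s.+2 by [rewrite exprn_ge0]; lra.
  - apply: continuous_subspaceT => x; apply: cvgM; [exact: tf.1|exact: continuous_pdf].
  - rewrite -[X in _ --> X](_ : - 0 - 2 * K * 0 = 0 :> R); last by ring.
    apply: cvgB; last by apply: cvgM; [exact: cvg_cst|exact: cvgy_expN2].
    under eq_fun do rewrite mulNr.
    apply: cvgN; apply: (@squeeze_cvgr _ _ _ _ (fun=> 0) (fun t => C * e4 t)).
    + near=> t; have t0 : 0 <= t by near: t; apply: nbhs_pinfty_ge; rewrite num_real.
      rewrite mulr_ge0 ?exprn_ge0 ?expR_ge0 //=.
      have := hC t t0; rewrite ger0_norm ?exprn_ge0 // => h.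
      by rewrite -E4 mulrA; apply: ler_wpM2r => //; exact: expR_ge0.
    + exact: cvg_cst.
    + by rewrite -(mulr0 C); apply: cvgM; [exact: cvg_cst|exact: cvgy_expN2].
  - by move=> x _; apply: ex_derive.
  - by apply: cvg_at_right_filter; apply: (is_derive_continuous dF).
  - by move=> x _; rewrite derive1E; apply: derive_val.
have : ray f = ray_moment s.+2 + - s.+2%:R * ray_moment s + K * 2.
  rewrite /f rayD ?rayD ?rayZ ?K1 //; try exact: tame_pow.
  - exact/tameZ/tame_pow.
  - by apply: tameD; [exact: tame_pow|exact/tameZ/tame_pow].
  - exact: tameZ.
rewrite F1; lra.
Unshelve. all: by end_near.
Qed.

Lemma ray_moment1_gt0 : 0 < ray_moment 1.
Proof.
have h1 := ray_moment_convex 1; have h0 : 0 <= ray_moment 1.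
  by apply: ray_ge0 => t t0; rewrite exprn_ge0.
have m2 : ray_moment 2 = 2 by rewrite ray_momentSS ray_moment0 mulr1.
have m3 : ray_moment 3 = 3 * ray_moment 1 by rewrite ray_momentSS.
rewrite lt_neqAle h0 andbT; apply/eqP => E; move: h1; rewrite m2 m3 -E.
by rewrite mul0r; lra.
Qed.

End Rayleigh.

Section OneSize.
Variable R : realType.
Local Notation a := (ser_a R).
Local Notation e := (expR 1 : R).
Local Notation Q := (Qn R).

Definition jump_rate j : R := ser_t R j * expR (- j%:R).

Lemma jump_rate_ge0 j : 0 <= jump_rate j.
Proof.
apply: mulr_ge0; last exact: expR_ge0.
by case: j => [|j] //; apply/ltW/ser_t_gt0.
Qed.

Lemma lamE n j : (0 < j)%N -> lam R n j = Num.sqrt n%:R * jump_rate j.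
Proof.
case: j => // j _; rewrite /lam /jump_rate /ser_t expRN -!mulrA; congr (_ * (_ * _)).
by rewrite invfM.
Qed.

Lemma shift_mul j (u : fps R) n : (jump_series R (pred1 j) * u) n =
  if (j <= n)%N then ser_t R j * u (n - j)%N else 0.
Proof.
rewrite mulsE; case: ifP => jn.
  have jn' : (j < n.+1)%N by rewrite ltnS.
  rewrite (bigD1 (Ordinal jn')) //= /jump_series /= eqxx big1 ?addr0 // => i.
  by rewrite -val_eqE /= => /negPf ->; rewrite mul0r.
apply: big1 => i _; rewrite /jump_series /=; case: eqP => [E|_]; last by rewrite mul0r.
by have := ltn_ord i; rewrite ltnS E jn.
Qed.

Lemma shiftX_mul j s (u : fps R) n : (jump_series R (pred1 j) ^+ s * u) n =
  if (j * s <= n)%N then ser_t R j ^+ s * u (n - j * s)%N else 0.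
Proof.
elim: s n => [|s IH] n; first by rewrite muln0 subn0 !expr0 !mul1r.
rewrite exprS -mulrA shift_mul IH mulnS.
case: (leqP j n) => jn; last by rewrite leqNgt ltn_addr.
rewrite leq_subRL //; case: ifP => h; last by rewrite mulr0.
by rewrite exprS mulrA subnDA.
Qed.

Lemma admissible_one j : (0 < j)%N -> admissible (pred1 j) (jump_rate j).
Proof.
move=> j0; split=> [||n]; [by case: j j0|exact: jump_rate_ge0|].
have -> : a * jump_series R (pred1 j) * a = jump_series R (pred1 j) * (a * a).
  by rewrite [a * _]mulrC mulrA.
rewrite shift_mul; case: ifP => jn; last first.
  apply: mulr_ge0; last by apply: mulr_ge0; [exact: Qn_ge0|exact: ser_a_ge0].
  apply: mulr_ge0; last exact: jump_rate_ge0.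
  by rewrite mulr_ge0 ?expR_ge0.
apply: le_trans (_ : ser_t R j * (4 * expR (n - j)%:R) <= _).
  by apply: ler_wpM2l (ser_aa_le R (n - j)); apply/ltW/ser_t_gt0.
rewrite natrB // expRD.
have -> : ser_t R j * (4 * (expR n%:R * expR (- j%:R))) = 4 * jump_rate j * expR n%:R.
  by rewrite /jump_rate; ring.
apply: le_trans (_ : 4 * jump_rate j * (e * Q n * a n) <= _).
  by apply: ler_wpM2l (expR_le_ser_a R n); rewrite mulr_ge0 ?jump_rate_ge0.
by apply: eq_imp_le; ring.
Qed.

Lemma fact_momentE n j s : fact_moment R n j s = pmean (pred1 j) n (ff R s).
Proof.
rewrite /fact_moment -sum_pmean; apply: eq_bigr => k _; rewrite lawXjE //.
Qed.

Lemma pmean_xser j n s : (0 < j)%N ->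
  pmean (pred1 j) n (ff R s) = xser R (pred1 j) s n.+1 / a n.+1.
Proof. by move=> j0; rewrite pmean_ser //; case: j j0. Qed.

Lemma Qn_sqrt n : (0 < n)%N -> Q n.+1 <= 2 * Num.sqrt n%:R.
Proof.
move=> n0; rewrite -(@ler_pXn2r _ 2) ?nnegrE ?mulr_ge0 ?sqrtr_ge0 ?Qn_ge0 //.
by rewrite exprMn Qn_sqr sqr_sqrtr // -natrX -natrM ler_nat; lia.
Qed.

Lemma fact_moment_le s : exists C : R, forall n j, (0 < n)%N -> (0 < j)%N ->
  fact_moment R n j s <= C * lam R n j ^+ s.
Proof.
have [Kv Kv0 hv] := vser_le R s; have [Ku Ku0 hu] := user_le R s.
exists ((Kv + Ku) * 2 ^+ s) => n j n0 j0; rewrite fact_momentE pmean_xser //.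
have adm := admissible_one j0; have a0 := ser_a_gt0 R n.+1.
rewrite xserE ler_pdivrMr //.
have W0 := W_ge0 adm s n.+1.
apply: le_trans (_ : (Kv + Ku) * W (jump_rate j) s n.+1 <= _).
  rewrite mulrDl; apply: lerD; first exact: hv.
  apply: le_trans (hu _ _ adm _) _; apply: ler_piMr; first exact: mulr_ge0.
  by rewrite invf_le1 ?rn_gt0 ?rn_ge1.
have -> (x y z : R) : (Kv + Ku) * x * y * z = (Kv + Ku) * (x * y * z) by ring.
apply: ler_wpM2l; first exact: addr_ge0.
rewrite /W; apply: ler_wpM2r; first exact: ltW.
have g0 := jump_rate_ge0 j; have q0 := Qn_ge0 R n.+1.
have s0 : 0 <= Num.sqrt n%:R :> R := sqrtr_ge0 _.
rewrite lamE // -!exprMn; apply: lerXn2r.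
- by rewrite nnegrE; apply: mulr_ge0.
- by rewrite nnegrE; apply: mulr_ge0 => //; apply: mulr_ge0.
have -> (x y : R) : 2 * (x * y) = 2 * x * y by ring.
by rewrite [leLHS]mulrC; apply: ler_wpM2r; [exact: jump_rate_ge0|exact: Qn_sqrt].
Qed.

Lemma fact_moment_ge0 n j s : 0 <= fact_moment R n j s.
Proof. by rewrite fact_momentE; apply: pmean_ge0 => c; exact: ff_ge0. Qed.

Lemma jump_rate_le j : (0 < j)%N -> jump_rate j <= j%:R^-1.
Proof.
case: j => // j _; have j0 : (0 : R) < j.+1%:R by rewrite ltr0n.
rewrite -[leRHS]mul1r ler_pdivlMr //.
have -> : jump_rate j.+1 * j.+1%:R = alpha R j.+1.
  by rewrite /jump_rate /alpha /ser_a /ser_t exprS; ring.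
apply: le_trans (alpha_Qn_le R j.+1); rewrite ler_peMr ?Qn_ge1 //.
exact/ltW/alpha_gt0.
Qed.

Lemma alpha_sqr_up m n : (m <= n)%N -> alpha R m.+1 ^+ 2 * m.+1%:R <= alpha R n.+1 ^+ 2 * n.+1%:R.
Proof.
exact: (homo_leq (f := fun k => alpha R k.+1 ^+ 2 * k.+1%:R) lexx le_trans (@alpha_up R)).
Qed.

Lemma alpha_sqr_down m n : (m <= n)%N -> alpha R n ^+ 2 * n.+1%:R <= alpha R m ^+ 2 * m.+1%:R.
Proof.
apply: (homo_leq (f := fun k => alpha R k ^+ 2 * k.+1%:R) (r := fun x y => y <= x)).
- exact: lexx.
- by move=> y x z xy yz; exact: le_trans yz xy.
- exact: alpha_down.
Qed.

Lemma invn_cvg : (n%:R^-1 : R) @[n --> \oo] --> (0 : R).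
Proof. by apply/gtr0_cvgV0; [exists 1%N => // n; rewrite /= ltr0n|exact: cvgr_idn]. Qed.

Section Sequence.
Variable j : nat -> nat.
Hypothesis j_small : (fun n => (j n)%:R / n%:R : R) @ \oo --> (0 : R).

Lemma j_small_near s : \forall n \near \oo, (j n * s.+1 <= n)%N /\ (1 < n)%N.
Proof.
have s0 : (0 : R) < s.+1%:R^-1 by rewrite invr_gt0 ltr0n.
move/cvgrPdist_lt: j_small => /(_ _ s0) h.
have h2 : \forall n \near \oo, (1 < n)%N by exists 2%N.
apply: filterS2 h h2 => n /= h n1; split=> //.
have n0 : (0 : R) < n%:R by rewrite ltr0n; lia.
move: h; rewrite sub0r normrN ger0_norm ?divr_ge0 // ltr_pdivrMr //.
rewrite mulrC ltr_pdivlMr ?ltr0n // -natrM ltr_nat; exact: ltnW.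
Qed.

Lemma shifted_ratio s (c : nat) : (n - j n * s + c)%:R / n%:R @[n --> \oo] --> (1 : R).
Proof.
apply: (@cvg_of_sub_null _ _ (fun n => 1 + c%:R * n%:R^-1 - s%:R * ((j n)%:R / n%:R))).
  rewrite -[X in _ --> X](_ : 1 + c%:R * 0 - s%:R * 0 = 1); last by rewrite !mulr0 addr0 subr0.
  apply: cvgB; [apply: cvgD; first exact: cvg_cst|].
    by apply: cvgM; [exact: cvg_cst|exact: invn_cvg].
  by apply: cvgM; [exact: cvg_cst|exact: j_small].
apply: cvg_near_cst; near=> n.
have [jn n1] : (j n * s.+1 <= n)%N /\ (1 < n)%N by near: n; exact: j_small_near.
have n0 : n%:R != 0 :> R by rewrite pnatr_eq0; lia.
rewrite natrD natrB; last by rewrite (leq_trans _ jn) // leq_mul2l leqnSn orbT.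
by rewrite natrM; field.
Unshelve. all: by end_near.
Qed.

Lemma Q_ratio s : Q (n - j n * s) / Num.sqrt n%:R @[n --> \oo] --> (1 : R).
Proof.
have h := cvg_comp _ _ (@shifted_ratio s 1%N) (@sqrt_continuous R 1).
rewrite sqrtr1 in h; rewrite (_ : (fun n => _) = fun n => Num.sqrt ((n - j n * s + 1)%:R / n%:R)) //.
by apply/funext => n; rewrite sqrtrM // sqrtrV // addn1.
Qed.

Lemma alpha_ratio s : alpha R (n - j n * s).+1 / alpha R n.+1 @[n --> \oo] --> (1 : R).
Proof.
have sq : (alpha R (n - j n * s).+1 / alpha R n.+1) ^+ 2 @[n --> \oo] --> (1 : R).
  have shift0 c : (n + c)%:R / n%:R @[n --> \oo] --> (1 : R).
    by have := @shifted_ratio 0%N c; under eq_fun do rewrite muln0 subn0.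
  have lo : ((n + 2)%:R / n%:R) / ((n - j n * s + 2)%:R / n%:R) @[n --> \oo] --> (1 : R).
    rewrite -[X in _ --> X](divr1 (1 : R)); apply: cvgM; first exact: shift0.
    by apply: cvgV; [exact: oner_neq0|exact: shifted_ratio].
  have hi : ((n + 1)%:R / n%:R) / ((n - j n * s + 1)%:R / n%:R) @[n --> \oo] --> (1 : R).
    rewrite -[X in _ --> X](divr1 (1 : R)); apply: cvgM; first exact: shift0.
    by apply: cvgV; [exact: oner_neq0|exact: shifted_ratio].
  apply: squeeze_cvgr lo hi; exists 1%N => // n /= n0.
  have nn : (n%:R : R) != 0 by rewrite pnatr_eq0; lia.
  have c2 (x y : nat) : (x%:R / n%:R) / (y.+1%:R / n%:R) = x%:R / y.+1%:R :> R.
    by rewrite invfM invrK mulrACA mulVf ?mulr1.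
  rewrite !addn1 !addn2 !c2 expr_div_n.
  have a1 := alpha_gt0 R n.+1; have hm : (n - j n * s <= n)%N := leq_subr _ _.
  apply/andP; split.
    rewrite ler_pdivlMr ?exprn_gt0 // mulrAC ler_pdivrMr ?ltr0n // mulrC.
    exact: (@alpha_sqr_down (n - j n * s).+1 n.+1).
  rewrite ler_pdivrMr ?exprn_gt0 // mulrAC ler_pdivlMr ?ltr0n // [leRHS]mulrC.
  exact: alpha_sqr_up.
have h := cvg_comp _ _ sq (@sqrt_continuous R 1); rewrite sqrtr1 in h.
rewrite (_ : (fun n => _) = fun n => Num.sqrt ((alpha R (n - j n * s).+1 / alpha R n.+1) ^+ 2)) //.
by apply/funext => n; rewrite sqrtr_sqr ger0_norm // divr_ge0 // ltW ?alpha_gt0.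
Qed.

Lemma sub_cvgy s : (n - j n * s)%N @[n --> \oo] --> \oo.
Proof.
apply/cvgnyPge => A.
have h := j_small_near (2 * s).
have h2 : \forall n \near \oo, (2 * A <= n)%N by exists (2 * A)%N.
by apply: filterS2 h h2 => n [h1 _] h2; nia.
Qed.

Local Notation mu := (ray_moment R).

Lemma positive_bounded s : exists C : R, \forall n \near \oo,
  `|pmean positive_jump n (ff R s) / Q n ^+ s| <= C.
Proof.
exists (1 + s`!%:R * (8 * e) ^+ s).
have := cvg_near_bounded (@pmean_positive R s); rewrite normr0 add0r; apply: filterS => n h.
rewrite -[X in `|X|](subrK (msn R s n)) (le_trans (ler_normD _ _)) // lerD //.
by rewrite ger0_norm ?msn_ge0 // msn_le.
Qed.

Lemma msn_cvg s : msn R s n @[n --> \oo] --> mu s.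
Proof.
have Qp : \forall n \near \oo, 0 < Q n by apply: nearW => n; exact: Qn_gt0.
have P := @pmoment_asymp R (fun=> positive_jump) Q (fun=> erefl) Qp (@invQ_cvg R) positive_bounded.
pose A s n := pmoment positive_jump n (Q n) s.
have D k : (A k n - msn R k n) @[n --> \oo] --> (0 : R).
  rewrite (_ : (fun n => _) = fun n => (A k n - pmean positive_jump n (ff R k) / Q n ^+ k) +
     (pmean positive_jump n (ff R k) / Q n ^+ k - msn R k n)).
    by rewrite -[0]addr0; apply: cvgD; [exact: (P k).2|exact: pmean_positive].
  by apply/funext => n; rewrite addrA subrK.
apply: (@cvg_of_sub_null _ _ (A s)); last first.
  rewrite (_ : (fun n => _) = fun n => - (A s n - msn R s n)).
    by rewrite -oppr0; apply: cvgN.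
  by apply/funext => n; rewrite opprB.
apply: (pinned_limit (ray_moment0 R) (ray_moment1_gt0 R) (@ray_momentSS R)
  (@ray_moment_convex R)).
- by move=> n; rewrite /A /pmoment; apply: pmean_cst.
- by move=> k n; apply: pmoment_ge0; exact: Qn_ge0.
- move=> k; rewrite (_ : (fun n => _) = fun n => (A k.+2 n - msn R k.+2 n) -
    k.+2%:R * (A k n - msn R k n) + k.+2%:R * (msn R k.+1 n * (Q n)^-1)).
    rewrite -[0]addr0; apply: cvgD.
      rewrite -[0]subr0; apply: cvgB; first exact: D.
      by rewrite -[X in _ --> X](mulr0 (k.+2%:R : R)); apply: cvgM; [exact: cvg_cst|exact: D].
    rewrite -[X in _ --> X](mulr0 (k.+2%:R : R)); apply: cvgM; first exact: cvg_cst.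
    apply: (@cvg_bounded_mul0 _ _ _ (k.+1`!%:R * (8 * e) ^+ k.+1)); last exact: invQ_cvg.
    by apply: nearW => n; rewrite ger0_norm ?msn_ge0 // msn_le.
  by apply/funext => n; rewrite msn_rec; ring.
- by move=> k n; apply: pmoment_convex; exact: Qn_ge0.
Qed.

Lemma positive_cvg s : pmean positive_jump n (ff R s) / Q n ^+ s @[n --> \oo] --> mu s.
Proof. exact: cvg_of_sub_null (@msn_cvg s) (@pmean_positive R s). Qed.

Hypothesis j_range : forall n, (1 < n)%N -> (0 < j n < n)%N.

Lemma fact_moment_cvg s : fact_moment R n (j n) s / lam R n (j n) ^+ s @[n --> \oo] --> mu s.
Proof.
case: s => [|s].
  rewrite ray_moment0; apply: cvg_near_cst; near=> n.
  have [_ /j_range/andP[jn0 _]] : (j n * 1 <= n)%N /\ (1 < n)%N by near: n; exact: j_small_near.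
  rewrite expr0 divr1 fact_momentE pmean_cst //.
  by case: (j n) jn0.
have [K K0 hK] := user_le R s.+1.
pose m n := (n - j n * s.+1)%N.
pose rA n : R := alpha R (m n).+1 / alpha R n.+1.
pose rQ n : R := Q (m n) / Num.sqrt n%:R.
pose v n : R := msn R s.+1 (m n) * rA n * rQ n ^+ s.+1 - s.+1%:R * (msn R s (m n) * rA n * rQ n ^+ s.+1 * (Q (m n))^-1).
have mcv k : msn R k (m n) @[n --> \oo] --> mu k by apply: cvg_comp (@sub_cvgy s.+1) (@msn_cvg k).
have Acv : rA n @[n --> \oo] --> (1 : R) := @alpha_ratio s.+1.
have Qcv : rQ n ^+ s.+1 @[n --> \oo] --> (1 : R).
  have h := cvg_comp _ _ (@Q_ratio s.+1) (@exprn_continuous R s.+1 1).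
  by rewrite expr1n in h.
have mcv' k : msn R k (m n) * rA n * rQ n ^+ s.+1 @[n --> \oo] --> mu k.
  rewrite -[mu k]mulr1 -[X in X * 1]mulr1; apply: cvgM => //; exact: cvgM.
apply: (@cvg_of_sub_null _ _ v).
  rewrite -[mu _]subr0; apply: cvgB; first exact: mcv'.
  rewrite -[X in _ --> X](_ : s.+1%:R * (mu s * 0) = 0); last by rewrite !mulr0.
  apply: cvgM; first exact: cvg_cst.
  apply: cvgM; first exact: mcv'.
  exact: cvg_comp (@sub_cvgy s.+1) (@invQ_cvg R).
apply: (@cvg_dominated _ _ (fun n => K * 2 ^+ s.+1 * (rn R n)^-1)); last first.
  by rewrite -[X in _ --> X](mulr0 (K * 2 ^+ s.+1)); apply: cvgM; [exact: cvg_cst|exact: invrn_cvg].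
near=> n.
have [jn n1] : (j n * s.+2 <= n)%N /\ (1 < n)%N by near: n; exact: j_small_near.
have /andP[j0 _] := j_range n1.
have n0 : (0 < n)%N by lia.
have adm := admissible_one j0; have J0' : pred1 (j n) 0%N = false by case: (j n) j0.
have jr : 0 < jump_rate (j n) by rewrite mulr_gt0 ?expR_gt0 ?ser_t_gt0.
have sn : 0 < Num.sqrt n%:R :> R by rewrite sqrtr_gt0 ltr0n.
have a0 := ser_a_gt0 R n.+1.
rewrite subr0 fact_momentE pmean_xser // lamE //.
rewrite xserE.
have jm : (j n * s.+1 <= n)%N by rewrite (leq_trans _ jn) // leq_mul2l leqnSn orbT.
have V : vser R (pred1 (j n)) s.+1 n.+1 = s.+1`!%:R * (ser_t R (j n) ^+ s.+1 *
    ((a ^+ s.+2) (m n).+1 - (a ^+ s.+1) (m n).+1)).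
  have Ea : a ^+ s.+1 * (a - 1) = a ^+ s.+2 - a ^+ s.+1 by rewrite mulrBr mulr1 -exprSr.
  rewrite /vser natsE -[LHS]mulr_natl -[_ * _ * (a - 1)]mulrA Ea shiftX_mul leqW // subSn //.
have E : vser R (pred1 (j n)) s.+1 n.+1 / a n.+1 / (Num.sqrt n%:R * jump_rate (j n)) ^+ s.+1 = v n.
  rewrite V /v /msn /rA /rQ /alpha /jump_rate -/(m n).
  have eE : expR (- (m n).+1%:R) = expR (- n.+1%:R) * expR (- (j n)%:R) ^- s.+1 :> R.
    rewrite -exprVn -expRN opprK -expRM_natl -expRD; congr expR.
    rewrite /m -subSn // natrB ?leqW // natrM; ring.
  rewrite eE exprMn [(ser_t _ _ * _) ^+ _]exprMn factS natrM.
  have q0 := lt0r_neq0 (Qn_gt0 R (m n)); have am := lt0r_neq0 (ser_a_gt0 R (m n).+1).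
  have tn := lt0r_neq0 (ser_t_gt0 R j0).
  rewrite expr_div_n [Q (m n) ^+ s.+1]exprS.
  have en := lt0r_neq0 (expR_gt0 (- n.+1%:R : R)).
  have ej : expR (- (j n)%:R) ^+ s.+1 != 0 :> R by rewrite expf_neq0 // gt_eqF ?expR_gt0.
  have qs : Q (m n) ^+ s != 0 by rewrite expf_neq0.
  have ts : ser_t R (j n) ^+ s.+1 != 0 by rewrite expf_neq0.
  have ss : Num.sqrt n%:R ^+ s.+1 != 0 :> R by rewrite expf_neq0 // gt_eqF.
  have an := lt0r_neq0 a0.
  move: q0 am en ej qs ts ss an.
  move: (Q (m n)) (Q (m n) ^+ s) (a (m n).+1) (expR (- n.+1%:R)) (expR _ ^+ s.+1) (ser_t _ _ ^+ s.+1) (Num.sqrt _ ^+ s.+1) (a n.+1).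
  move=> q qs' am' en' ej' ts' ss' an' *; field.
  by do !(apply/andP; split).
rewrite [X in `|X|](_ : _ = user R (pred1 (j n)) s.+1 n.+1 / a n.+1 / (Num.sqrt n%:R * jump_rate (j n)) ^+ s.+1); last first.
  by rewrite -E !mulrDl addrAC subrr add0r.
rewrite ger0_norm; last first.
  apply: divr_ge0; first by apply: divr_ge0; [exact: user_ge0|exact: ltW].
  by apply/exprn_ge0/ltW; exact: mulr_gt0.
rewrite !ler_pdivrMr ?(exprn_gt0 _ (mulr_gt0 sn jr)) //.
apply: le_trans (hK _ _ adm n.+1) _; rewrite /W.
have r1 : (rn R n.+1)^-1 <= (rn R n)^-1 by rewrite lef_pV2 ?posrE ?rn_gt0 // rn_le.
apply: le_trans (_ : K * ((2 * Num.sqrt n%:R * jump_rate (j n)) ^+ s.+1 * a n.+1) / rn R n <= _).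
  apply: ler_pM => //.
  - by rewrite !mulr_ge0 ?exprn_ge0 ?(ltW jr) ?(ltW a0) ?Qn_ge0.
  - by rewrite invr_ge0 ltW // rn_gt0.
  - apply: ler_wpM2l => //; rewrite ler_pM2r // mulrC -exprMn; apply: lerXn2r.
    + by rewrite nnegrE; apply: mulr_ge0; [exact: Qn_ge0|exact: ltW].
    + by rewrite nnegrE; apply: mulr_ge0; [apply: mulr_ge0|]; rewrite ?ltW.
    + by rewrite ler_pM2r // Qn_sqrt.
have -> : (2 * Num.sqrt n%:R * jump_rate (j n)) ^+ s.+1 = 2 ^+ s.+1 * (Num.sqrt n%:R * jump_rate (j n)) ^+ s.+1 :> R.
  by rewrite -exprMn [in RHS](mulrA 2).
move: ((Num.sqrt _ * _) ^+ _) (2 ^+ _) => x y.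
by apply: eq_imp_le; ring.
Unshelve. all: by end_near.
Qed.

End Sequence.
End OneSize.

Section GammaMoments.
Variable R : realType.
Let mu := @lebesgue_measure R.

Lemma bigcup_itv0 (u : nat -> R) : (forall A : R, exists n, A <= u n) ->
  \bigcup_n (`[(0 : R), u n]%classic) = `[0, +oo[%classic.
Proof.
move=> hu; apply/seteqP; split => x /=.
  by move=> [n _] /=; rewrite !in_itv /= andbT => /andP[].
rewrite in_itv /= andbT => x0; have [n hn] := hu x; exists n => //=.
by rewrite in_itv /= x0.
Qed.

Lemma cvg_integral0y (f : R -> R) (u : nat -> R) : continuous f -> (forall t, 0 <= t -> 0 <= f t) ->
  (forall A : R, exists n, A <= u n) -> nondecreasing_seq u ->
  (\int[mu]_(x in `[0%R, u n]) (f x)%:E)%E @[n --> \oo] --> (\int[mu]_(x in `[0%R, +oo[) (f x)%:E)%E.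
Proof.
move=> cf f0 hu nu; rewrite -(bigcup_itv0 hu).
apply: ge0_nondecreasing_set_cvg_integral.
- move=> m n mn; apply/subsetPset => x /=; rewrite !in_itv /= => /andP[-> /le_trans]; apply; exact: nu.
- by move=> i; exact: measurable_itv.
- by move=> i; apply/measurable_EFinP; apply: measurable_funTS; exact: continuous_measurable_fun.
- by move=> i x /=; rewrite in_itv /= lee_fin => /andP[x0 _]; exact: f0.
Qed.

Lemma half_square_substitution (G : R -> R) : continuous G -> (forall t, 0 <= t -> 0 <= G t) ->
  (\int[mu]_(t in `[0%R, +oo[) (G t)%:E = \int[mu]_(x in `[0%R, +oo[) (G (x ^+ 2 / 2) * x)%:E)%E.
Proof.
move=> cG G0; pose F (x : R) := x ^+ 2 / 2.
have dF (x : R) : is_derive x 1 F x.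
  by rewrite /F; apply: is_derive_eq; rewrite /GRing.scale /=; field.
have F'E : F^`()%classic = id by apply/funext => x; rewrite derive1E derive_val.
have cF := is_derive_continuous dF.
have step n : (\int[mu]_(t in `[0%R, F n%:R]) (G t)%:E = \int[mu]_(x in `[0%R, n%:R]) (G (F x) * x)%:E)%E.
  have F0 : F 0 = 0 by rewrite /F expr0n /= mul0r.
  rewrite -{1}F0 integration_by_substitution_increasing ?F'E //.
  - move=> x y; rewrite !in_itv /= => /andP[x0 _] /andP[y0 _] xy.
    by rewrite /F ltr_pM2r ?invr_gt0 // ltr_pXn2r // nnegrE.
  - by move=> x _; exact: cvg_id.
  - by apply/cvg_ex; exists 0; apply: cvg_at_right_filter; exact: cvg_id.
  - by apply/cvg_ex; exists n%:R; apply: cvg_at_left_filter; exact: cvg_id.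
  - split; first by move=> x _; apply: ex_derive.
      by apply: cvg_at_right_filter; exact: cF.
    by apply: cvg_at_left_filter; exact: cF.
  - exact: continuous_subspaceT.
have big (A : R) : exists n : nat, A <= n%:R.
  by exists (Num.bound `|A|); apply: le_trans (ler_norm _) _; apply/ltW/archi_boundP.
have L : (\int[mu]_(t in `[0%R, F n%:R]) (G t)%:E)%E @[n --> \oo] --> (\int[mu]_(t in `[0%R, +oo[) (G t)%:E)%E.
  apply: (@cvg_integral0y G (fun n => F n%:R)) => // [A|m n mn].
    have [n hn] := big (A + 2); exists n; apply: le_trans (_ : n%:R - 2 <= _); first lra.
    rewrite /F; have : 0 <= (n%:R - 2) ^+ 2 :> R by rewrite sqr_ge0.
    have : 0 <= n%:R :> R by [].
    move: (n%:R) => x; nra.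
  by rewrite /F ler_pM2r ?invr_gt0 // lerXn2r ?nnegrE // ler_nat.
have H : (\int[mu]_(x in `[0%R, n%:R]) (G (F x) * x)%:E)%E @[n --> \oo] --> (\int[mu]_(x in `[0%R, +oo[) (G (F x) * x)%:E)%E.
  apply: (@cvg_integral0y (fun x => G (F x) * x) (fun n => n%:R)) => //.
  - by move=> x; apply: cvgM; [apply: continuous_comp; [exact: cF|exact: cG]|exact: cvg_id].
  - by move=> t t0; rewrite mulr_ge0 // G0 // /F divr_ge0 // sqr_ge0.
  - by move=> m n mn; rewrite ler_nat.
apply: cvg_unique L _ => //; apply: cvg_trans H.
by rewrite (_ : (fun n : nat => _) = fun n : nat => (\int[mu]_(x in `[0%R, n%:R]) (G (F x) * x)%:E)%E) //; apply/funext => n; exact: step.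
Qed.

Lemma Gamma_moment s : powR 2 (s%:R / 2) * Gamma (s%:R / 2 + 1) = ray_moment R s.
Proof.
pose G (t : R) := Num.sqrt t ^+ s * expR (- t).
have cG : continuous G.
  move=> x; apply: cvgM.
    have h := cvg_comp _ _ (@sqrt_continuous R x) (@exprn_continuous R s (Num.sqrt x)); exact: h.
  have h (y : R) : is_derive y 1 (fun t : R => expR (- t)) (- expR (- y)).
    by apply: is_derive_eq; rewrite /GRing.scale /=; ring.
  exact: (is_derive_continuous h).
have G0 t : 0 <= t -> 0 <= G t.
  by move=> _; rewrite mulr_ge0 ?expR_ge0 // exprn_ge0 // sqrtr_ge0.
have half t : 0 <= t -> powR t (s%:R / 2) = Num.sqrt t ^+ s.
  by move=> t0; rewrite mulrC powRrM powR12_sqrt // powR_mulrn // sqrtr_ge0.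
have -> : Gamma (s%:R / 2 + 1) = \int[mu]_(t in `[0, +oo[) G t.
  rewrite /Gamma /Rintegral; congr fine.
  rewrite -[RHS]integral_itv_obnd_cbnd; last first.
    by apply/measurable_EFinP; apply: measurable_funTS; exact: continuous_measurable_fun.
  apply: eq_integral => t; rewrite inE /= in_itv /= andbT => t0.
  by rewrite addrK half // ltW.
rewrite /Rintegral half_square_substitution //.
rewrite half // -[LHS]/(_ * \int[mu]_(x in `[0, +oo[) (G (x ^+ 2 / 2) * x)).
pose c : R := Num.sqrt 2 ^+ s.
have c0 : 0 < c by rewrite exprn_gt0 // sqrtr_gt0.
rewrite -/c (_ : \int[mu]_(x in _) _ = ray (fun t => c^-1 * t ^+ s)).
  rewrite rayZ; last exact: tame_pow.
  by rewrite mulrA divff ?mul1r // gt_eqF.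
apply: eq_Rintegral => x; rewrite inE /= in_itv /= andbT => x0.
rewrite /G /rayleigh_pdf sqrtrM ?sqr_ge0 // sqrtr_sqr ger0_norm // sqrtrV // exprMn exprVn -/c mulNr.
by ring.
Qed.

End GammaMoments.

(** * Convergence of distributions from moments *)

Section MomentMethod.
Variable R : realType.

Definition taylor_expN r (y : R) : R := \sum_(i < r) (- y) ^+ i / i`!%:R.

Lemma is_derive_taylor r (y : R) : is_derive y 1 (taylor_expN r.+1) (- taylor_expN r y).
Proof.
elim: r => [|r IH].
  rewrite (_ : taylor_expN 1 = cst 1); last first.
    by apply/funext => t; rewrite /taylor_expN big_ord1 expr0 fact0 divr1.
  by apply: is_derive_eq; rewrite /taylor_expN big_ord0 oppr0.
have dm : is_derive y 1 (fun t : R => (- t) ^+ r.+1 / r.+1`!%:R) (- ((- y) ^+ r / r`!%:R)).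
  rewrite (_ : (fun t : R => _) = ((-%R : R -> R) ^+ r.+1) * cst (r.+1`!%:R^-1)); last first.
    by apply/funext => t; rewrite !fctE.
  apply: is_derive_eq; rewrite /GRing.scale /= factS natrM.
  have f0 := fact_neq0 R r; have r0 : r.+1%:R != 0 :> R by rewrite pnatr_eq0.
  by move: (r.+1%:R) r0 ((- y) ^+ r) => u r0 v; field; rewrite f0 r0.
rewrite (_ : taylor_expN r.+2 = taylor_expN r.+1 + (fun t : R => (- t) ^+ r.+1 / r.+1`!%:R)); last first.
  by apply/funext => t; rewrite fctE /taylor_expN big_ord_recr.
apply: is_derive_eq; rewrite /taylor_expN [in RHS]big_ord_recr /=; ring.
Qed.

Lemma taylor_sign r (y : R) : 0 <= y -> 0 <= (-1) ^+ r * (expR (- y) - taylor_expN r y).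
Proof.
elim: r y => [|r IH] y y0.
  by rewrite expr0 mul1r /taylor_expN big_ord0 subr0 expR_ge0.
have dT (x : R) := is_derive_taylor r x.
have de (x : R) : is_derive x 1 (fun t : R => expR (- t)) (- expR (- x)).
  by apply: is_derive_eq; rewrite /GRing.scale /=; ring.
pose f (t : R) := (-1) ^+ r.+1 * (expR (- t) - taylor_expN r.+1 t).
have -> : 0 = f 0.
  rewrite /f oppr0 expR0 /taylor_expN big_ord_recl expr0 fact0 divr1.
  rewrite big1 ?addr0 ?subrr ?mulr0 // => i _.
  by rewrite oppr0 expr0n /= mul0r.
apply: (@ge0_derive_le R f (fun t => (-1) ^+ r * (expR (- t) - taylor_expN r t))) => // x.
refine (is_derive_eq (is_deriveM (is_derive_cst ((-1) ^+ r.+1 : R) x 1) (is_deriveB (de x) (dT x))) _).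
by rewrite /GRing.scale /= exprS; ring.
Qed.

Lemma taylor_bound r (y : R) : 0 <= y -> `|expR (- y) - taylor_expN r y| <= y ^+ r / r`!%:R.
Proof.
move=> y0; have h1 := taylor_sign r y0; have h2 := taylor_sign r.+1 y0.
have E : taylor_expN r.+1 y = taylor_expN r y + (-1) ^+ r * (y ^+ r / r`!%:R).
  by rewrite /taylor_expN big_ord_recr /= [(- y) ^+ r]exprNn mulrA.
have s2 : (-1) ^+ r * (-1) ^+ r = 1 :> R by rewrite -expr2 sqrr_sign.
have -> : `|expR (- y) - taylor_expN r y| = (-1) ^+ r * (expR (- y) - taylor_expN r y).
  by rewrite -[RHS]ger0_norm // normrM normrX normrN1 expr1n mul1r.
move: h2; rewrite E exprS; set d := expR _ - _ in h1 *; set z := y ^+ r / _.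
have -> : -1 * (-1) ^+ r * (expR (- y) - (taylor_expN r y + (-1) ^+ r * z)) =
   (-1) ^+ r * (-1) ^+ r * z - (-1) ^+ r * d by rewrite /d; ring.
by rewrite s2 mul1r subr_ge0.
Qed.

Lemma double_approximation (u : nat -> R) (L : R) :
  (forall eps, 0 < eps -> exists S S0 e e0,
     [/\ e0 < eps, S n @[n --> \oo] --> (S0 : R), e n @[n --> \oo] --> (e0 : R),
         \forall n \near \oo, `|u n - S n| <= e n & `|L - S0| <= e0]) ->
  u n @[n --> \oo] --> L.
Proof.
move=> h; apply/cvgrPdist_lt => eps eps0.
have e4 : 0 < eps / 4 by rewrite divr_gt0.
have [S [S0 [e [e0 [he0 hS he hu hL]]]]] := h _ e4.
move/cvgrPdist_lt: hS => /(_ _ e4) hS; move/cvgrPdist_lt: he => /(_ _ e4) he.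
near=> n.
have a1 : `|S0 - S n| < eps / 4 by near: n.
have a2 : `|e0 - e n| < eps / 4 by near: n.
have a3 : `|u n - S n| <= e n by near: n.
move: a1 a2 a3 hL; rewrite !ltr_norml !ler_norml => /andP[? ?] /andP[? ?] /andP[? ?] /andP[? ?].
by apply/andP; split; lra.
Unshelve. all: by end_near.
Qed.

Lemma ray_moment_even k : ray_moment R (2 * k)%N = 2 ^+ k * k`!%:R.
Proof.
elim: k => [|k IH]; first by rewrite muln0 ray_moment0 expr0 mul1r.
rewrite mulnS ray_momentSS IH factS exprS natrM.
have -> : (2 * k)%N.+2%:R = 2 * k.+1%:R :> R by rewrite -natrM; congr (_%:R); lia.
ring.
Qed.

Lemma ray_moment_small (a eps : R) N : 0 <= a -> 0 < eps ->
  exists2 s, (N <= s)%N & a ^+ s * ray_moment R s / s`!%:R < eps.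
Proof.
move=> a0 eps0; pose c := 2 * a ^+ 2.
have c0 : 0 <= c by rewrite mulr_ge0 // sqr_ge0.
have := cvg_exp_coeff c => /cvgrPdist_lt /(_ _ eps0) [K _ hK].
exists (2 * (N + K))%N; first lia.
have := hK (N + K)%N (leq_addl _ _); rewrite sub0r normrN /exp_coeff /=.
set k := (N + K)%N; apply: le_lt_trans.
rewrite ger0_norm; last by rewrite divr_ge0 // exprn_ge0.
rewrite ray_moment_even exprM.
have E : c ^+ k = (a ^+ 2) ^+ k * 2 ^+ k by rewrite -exprMn mulrC.
rewrite E -!mulrA; apply: ler_wpM2l; first by rewrite exprn_ge0 // sqr_ge0.
apply: ler_wpM2l; first exact: exprn_ge0.
rewrite ler_pdivrMr ?ltr0n ?fact_gt0 // mulrC ler_pdivlMr ?ltr0n ?fact_gt0 //.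
rewrite -natrM ler_nat.
have := bin_fact (leq_addr k k); rewrite addnK addnn -mul2n => <-.
by rewrite leq_pmull // bin_gt0 mul2n -addnn leq_addr.
Qed.

Variables (J : nat -> pred nat) (l : nat -> R).
Hypothesis J0 : forall n, J n 0%N = false.
Hypothesis l_ge0 : forall n, 0 <= l n.
Hypothesis moments : forall s, pmoment (J n) n (l n) s @[n --> \oo] --> ray_moment R s.

Definition emean n (f : R -> R) := pmean (J n) n (fun c => f (c%:R / l n)).

Lemma emean_le n f g : (forall t, 0 <= t -> f t <= g t) -> emean n f <= emean n g.
Proof. by move=> h; apply: pmean_le => // c; apply: h; rewrite divr_ge0. Qed.

Lemma emeanD n f g : emean n (fun t => f t + g t) = emean n f + emean n g.
Proof. exact: pmeanD. Qed.

Lemma emeanZ n k f : emean n (fun t => k * f t) = k * emean n f.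
Proof. exact: pmeanZ. Qed.

Lemma emean_cst n k : emean n (fun=> k) = k.
Proof. exact: pmean_cst. Qed.

Lemma emean_ext n f g : f =1 g -> emean n f = emean n g.
Proof. by move=> fg; apply: pmean_ext => c; rewrite fg. Qed.

Lemma emean_linear n (I : Type) (r : seq I) (k : I -> R) (F : I -> R -> R) :
  emean n (fun t => \sum_(i <- r) k i * F i t) = \sum_(i <- r) k i * emean n (F i).
Proof. exact: pmean_linear. Qed.

Lemma taylor_powers r (a t : R) : taylor_expN r (a * t) = \sum_(i < r) (- a) ^+ i / i`!%:R * t ^+ i.
Proof. by apply: eq_bigr => i _; rewrite -mulNr exprMn mulrAC. Qed.

Lemma emean_taylor r (a : R) n : 0 <= a ->
  `|emean n (fun t => expR (- (a * t))) - \sum_(i < r) (- a) ^+ i / i`!%:R * pmoment (J n) n (l n) i|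
  <= a ^+ r / r`!%:R * pmoment (J n) n (l n) r.
Proof.
move=> a0.
have -> : \sum_(i < r) (- a) ^+ i / i`!%:R * pmoment (J n) n (l n) i = emean n (fun t => taylor_expN r (a * t)).
  rewrite (emean_ext n (g := fun t => \sum_(i < r) (- a) ^+ i / i`!%:R * t ^+ i)); last exact: taylor_powers.
  by rewrite emean_linear.
have -> : a ^+ r / r`!%:R * pmoment (J n) n (l n) r = emean n (fun t => a ^+ r / r`!%:R * t ^+ r).
  exact: (esym (emeanZ n _ (fun t => t ^+ r))).
apply: pmean_dist_le => // c; rewrite mulrAC -exprMn; apply: taylor_bound.
by rewrite mulr_ge0 // divr_ge0.
Qed.

Lemma tame_expN (a : R) k : 0 <= a -> tame (fun t : R => t ^+ k * expR (- (a * t))).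
Proof.
move=> a0; apply: tameM_bounded; last exact: tame_pow.
  have h (x : R) : is_derive x 1 (fun t : R => expR (- (a * t))) (- a * expR (- (a * x))).
    by apply: is_derive_eq; rewrite /GRing.scale /=; ring.
  exact: is_derive_continuous h.
move=> t t0; rewrite ger0_norm ?expR_ge0 // -expR0 ler_expR oppr_le0.
exact: mulr_ge0.
Qed.

Lemma ray_taylor k r (a : R) : 0 <= a ->
  `|ray (fun t => t ^+ k * expR (- (a * t))) - \sum_(i < r) (- a) ^+ i / i`!%:R * ray_moment R (k + i)|
  <= a ^+ r / r`!%:R * ray_moment R (k + r).
Proof.
move=> a0.
have tT : tame (fun t => \sum_(i < r) (- a) ^+ i / i`!%:R * t ^+ (k + i)).
  by apply: tame_sum => i; apply: tameZ; exact: tame_pow.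
have te := tame_expN k a0.
have -> : \sum_(i < r) (- a) ^+ i / i`!%:R * ray_moment R (k + i) = ray (fun t => \sum_(i < r) (- a) ^+ i / i`!%:R * t ^+ (k + i)).
  rewrite ray_sum; last by move=> i; apply: tameZ; exact: tame_pow.
  by apply: eq_bigr => i _; rewrite rayZ //; exact: tame_pow.
have -> : a ^+ r / r`!%:R * ray_moment R (k + r) = ray (fun t => a ^+ r / r`!%:R * t ^+ (k + r)).
  by rewrite rayZ //; exact: tame_pow.
apply: ray_dist_le => //; first by apply: tameZ; exact: tame_pow.
move=> t t0; have -> : \sum_(i < r) (- a) ^+ i / i`!%:R * t ^+ (k + i) = t ^+ k * taylor_expN r (a * t).
  by rewrite taylor_powers mulr_sumr; apply: eq_bigr => i _; rewrite exprD; ring.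
rewrite -mulrBr normrM ger0_norm ?exprn_ge0 // exprD mulrCA ler_wpM2l ?exprn_ge0 //.
by rewrite mulrAC -exprMn; apply: taylor_bound; exact: mulr_ge0.
Qed.

Lemma cvg_sum (r : nat) (c : nat -> nat -> R) (d : nat -> R) :
  (forall i, (i < r)%N -> c i n @[n --> \oo] --> d i) ->
  (\sum_(i < r) c i n) @[n --> \oo] --> \sum_(i < r) d i.
Proof.
elim: r => [|r IH] h.
  by rewrite big_ord0; under eq_fun do rewrite big_ord0; exact: cvg_cst.
rewrite big_ord_recr /=; under eq_fun do rewrite big_ord_recr /=.
by apply: cvgD; [apply: IH => i ir; apply: h; exact: ltnW|exact: h].
Qed.

Lemma emean_exp_cvg (a : R) : 0 <= a ->
  emean n (fun t => expR (- (a * t))) @[n --> \oo] --> ray (fun t => expR (- (a * t))).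
Proof.
move=> a0; apply: double_approximation => eps eps0.
have [r _ hr] := ray_moment_small 0 a0 eps0.
exists (fun n => \sum_(i < r) (- a) ^+ i / i`!%:R * pmoment (J n) n (l n) i),
  (\sum_(i < r) (- a) ^+ i / i`!%:R * ray_moment R i),
  (fun n => a ^+ r / r`!%:R * pmoment (J n) n (l n) r), (a ^+ r / r`!%:R * ray_moment R r); split.
- by rewrite mulrAC.
- apply: (@cvg_sum r (fun i n => (- a) ^+ i / i`!%:R * pmoment (J n) n (l n) i) (fun i => (- a) ^+ i / i`!%:R * ray_moment R i)) => i _.
  by apply: cvgM; [exact: cvg_cst|exact: moments].
- by apply: cvgM; [exact: cvg_cst|exact: moments].
- by apply: nearW => n; exact: emean_taylor.
have := ray_taylor 0 r a0; rewrite (ray_ext (g := fun t => expR (- (a * t)))) // => t _.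
by rewrite expr0 mul1r.
Qed.

Definition soft_step (a : R) b (t : R) : R := 1 - (1 - expR (- (a * t))) ^+ b.

Lemma soft_stepE a b t : soft_step a b t =
  1 + \sum_(i < b.+1) - ('C(b, i)%:R * (-1) ^+ i) * expR (- (a * i%:R * t)).
Proof.
rewrite /soft_step exprBn -sumrN; congr (_ + _); apply: eq_bigr => i _.
have -> : expR (- (a * i%:R * t)) = expR (- (a * t)) ^+ i.
  by rewrite -expRM_natl; congr expR; ring.
by rewrite expr1n mulr1 -mulr_natl; ring.
Qed.

Lemma tame_expN0 (a : R) : 0 <= a -> tame (fun t : R => expR (- (a * t))).
Proof.
move=> a0; rewrite (_ : (fun t => _) = (fun t : R => t ^+ 0 * expR (- (a * t)))); first exact: tame_expN.
by apply/funext => t; rewrite expr0 mul1r.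
Qed.

Lemma tame_soft_step a b : 0 <= a -> tame (soft_step a b).
Proof.
move=> a0; rewrite (_ : soft_step a b = fun t => 1 + \sum_(i < b.+1) - ('C(b, i)%:R * (-1) ^+ i) * expR (- (a * i%:R * t))).
  apply: tameD; first exact: tame_cst.
  by apply: tame_sum => i; apply: tameZ; apply: tame_expN0; rewrite mulr_ge0.
by apply/funext => t; exact: soft_stepE.
Qed.

Lemma emean_soft_step a b : 0 <= a ->
  emean n (soft_step a b) @[n --> \oo] --> ray (soft_step a b).
Proof.
move=> a0; have ai i : 0 <= a * i%:R by rewrite mulr_ge0.
pose c i : R := - ('C(b, i)%:R * (-1) ^+ i).
have -> : ray (soft_step a b) = 1 + \sum_(i < b.+1) c i * ray (fun t => expR (- (a * i%:R * t))).
  rewrite (ray_ext (g := fun t => 1 + \sum_(i < b.+1) c i * expR (- (a * i%:R * t)))); last by move=> t _; exact: soft_stepE.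
  rewrite rayD; [|exact: tame_cst|by apply: tame_sum => i; apply: tameZ; exact: tame_expN0].
  rewrite ray1; congr (_ + _).
  rewrite ray_sum; last by move=> i; apply: tameZ; exact: tame_expN0.
  by apply: eq_bigr => i _; rewrite rayZ //; exact: tame_expN0.
rewrite (_ : (fun n => _) = fun n => 1 + \sum_(i < b.+1) c i * emean n (fun t => expR (- (a * i%:R * t)))).
  apply: cvgD; first exact: cvg_cst.
  apply: (@cvg_sum b.+1 (fun i n => c i * emean n (fun t => expR (- (a * i%:R * t)))) (fun i => c i * ray (fun t => expR (- (a * i%:R * t))))) => i _.
  by apply: cvgM; [exact: cvg_cst|exact: emean_exp_cvg].
apply/funext => n; rewrite (emean_ext n (g := fun t => 1 + \sum_(i < b.+1) c i * expR (- (a * i%:R * t)))); last first.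
  exact: soft_stepE.
by rewrite emeanD emean_cst emean_linear.
Qed.

End MomentMethod.

Section DistributionFunction.
Variable R : realType.
Let mu := @lebesgue_measure R.
Local Notation F := (@rayleigh_cdf R).
Local Notation pdf := (@rayleigh_pdf R).

Lemma subset_itv0y (y : R) : `[0, y]%classic `<=` `[(0 : R), +oo[%classic.
Proof. by move=> t /=; rewrite !in_itv /= andbT => /andP[]. Qed.

Lemma tame_integrable_itv (f : R -> R) (y : R) : tame f ->
  mu.-integrable `[0, y]%classic (EFin \o (fun t => f t * pdf t)).
Proof.
move=> tf; apply: integrableS (tame_integrable tf); [exact: measurable_itv|exact: measurable_itv|].
exact: subset_itv0y.
Qed.

Lemma tame_integrable_tail (f : R -> R) (y : R) : 0 <= y -> tame f ->
  mu.-integrable `]y, +oo[%classic (EFin \o (fun t => f t * pdf t)).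
Proof.
move=> y0 tf; apply: integrableS (tame_integrable tf); [exact: measurable_itv|exact: measurable_itv|].
by move=> t /=; rewrite !in_itv /= !andbT => /ltW; apply: le_trans.
Qed.

Lemma ray_split (f : R -> R) (y : R) : 0 <= y -> tame f ->
  ray f = \int[mu]_(t in `[0, y]) (f t * pdf t) + \int[mu]_(t in `]y, +oo[) (f t * pdf t).
Proof.
move=> y0 tf; have h := tame_integrable tf.
by rewrite -(@Rintegral_itvB R _ _ _ y h) //; rewrite addrC subrK.
Qed.

Lemma rayleigh_cdfE (y : R) : F y = \int[mu]_(t in `[0, y]) (1 * pdf t).
Proof. by apply: eq_Rintegral => t _; rewrite mul1r. Qed.

Lemma rayleigh_cdf_ge0 y : 0 <= F y.
Proof. by apply: Rintegral_ge0 => t /=; rewrite in_itv /= => /andP[t0 _]; exact: pdf_ge0. Qed.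

Lemma rayleigh_cdf_lt0 y : y < 0 -> F y = 0.
Proof.
move=> y0; rewrite /rayleigh_cdf set_itv_ge ?Rintegral_set0 //.
by rewrite bnd_simp -ltNge.
Qed.

Lemma ray_le_cdf (h : R -> R) y c : 0 <= y -> 0 <= c -> tame h ->
  (forall t, 0 <= t -> h t <= 1) -> (forall t, y < t -> h t <= c) -> ray h <= F y + c.
Proof.
move=> y0 c0 th h1 hc; rewrite (ray_split y0 th) rayleigh_cdfE; apply: lerD.
  apply: le_Rintegral; [exact: measurable_itv|exact: tame_integrable_itv|apply: (tame_integrable_itv _ (tame_cst 1))|].
  move=> t /=; rewrite in_itv /= => /andP[t0 _]; apply: ler_wpM2r; [exact: pdf_ge0|exact: h1].
have tc := tame_cst c.
apply: le_trans (_ : \int[mu]_(t in `]y, +oo[) (c * pdf t) <= _).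
  apply: le_Rintegral; [exact: measurable_itv|exact: tame_integrable_tail|exact: tame_integrable_tail|].
  move=> t /=; rewrite in_itv /= andbT => yt; apply: ler_wpM2r; last exact: hc.
  by apply: pdf_ge0; apply/ltW/(le_lt_trans y0).
have Ec : ray (fun=> c) = c.
  transitivity (ray (fun t : R => c * 1)); first by apply: ray_ext => t _; rewrite mulr1.
  by rewrite (@rayZ R c (fun=> 1) (tame_cst 1)) ray1 mulr1.
rewrite -[leRHS]Ec (ray_split y0 tc) lerDr.
by apply: Rintegral_ge0 => t /=; rewrite in_itv /= => /andP[t0 _]; rewrite mulr_ge0 // pdf_ge0.
Qed.

Lemma cdf_le_ray (h : R -> R) y c : 0 <= y -> tame h ->
  (forall t, 0 <= t -> 0 <= h t) -> (forall t, 0 <= t <= y -> c <= h t) -> c * F y <= ray h.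
Proof.
move=> y0 th h0 hc; rewrite (ray_split y0 th) -[leLHS]addr0; apply: lerD; last first.
  apply: Rintegral_ge0 => t /=; rewrite in_itv /= andbT => /ltW yt.
  by rewrite mulr_ge0 ?pdf_ge0 ?h0 // (le_trans y0).
rewrite rayleigh_cdfE -RintegralZl; [|exact: measurable_itv|exact: (tame_integrable_itv _ (tame_cst 1))].
apply: le_Rintegral; [exact: measurable_itv| |exact: tame_integrable_itv|].
  have := tame_integrable_itv y (tame_cst c); apply: eq_integrable; first exact: measurable_itv.
  by move=> t _ /=; rewrite mul1r.
move=> t /=; rewrite in_itv /= => /andP[t0 ty]; rewrite mul1r; apply: ler_wpM2r; first exact: pdf_ge0.
by apply: hc; rewrite t0.
Qed.

Lemma rayleigh_cdf_le1 y : F y <= 1.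
Proof.
case: (ltP y 0) => y0; first by rewrite rayleigh_cdf_lt0.
rewrite -ray1 -[F y]mul1r; apply: cdf_le_ray => //; exact: tame_cst.
Qed.

Lemma soft_step_bounds (a : R) b t : 0 <= a -> 0 <= t -> 0 <= soft_step a b t <= 1.
Proof.
move=> a0 t0; have h : 0 <= 1 - expR (- (a * t)) <= 1.
  by rewrite subr_ge0 gerBl expR_ge0 andbT -expR0 ler_expR oppr_le0 mulr_ge0.
case/andP: h => h1 h2; rewrite /soft_step subr_ge0 gerBl exprn_ile1 //=.
exact: exprn_ge0.
Qed.

Lemma soft_step_nincr (a : R) b t u : 0 <= a -> 0 <= t <= u -> soft_step a b u <= soft_step a b t.
Proof.
move=> a0 /andP[t0 tu]; rewrite /soft_step lerD2l lerN2; apply: lerXn2r; rewrite ?nnegrE.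
- by rewrite subr_ge0 -expR0 ler_expR oppr_le0 mulr_ge0.
- by rewrite subr_ge0 -expR0 ler_expR oppr_le0 mulr_ge0 // (le_trans t0).
- by rewrite lerD2l lerN2 ler_expR lerN2 ler_wpM2l.
Qed.

(* b is about e^(aw) with w midway: then b e^(-au) is large and b e^(-av) small. *)
Lemma soft_step_threshold (u v eps : R) : 0 <= u -> u < v -> 0 < eps ->
  exists a b, [/\ 0 <= a, 1 - eps <= soft_step a b u & soft_step a b v <= eps].
Proof.
move=> u0 uv eps0; pose d := (v - u) / 2; have d0 : 0 < d by rewrite divr_gt0 // subr_gt0.
pose w := u + d; pose a := 2 / (eps * d).
have a0 : 0 < a by rewrite divr_gt0 // mulr_gt0.
pose b := (Num.truncn (expR (a * w))).+1.
have b1 : expR (a * w) <= b%:R by apply/ltW; rewrite truncnS_gt.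
have b2 : b%:R <= 2 * expR (a * w).
  rewrite /b -natr1 mulr_natl mulr2n; apply: lerD; first by rewrite truncn_le // expR_ge0.
  by rewrite -expR0 ler_expR mulr_ge0 ?(ltW a0) // addr_ge0 // ltW.
have ad : a * d * eps = 2 by rewrite /a; field; rewrite !gt_eqF.
have adp : 0 < a * d by rewrite mulr_gt0.
exists a, b; split; first exact: ltW.
  rewrite /soft_step lerD2l lerN2.
  have h0 : 0 <= 1 - expR (- (a * u)).
    by rewrite subr_ge0 -expR0 ler_expR oppr_le0 mulr_ge0 // ltW.
  apply: le_trans (_ : expR (- expR (- (a * u))) ^+ b <= _).
    apply: lerXn2r; rewrite ?nnegrE ?expR_ge0 //; exact: expR_ge1Dx.
  rewrite -expRM_natl mulrN.
  have k1 : a * d <= b%:R * expR (- (a * u)).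
    apply: le_trans (_ : expR (a * w) * expR (- (a * u)) <= _); last first.
      by apply: ler_wpM2r b1; exact: expR_ge0.
    rewrite -expRD (_ : a * w + - (a * u) = a * d); last by rewrite /w; ring.
    by apply: le_trans (expR_ge1Dx (a * d)); rewrite lerDr.
  apply: le_trans (_ : expR (- (a * d)) <= _); first by rewrite ler_expR lerN2.
  rewrite expRN invf_ple ?posrE ?expR_gt0 //; apply: le_trans (expR_ge1Dx (a * d)).
  rewrite -(ler_pM2r eps0) mulVf ?gt_eqF //; nra.
rewrite /soft_step lerBlDr -lerBlDl.
have q0 := expR_gt0 (- (a * v)); have q1 : expR (- (a * v)) <= 1.
  by rewrite -expR0 ler_expR oppr_le0 mulr_ge0 ?(ltW a0) // (le_trans u0) // ltW.
have bern n (q : R) : 0 <= q <= 1 -> 1 - n%:R * q <= (1 - q) ^+ n.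
  move=> /andP[q00 q11]; elim: n => [|n IH]; first by rewrite mul0r subr0 expr0.
  rewrite exprS; apply: le_trans (_ : (1 - q) * (1 - n%:R * q) <= _).
    have -> : n.+1%:R = n%:R + 1 :> R by rewrite natr1.
    have : 0 <= n%:R * q ^+ 2 by rewrite mulr_ge0 // sqr_ge0.
    nra.
  by apply: ler_wpM2l => //; rewrite subr_ge0.
apply: le_trans (bern b _ _); last by rewrite (ltW q0).
rewrite lerD2l lerN2.
apply: le_trans (_ : 2 * expR (a * w) * expR (- (a * v)) <= _).
  by apply: ler_wpM2r b2; exact: ltW.
rewrite -mulrA -expRD (_ : a * w - a * v = - (a * d)); last by rewrite /w /d; field.
rewrite expRN ler_pdivrMr ?expR_gt0 //.
apply: le_trans (_ : eps * (1 + a * d) <= _); first lra.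
by apply: ler_wpM2l; [exact: ltW|exact: expR_ge1Dx].
Qed.

Variables (J : nat -> pred nat) (l : nat -> R).
Hypothesis J0 : forall n, J n 0%N = false.
Hypothesis l_ge0 : forall n, 0 <= l n.
Hypothesis moments : forall s, pmoment (J n) n (l n) s @[n --> \oo] --> ray_moment R s.
Local Notation emean := (emean J l).
Local Notation P := (fun n (x : R) => emean n (fun t => (t <= x)%R%:R)).

Lemma rayleigh_limit x : {for x, continuous F} -> P n x @[n --> \oo] --> F x.
Proof.
move=> cF; case: (ltP x 0) => x0.
  rewrite rayleigh_cdf_lt0 //; apply: cvg_near_cst; apply: nearW => n.
  rewrite -[RHS](@emean_cst R J l J0 n 0); apply: pmean_ext => c.
  by rewrite leNgt (lt_le_trans x0) // divr_ge0.
apply/cvgrPdist_lt => eps eps0; pose e := eps / 8.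
have e0 : 0 < e by rewrite divr_gt0.
have [d /= d0 hd] : exists2 d : R, 0 < d & forall y, `|y - x| < d -> `|F x - F y| < e.
  move/cvgrPdist_lt: cF => /(_ _ e0) /nbhs_ballP [d /= d0 hd]; exists d => // y yx.
  by apply: hd; rewrite /ball /= distrC.
pose y := x + d / 2; pose z := x - d / 2.
have Fy : `|F x - F y| < e by apply: hd; rewrite /y addrC addKr ger0_norm; lra.
have Fz : `|F x - F z| < e by apply: hd; rewrite /z addrC addKr normrN ger0_norm; lra.
have xy : x < y by rewrite /y; lra.
have [a1 [b1 [a10 A1 A2]]] := soft_step_threshold x0 xy e0.
have L1 := @emean_soft_step R J l J0 l_ge0 moments a1 b1 a10.
move/cvgrPdist_lt: L1 => /(_ _ e0) L1.
have up : \forall n \near \oo, P n x < F x + eps.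
  near=> n.
  have n1 : `|ray (soft_step a1 b1) - emean n (soft_step a1 b1)| < e by near: n.
  have k1 : (1 - e) * P n x <= emean n (soft_step a1 b1).
    rewrite -emeanZ; apply: emean_le => // t t0; have /andP[s0 s1] := soft_step_bounds b1 a10 t0.
    case: (lerP t x) => tx; rewrite ?mulr0 // mulr1; apply: le_trans A1 _.
    by apply: soft_step_nincr => //; rewrite t0.
  have k2 : ray (soft_step a1 b1) <= F y + e.
    apply: ray_le_cdf; [exact: le_trans (ltW xy)|exact: ltW|exact: tame_soft_step| |].
      by move=> t t0; case/andP: (soft_step_bounds b1 a10 t0).
    move=> t yt; apply: le_trans A2; apply: soft_step_nincr => //.
    by rewrite (ltW yt) andbT (le_trans x0) // ltW.
  have k3 : P n x <= 1.
    rewrite -[leRHS](@emean_cst R J l J0 n 1); apply: emean_le => // t _.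
    by case: (t <= x).
  have k4 : e * P n x <= e by apply: ler_piMr => //; exact: ltW.
  have eE : eps = 8 * e by rewrite /e; lra.
  move: n1 Fy k1 k2 k4; rewrite !ltr_norml mulrBl mul1r eE => /andP[? ?] /andP[? ?].
  by move: e0; lra.
have low : \forall n \near \oo, F x - eps < P n x.
  case: (ltP z 0) => z0.
    apply: nearW => n; have : 0 <= P n x by apply: pmean_ge0 => c; case: (_ <= x).
    move: Fz; rewrite (rayleigh_cdf_lt0 z0) subr0 ltr_norml /e => /andP[_ h] p0; lra.
  have zx : z < x by rewrite /z; lra.
  have [a2 [b2 [a20 B1 B2]]] := soft_step_threshold z0 zx e0.
  have L2 := @emean_soft_step R J l J0 l_ge0 moments a2 b2 a20.
  move/cvgrPdist_lt: L2 => /(_ _ e0) L2.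
  near=> n.
  have n1 : `|ray (soft_step a2 b2) - emean n (soft_step a2 b2)| < e by near: n.
  have k1 : emean n (soft_step a2 b2) <= P n x + e.
    rewrite -[X in _ <= _ + X](@emean_cst R J l J0 n e) -emeanD; apply: emean_le => // t t0.
    have /andP[s0 s1] := soft_step_bounds b2 a20 t0.
    case: (lerP t x) => tx; first by rewrite (le_trans s1) // lerDl ltW.
    by rewrite add0r; apply: le_trans B2; apply: soft_step_nincr => //; rewrite x0 ltW.
  have k2 : (1 - e) * F z <= ray (soft_step a2 b2).
    apply: cdf_le_ray => //; first exact: tame_soft_step.
      by move=> t t0; case/andP: (soft_step_bounds b2 a20 t0).
    by move=> t /andP[t0 tz]; apply: le_trans B1 _; apply: soft_step_nincr => //; rewrite t0.
  have k3 := rayleigh_cdf_le1 z; have k4 := rayleigh_cdf_ge0 z.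
  have k5 : e * F z <= e by apply: ler_piMr => //; exact: ltW.
  have eE : eps = 8 * e by rewrite /e; lra.
  move: n1 Fz k1 k2 k5; rewrite !ltr_norml mulrBl mul1r eE => /andP[? ?] /andP[? ?].
  by move: e0; lra.
near=> n.
have k1 : P n x < F x + eps by near: n.
have k2 : F x - eps < P n x by near: n.
by rewrite ltr_norml; apply/andP; split; lra.
Unshelve. all: by end_near.
Qed.

End DistributionFunction.

Section MixedPoisson.
Variable R : realType.

Lemma alternating_partial_sum m r :
  \sum_(i < r.+1) (-1) ^+ i * 'C(m.+1, i)%:R = (-1) ^+ r * 'C(m, r)%:R :> R.
Proof.
elim: r => [|r IH]; first by rewrite big_ord1 expr0 !bin0.
by rewrite big_ord_recr /= IH binS natrD exprS; ring.
Qed.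

Lemma bonferroni0 m r : `|(m == 0)%N%:R - \sum_(i < r) (-1) ^+ i * 'C(m, i)%:R| <= 'C(m, r)%:R :> R.
Proof.
case: r => [|r]; first by rewrite big_ord0 subr0 bin0 normr_nat ler_nat; case: m.
case: m => [|m].
  rewrite big_ord_recl expr0 bin0 mul1r big1 ?addr0 ?subrr ?normr0 //.
  by move=> i _; rewrite bin0n mulr0.
rewrite sub0r normrN alternating_partial_sum normrM normrX normrN1 expr1n mul1r normr_nat.
by rewrite ler_nat binS leq_addl.
Qed.

Lemma bonferroni l r k :
  `|(k == l)%:R - \sum_(i < r) (-1) ^+ i / (i`!%:R * l`!%:R) * ff R (l + i) k|
  <= ff R (l + r) k / (l`!%:R * r`!%:R).
Proof.
have E i : ff R (l + i) k / (l`!%:R * i`!%:R) = 'C(k, l)%:R * 'C(k - l, i)%:R.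
  have hf : (k ^_ (l + i) = k ^_ l * (k - l) ^_ i)%N.
    elim: i => [|i IH]; first by rewrite addn0 ffactn0 muln1.
    by rewrite addnS !ffactnSr IH subnDA mulnA.
  rewrite /ff hf -!bin_ffact !natrM; have := fact_neq0 R l; have := fact_neq0 R i.
  by move=> h1 h2; field; rewrite h1 h2.
have -> : (k == l)%:R = 'C(k, l)%:R * (k - l == 0)%N%:R :> R.
  case: (ltngtP k l) => kl; last by rewrite kl subnn binn mulr1.
    by rewrite bin_small // mul0r.
  by rewrite subn_eq0 leqNgt kl mulr0.
rewrite (eq_bigr (fun i : 'I_r => 'C(k, l)%:R * ((-1) ^+ i * 'C(k - l, i)%:R))); last first.
  move=> i _; rewrite mulrCA -E [l`!%:R * _]mulrC; ring.
rewrite -mulr_sumr -mulrBr normrM normr_nat E; apply: ler_wpM2l => //.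
exact: bonferroni0.
Qed.

Variables (J : nat -> pred nat) (rho : R).
Hypothesis J0 : forall n, J n 0%N = false.
Hypothesis rho_ge0 : 0 <= rho.
Hypothesis factorial_moments : forall s,
  pmean (J n) n (ff R s) @[n --> \oo] --> rho ^+ s * ray_moment R s.

Definition pt n k : R := pmean (J n) n (fun c => (c == k)%:R).

Lemma pmean_bonferroni l r n :
  `|pt n l - \sum_(i < r) (-1) ^+ i / (i`!%:R * l`!%:R) * pmean (J n) n (ff R (l + i))|
  <= pmean (J n) n (ff R (l + r)) / (l`!%:R * r`!%:R).
Proof.
rewrite -(pmean_linear (J n) n _ _ (fun i : 'I_r => ff R (l + i))) [leRHS]mulrC -pmeanZ.
by apply: pmean_dist_le => // c; rewrite [leRHS]mulrC; exact: bonferroni.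
Qed.

Lemma mpo_pmfE l : mpo_pmf rho l = rho ^+ l / l`!%:R * ray (fun t => t ^+ l * expR (- (rho * t))).
Proof. by []. Qed.

Lemma pt_cvg l : pt n l @[n --> \oo] --> mpo_pmf rho l.
Proof.
apply: double_approximation => eps eps0.
have [s ls hs] := ray_moment_small l (mulr_ge0 (ler0n R 2) rho_ge0) eps0.
pose r := (s - l)%N; have sE : s = (l + r)%N by rewrite /r subnKC.
have lf := fact_neq0 R l.
exists (fun n => \sum_(i < r) (-1) ^+ i / (i`!%:R * l`!%:R) * pmean (J n) n (ff R (l + i))),
  (\sum_(i < r) (-1) ^+ i / (i`!%:R * l`!%:R) * (rho ^+ (l + i) * ray_moment R (l + i))),
  (fun n => pmean (J n) n (ff R (l + r)) / (l`!%:R * r`!%:R)),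
  (rho ^+ (l + r) * ray_moment R (l + r) / (l`!%:R * r`!%:R)); split.
- apply: le_lt_trans hs; rewrite sE exprMn -!mulrA [leRHS]mulrCA; apply: ler_wpM2l.
    exact: exprn_ge0.
  rewrite [leRHS]mulrCA; apply: ler_wpM2l; first by apply: ray_ge0 => t t0; exact: exprn_ge0.
  have f0 k : (0 : R) < k`!%:R by rewrite ltr0n fact_gt0.
  rewrite ler_pdivlMr // mulrC ler_pdivrMr ?mulr_gt0 //.
  rewrite -natrX -!natrM ler_nat -(bin_fact (leq_addr r l)) addKn leq_mul2r.
  apply/orP; right; have := Pascal 1 1 (l + r); rewrite addn1 => ->.
  rewrite (bigD1 (Ordinal (leq_addr r l : (l < (l + r).+1)%N))) //= !exp1n !muln1.
  exact: leq_addr.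
- apply: (@cvg_sum R r (fun i n => (-1) ^+ i / (i`!%:R * l`!%:R) * pmean (J n) n (ff R (l + i)))
    (fun i => (-1) ^+ i / (i`!%:R * l`!%:R) * (rho ^+ (l + i) * ray_moment R (l + i)))) => i _.
  by apply: cvgM; [exact: cvg_cst|exact: factorial_moments].
- by apply: cvgM; [exact: factorial_moments|exact: cvg_cst].
- by apply: nearW => n; exact: pmean_bonferroni.
have := ray_taylor l r rho_ge0; rewrite mpo_pmfE.
set X := ray _; set S := \sum_(i < r) _ => h.
have -> : \sum_(i < r) (-1) ^+ i / (i`!%:R * l`!%:R) * (rho ^+ (l + i) * ray_moment R (l + i)) = rho ^+ l / l`!%:R * S.
  rewrite /S mulr_sumr; apply: eq_bigr => i _; rewrite exprD [(- rho) ^+ i]exprNn.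
  by field; rewrite lf fact_neq0.
have c0 : 0 <= rho ^+ l / l`!%:R by rewrite divr_ge0 // exprn_ge0.
rewrite -mulrBr normrM (ger0_norm c0); apply: le_trans (ler_wpM2l c0 h) _.
apply: eq_imp_le; rewrite exprD.
by field; rewrite lf fact_neq0.
Qed.

Lemma mpo_pmf_ge0 k : 0 <= mpo_pmf rho k.
Proof.
rewrite mpo_pmfE mulr_ge0 ?divr_ge0 ?exprn_ge0 //.
by apply: ray_ge0 => t t0; rewrite mulr_ge0 ?expR_ge0 // exprn_ge0.
Qed.

Lemma sum_filter_stable (p : nat -> R) (Q : pred nat) K N : (K <= N)%N ->
  (forall k, (K <= k)%N -> ~~ Q k) -> \sum_(k < N | Q k) p k = \sum_(k < K | Q k) p k.
Proof.
move=> KN hQ; rewrite -(big_mkord Q p) -(big_mkord Q p) (big_cat_nat _ KN) //=.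
rewrite [X in _ + X]big_nat_cond [X in _ + X]big1 ?addr0 // => k /andP[/andP[Kk _] Qk].
by rewrite (negPf (hQ k Kk)) in Qk.
Qed.

Lemma mpo_dist_cvg (x : R) :
  (\sum_(k < n.+1 | (k%:R <= x)%R) pt n k) @[n --> \oo] --> mpo_cdf rho x.
Proof.
have [K hK] : exists K : nat, x < K%:R.
  by exists (Num.bound `|x|); apply: le_lt_trans (ler_norm x) _; exact: archi_boundP.
have big k : (K <= k)%N -> ~~ (k%:R <= x)%R.
  by move=> Kk; rewrite -ltNge (lt_le_trans hK) // ler_nat.
have -> : mpo_cdf rho x = \sum_(k < K | (k%:R <= x)%R) mpo_pmf rho k.
  apply: cvg_lim => //; apply: cvg_near_cst; exists K => // N /= KN.
  by rewrite (@sum_filter_stable (mpo_pmf rho) (fun k => (k%:R <= x)%R) K N KN big).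
apply: (@cvg_of_sub_null R _ (fun n => \sum_(k < K | (k%:R <= x)%R) pt n k)).
  rewrite big_mkcond /=; under eq_fun do rewrite big_mkcond /=.
  apply: (@cvg_sum R K (fun k n => if (k%:R <= x)%R then pt n k else 0) (fun k => if (k%:R <= x)%R then mpo_pmf rho k else 0)) => i _.
  by case: ifP => _; [exact: pt_cvg|exact: cvg_cst].
apply: cvg_near_cst; exists K => // n /= Kn.
by rewrite (@sum_filter_stable (pt n) (fun k => (k%:R <= x)%R) K n.+1 (leqW Kn) big) subrr.
Qed.

Lemma power_moment_bounded s : exists C : R, \forall n \near \oo, pmean (J n) n (fun c => c%:R ^+ s) <= C.
Proof.
elim: s => [|s [C hC]].
  exists 1; apply: nearW => n; rewrite -[leRHS](pmean_cst n 1 (J0 n)).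
  by apply: pmean_le => // c; rewrite expr0.
have hF := cvg_near_bounded (@factorial_moments s.+1).
set D := (_ + 1) in hF.
exists (D + (s.+1 ^ 2)%:R * C); apply: filterS2 hC hF => n h1 h2.
apply: le_trans (_ : pmean (J n) n (fun c => ff R s.+1 c + (s.+1 ^ 2)%:R * c%:R ^+ s) <= _).
  by apply: pmean_le => // c; rewrite /ff -!natrX -natrM -natrD ler_nat exp_le_ffact.
rewrite pmeanD pmeanZ; apply: lerD; first exact: le_trans (ler_norm _) h2.
by apply: ler_wpM2l.
Qed.

Lemma pmean_truncated s L n :
  pmean (J n) n (fun c => \sum_(k < L) k%:R ^+ s * (c == k)%:R) = \sum_(k < L) k%:R ^+ s * pt n k.
Proof. by rewrite (pmean_linear _ _ _ _ (fun (k : 'I_L) c => (c == k)%:R)). Qed.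

Lemma truncated_power (s L c : nat) : \sum_(k < L) k%:R ^+ s * (c == k)%:R = (if (c < L)%N then c%:R ^+ s else 0) :> R.
Proof.
case: ifP => cL.
  rewrite (bigD1 (Ordinal cL)) //= big1 ?addr0.
    by case: eqP => [_|/(_ erefl)//]; rewrite mulr1.
  move=> i /eqP ic; case: eqP => [E|_]; last by rewrite mulr0.
  by case: ic; apply: val_inj; rewrite /= E.
rewrite big1 // => i _; case: eqP => [E|_]; last by rewrite mulr0.
by rewrite E ltn_ord in cL.
Qed.

Lemma truncation_error s L n (C : R) : pmean (J n) n (fun c => c%:R ^+ s.+1) <= C ->
  0 <= pmean (J n) n (fun c => c%:R ^+ s) - \sum_(k < L.+1) k%:R ^+ s * pt n k <= C / L.+1%:R.
Proof.
move=> hC; rewrite -pmean_truncated -[- pmean _ _ _]mulN1r -pmeanZ -pmeanD.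
apply/andP; split.
  apply: pmean_ge0 => c; rewrite truncated_power mulN1r; case: ifP => _; first by rewrite subrr.
  by rewrite subr0 exprn_ge0.
apply: le_trans (_ : pmean (J n) n (fun c => L.+1%:R^-1 * c%:R ^+ s.+1) <= _).
  apply: pmean_le => // c; rewrite truncated_power mulN1r; case: ifP => cL.
    by rewrite subrr mulr_ge0 // ?invr_ge0 // exprn_ge0.
  rewrite subr0 exprS mulrA ler_peMl ?exprn_ge0 //.
  by rewrite mulrC ler_pdivlMr ?ltr0n // mul1r ler_nat leqNgt cL.
by rewrite pmeanZ mulrC; apply: ler_wpM2r => //; rewrite invr_ge0.
Qed.

Lemma mpo_moment_cvg s : pmean (J n) n (fun c => c%:R ^+ s) @[n --> \oo] --> mpo_moment rho s.
Proof.
pose T N : R := \sum_(k < N) k%:R ^+ s * mpo_pmf rho k.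
have Tn N n : \sum_(k < N) k%:R ^+ s * pt n k <= pmean (J n) n (fun c => c%:R ^+ s).
  rewrite -pmean_truncated; apply: pmean_le => // c; rewrite truncated_power.
  by case: ifP => _ //; exact: exprn_ge0.
have Tcv N : (\sum_(k < N) k%:R ^+ s * pt n k) @[n --> \oo] --> T N.
  apply: (@cvg_sum R N (fun k n => k%:R ^+ s * pt n k) (fun k => k%:R ^+ s * mpo_pmf rho k)) => k _.
  by apply: cvgM; [exact: cvg_cst|exact: pt_cvg].
have [C hC] := power_moment_bounded s; have [C1 hC1] := power_moment_bounded s.+1.
have Tb N : T N <= C.
  apply: (cvgr_to_le (@Tcv N)); apply: filterS hC => n; exact: le_trans.
have Tnd : nondecreasing_seq T.
  apply/nondecreasing_seqP => N; rewrite /T big_ord_recr /= lerDl.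
  by rewrite mulr_ge0 ?mpo_pmf_ge0 // exprn_ge0.
have TM : T N @[N --> \oo] --> mpo_moment rho s.
  apply: nondecreasing_is_cvgn => //; exists C => _ [N _ <-]; exact: Tb.
apply/cvgrPdist_lt => eps eps0; have e3 : 0 < eps / 3 by rewrite divr_gt0.
move/cvgrPdist_lt: TM => /(_ _ e3) [K _ hK].
have [K2 hK2] : exists K2 : nat, `|C1| / (eps / 3) < K2%:R.
  by exists (Num.bound (`|C1| / (eps / 3))); apply: archi_boundP; rewrite divr_ge0 // ltW.
pose L := (K + K2)%N.
have TL : `|mpo_moment rho s - T L.+1| < eps / 3 by apply: hK => /=; rewrite /L; lia.
have CL : `|C1| / L.+1%:R < eps / 3.
  rewrite ltr_pdivrMr ?ltr0n // mulrC -ltr_pdivrMr //; apply: lt_le_trans hK2 _.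
  by rewrite ler_nat /L; lia.
move/cvgrPdist_lt: (@Tcv L.+1) => /(_ _ e3) hT.
near=> n.
have k1 : `|T L.+1 - \sum_(k < L.+1) k%:R ^+ s * pt n k| < eps / 3 by near: n.
have k2 : pmean (J n) n (fun c => c%:R ^+ s.+1) <= C1 by near: n.
have /andP[k3 k4] := truncation_error L (le_trans k2 (ler_norm C1)).
have k5 := le_lt_trans k4 CL.
rewrite ltr_norml; move: k1 TL k3 k5; rewrite !ltr_norml.
move: (pmean _ _ _) (\sum_(k < _) _) (T _) (mpo_moment _ _) => x y z w.
by move=> /andP[? ?] /andP[? ?] ? ?; apply/andP; split; lra.
Unshelve. all: by end_near.
Qed.

End MixedPoisson.

(** * Limit laws *)

Section LimitLaws.
Variable R : realType.
Implicit Types (j : nat -> nat) (J : nat -> pred nat) (l : nat -> R).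

Lemma near_cvg (u v : nat -> R) (F : set_system R) :
  (\forall n \near \oo, u n = v n) -> (u @ \oo `=>` F) -> (v @ \oo `=>` F).
Proof. by move=> uv; apply: cvg_trans; apply: near_eq_cvg. Qed.

Lemma cvgM_seq (u v : nat -> R) (a b : R) :
  u @ \oo --> a -> v @ \oo --> b -> (fun n => u n * v n) @ \oo --> a * b.
Proof. by move=> ua vb; apply: cvgM. Qed.

Lemma cvg_seq_cst (a : R) : (fun _ : nat => a) @ \oo --> a.
Proof. exact: cvg_cst. Qed.

Lemma cvgX_seq (u : nat -> R) (a : R) s :
  u @ \oo --> a -> (fun n => u n ^+ s) @ \oo --> a ^+ s.
Proof.
move=> ua; elim: s => [|s IHs]; first exact: cvg_seq_cst.
have -> : (fun n => u n ^+ s.+1) = (fun n => u n * u n ^+ s).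
  by apply/funext => n; rewrite exprS.
by rewrite exprS; apply: cvgM_seq.
Qed.

Lemma ray_moment_gt0 s : 0 < ray_moment R s.
Proof.
exact: (mu_gt0 (ray_moment0 R) (ray_moment1_gt0 R) (@ray_momentSS R)).
Qed.

Lemma Qn_div_sqrt_cvg : (fun n => Qn R n / Num.sqrt n%:R : R) @ \oo --> (1 : R).
Proof.
have small : (fun n => 1%:R / n%:R : R) @ \oo --> (0 : R).
  by under eq_cvg do rewrite div1r; exact: invn_cvg.
by have := @Q_ratio R (fun=> 1%N) small 0; under eq_cvg do rewrite muln0 subn0.
Qed.

Lemma inv_sqrt_cvg : (fun n => (Num.sqrt n%:R)^-1 : R) @ \oo --> (0 : R).
Proof.
have := cvg_comp _ _ (@invn_cvg R) (@sqrt_continuous R 0); rewrite sqrtr0.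
by apply: near_cvg; apply: nearW => n /=; rewrite sqrtrV.
Qed.

Lemma pmoment_ray J l :
  (forall n, J n 0%N = false) -> (\forall n \near \oo, 0 < l n) ->
  (fun n => (l n)^-1) @ \oo --> (0 : R) ->
  (forall s, (fun n => pmean (J n) n (ff R s) / l n ^+ s) @ \oo --> ray_moment R s) ->
  forall s, (fun n => pmoment (J n) n (l n) s) @ \oo --> ray_moment R s.
Proof.
move=> J0 l_gt0 l_inv fmom s.
apply: (cvg_of_sub_null (fmom s)).
apply: (proj2 (pmoment_asymp J0 l_gt0 l_inv _ s)) => {}s.
by exists (`|ray_moment R s| + 1); apply: cvg_near_bounded (fmom s).
Qed.

Lemma positive_fact_cvg s :
  (fun n => pmean positive_jump n (ff R s) / Num.sqrt n%:R ^+ s) @ \oo --> ray_moment R s.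
Proof.
have h := @positive_cvg R s.
have := cvgM_seq h (cvgX_seq (s := s) Qn_div_sqrt_cvg).
rewrite expr1n mulr1; apply: near_cvg; near=> n.
rewrite expr_div_n mulrA divfK // expf_neq0 // gt_eqF //.
by rewrite /Qn sqrtr_gt0 ltr0n.
Unshelve. all: by end_near. Qed.

Lemma sum_law_le (J : pred nat) n (l x : R) :
  \sum_(k < n.+1 | k%:R / l <= x) pmean J n (fun c => (c == k)%:R : R) =
  pmean J n (fun c => ((c%:R / l <= x)%R : bool)%:R : R).
Proof.
rewrite big_mkcond -(sum_pmean J n (fun c => ((c%:R / l <= x)%R : bool)%:R)) /=.
by apply: eq_bigr => k _; case: ifP => _; rewrite ?mul1r ?mul0r.
Qed.

Lemma rayleigh_sum_limit J l (p : nat -> nat -> R) :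
  (forall n, J n 0%N = false) -> (forall n, 0 <= l n) -> (\forall n \near \oo, 0 < l n) ->
  (fun n => (l n)^-1) @ \oo --> (0 : R) ->
  (forall s, (fun n => pmean (J n) n (ff R s) / l n ^+ s) @ \oo --> ray_moment R s) ->
  (\forall n \near \oo, forall k, p n k = pmean (J n) n (fun c => (c == k)%:R)) ->
  cvg_in_dist (fun n x => \sum_(k < n.+1 | k%:R / l n <= x) p n k) (@rayleigh_cdf R) /\
  (forall s, (fun n => \sum_(k < n.+1) (k%:R / l n) ^+ s * p n k) @ \oo -->
     rayleigh_moment R s).
Proof.
move=> J0 l_ge0 l_gt0 l_inv fmom pE.
have mom := pmoment_ray J0 l_gt0 l_inv fmom; split=> [x Fx|s].
  have := rayleigh_limit J0 l_ge0 mom Fx.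
  apply: near_cvg; apply: filterS pE => n pE.
  by under eq_bigr do rewrite pE; rewrite sum_law_le.
rewrite rayleigh_momentE; have := mom s.
apply: near_cvg; apply: filterS pE => n pE; under eq_bigr do rewrite pE.
by rewrite (sum_pmean (J n) n (fun c => (c%:R / l n) ^+ s)).
Qed.

Lemma lam_ge0 n i : 0 <= lam R n i.
Proof. by rewrite /lam divr_ge0 ?mulr_ge0 ?exprn_ge0 ?sqrtr_ge0 ?ler0n ?expR_ge0. Qed.

Lemma lam_gt0 n i : (0 < n)%N -> (0 < i)%N -> 0 < lam R n i.
Proof.
move=> n0 i0; rewrite /lam divr_gt0 ?mulr_gt0 ?exprn_gt0 ?sqrtr_gt0 ?ltr0n ?expR_gt0 //.
by rewrite fact_gt0.
Qed.

Lemma small_of_lam j (c : R) :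
  (forall n, (1 < n)%N -> (0 < j n < n)%N) -> 0 < c ->
  (\forall n \near \oo, c <= lam R n (j n)) -> (fun n => (j n)%:R / n%:R : R) @ \oo --> (0 : R).
Proof.
move=> jr c0 hc.
apply: (@cvg_dominated R _ (fun n => (Num.sqrt n%:R)^-1 * c^-1)); last first.
  by have := cvgM_seq inv_sqrt_cvg (@cvg_seq_cst c^-1); rewrite mul0r; exact.
near=> n.
have n1 : (1 < n)%N by near: n; exact: nbhs_infty_gt.
have /andP[j0 _] := jr n n1.
have s0 : 0 < Num.sqrt (n%:R : R) by rewrite sqrtr_gt0 ltr0n ltnW.
have cl : c <= lam R n (j n) by near: n.
have jR : 0 < ((j n)%:R : R) by rewrite ltr0n.
have cj : c * (j n)%:R <= Num.sqrt n%:R.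
  rewrite -ler_pdivlMr //; apply: (le_trans cl); rewrite lamE //.
  by rewrite ler_wpM2l ?sqrtr_ge0 // jump_rate_le.
rewrite subr0 ger0_norm ?divr_ge0 ?ler0n //.
have -> : (j n)%:R / (n%:R : R) = (j n)%:R / (Num.sqrt n%:R * Num.sqrt n%:R).
  by rewrite -expr2 sqr_sqrtr ?ler0n.
have -> : (Num.sqrt (n%:R : R))^-1 * c^-1
   = Num.sqrt n%:R / c / (Num.sqrt n%:R * Num.sqrt n%:R).
  by field; rewrite !gt_eqF.
rewrite ler_wpM2r ?invr_ge0 ?mulr_ge0 ?sqrtr_ge0 //.
by rewrite ler_pdivlMr // mulrC.
Unshelve. all: by end_near. Qed.

Lemma ratio_Gamma_cvg j s :
  (forall n, (1 < n)%N -> (0 < j n < n)%N) ->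
  (fun n => (j n)%:R / n%:R : R) @ \oo --> (0 : R) ->
  (fun n => fact_moment R n (j n) s /
     (lam R n (j n) ^+ s * powR 2 (s%:R / 2) * Gamma (s%:R / 2 + 1))) @ \oo --> (1 : R).
Proof.
move=> jr jsmall; have m0 := ray_moment_gt0 s.
have := cvgM_seq (fact_moment_cvg (s := s) jsmall jr) (@cvg_seq_cst (ray_moment R s)^-1).
rewrite mulfV ?gt_eqF //; apply: near_cvg; near=> n.
by rewrite -[in RHS]mulrA Gamma_moment invfM mulrA.
Unshelve. all: by end_near. Qed.

Lemma fact_moment_bigO j s :
  (forall n, (1 < n)%N -> (0 < j n < n)%N) ->
  exists C : R, \forall n \near \oo, `|fact_moment R n (j n) s| <= C * `|lam R n (j n) ^+ s|.
Proof.
move=> jr; have [C hC] := fact_moment_le R s; exists C; near=> n.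
have n1 : (1 < n)%N by near: n; exact: nbhs_infty_gt.
rewrite !ger0_norm ?fact_moment_ge0 ?exprn_ge0 ?lam_ge0 //.
by apply: hC; [exact: ltnW | case/andP: (jr n n1)].
Unshelve. all: by end_near. Qed.

(* Any size would do for the finitely many n where j n may vanish. *)
Let size_at j n : pred nat := pred1 (maxn 1 (j n)).

Let size_at0 j n : size_at j n 0%N = false.
Proof. by rewrite /size_at; case: (maxn 1 (j n)) (leq_maxl 1 (j n)). Qed.

Let near_size_at j : (forall n, (1 < n)%N -> (0 < j n < n)%N) ->
  \forall n \near \oo, size_at j n = pred1 (j n).
Proof.
by move=> jr; exists 2%N => // n /= /jr /andP[j0 _]; rewrite /size_at (maxn_idPr j0).
Qed.

Lemma one_size_rayleigh j :
  (forall n, (1 < n)%N -> (0 < j n < n)%N) ->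
  (fun n => lam R n (j n)) @ \oo --> +oo ->
  cvg_in_dist (fun n x => \sum_(k < n.+1 | k%:R / lam R n (j n) <= x) lawXj R n (j n) k)
              (@rayleigh_cdf R) /\
  (forall s, (fun n => \sum_(k < n.+1) (k%:R / lam R n (j n)) ^+ s * lawXj R n (j n) k)
     @ \oo --> rayleigh_moment R s).
Proof.
move=> jr loo; have jE := near_size_at jr.
have jsmall : (fun n => (j n)%:R / n%:R : R) @ \oo --> (0 : R).
  by apply: (small_of_lam jr ltr01); move/cvgryPge: loo; apply.
apply: (@rayleigh_sum_limit (size_at j) (fun n => lam R n (j n)) (fun n => lawXj R n (j n))).
- exact: size_at0.
- by move=> n; exact: lam_ge0.
- by move/cvgryPgt: loo; apply.
- by apply/gtr0_cvgV0 => //; move/cvgryPgt: loo; exact.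
- move=> s; have := fact_moment_cvg (s := s) jsmall jr.
  by apply: near_cvg; apply: filterS jE => n ->; rewrite fact_momentE.
- by apply: filterS jE => n -> k; exact: lawXjE.
Qed.

Lemma one_size_fact_cvg j (rho : R) s :
  (forall n, (1 < n)%N -> (0 < j n < n)%N) -> 0 <= rho ->
  (fun n => lam R n (j n)) @ \oo --> rho ->
  (fun n => fact_moment R n (j n) s) @ \oo --> rho ^+ s * ray_moment R s.
Proof.
move=> jr rho0 lrho; have lX := cvgX_seq (s := s) lrho.
case: (eqVneq rho 0) => [rhoE|rho_neq0].
  case: s lX => [|s] lX.
    rewrite expr0 mul1r ray_moment0; have := @cvg_seq_cst 1.
    apply: near_cvg; exists 2%N => // n /= /jr /andP[j0 _]; rewrite fact_momentE.
    rewrite (@pmean_ext R _ _ _ (fun=> 1)) ?pmean_cst //=.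
    by rewrite eq_sym; apply/negbTE; rewrite -lt0n.
  have [C hC] := fact_moment_le R s.+1.
  apply: (@cvg_dominated R _ (fun n => lam R n (j n) ^+ s.+1 * C)); last first.
    by have := cvgM_seq lX (@cvg_seq_cst C); rewrite rhoE expr0n /= mul0r; exact.
  exists 2%N => // n /= n1; have /andP[j0 _] := jr n n1.
  rewrite rhoE expr0n mul0r subr0 ger0_norm ?fact_moment_ge0 // mulrC hC //.
  exact: ltnW.
have rho_gt0 : 0 < rho by rewrite lt_neqAle eq_sym rho_neq0.
have jsmall : (fun n => (j n)%:R / n%:R : R) @ \oo --> (0 : R).
  apply: (@small_of_lam _ (rho / 2)) => //; first by lra.
  by move: lrho => /cvgr_ge; apply; lra.
have := cvgM_seq lX (fact_moment_cvg (s := s) jsmall jr).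
apply: near_cvg; exists 2%N => // n /= n1; have /andP[j0 _] := jr n n1.
by rewrite mulrC divfK // expf_neq0 // gt_eqF // lam_gt0 // ltnW.
Qed.

Lemma one_size_mixed_poisson j (rho : R) :
  (forall n, (1 < n)%N -> (0 < j n < n)%N) -> 0 <= rho ->
  (fun n => lam R n (j n)) @ \oo --> rho ->
  cvg_in_dist (fun n x => \sum_(k < n.+1 | k%:R <= x) lawXj R n (j n) k) (mpo_cdf rho) /\
  (forall s, (fun n => \sum_(k < n.+1) k%:R ^+ s * lawXj R n (j n) k)
     @ \oo --> mpo_moment rho s).
Proof.
move=> jr rho0 lrho; have jE := near_size_at jr.
have fm s : (fun n => pmean (size_at j n) n (ff R s)) @ \oo --> rho ^+ s * ray_moment R s.
  have := one_size_fact_cvg (s := s) jr rho0 lrho.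
  by apply: near_cvg; apply: filterS jE => n ->; rewrite fact_momentE.
split=> [x _|s].
  have := mpo_dist_cvg (x := x) (@size_at0 j) rho0 fm; apply: near_cvg.
  by apply: filterS jE => n jE; apply: eq_bigr => k _; rewrite lawXjE /pt jE.
have := mpo_moment_cvg (s := s) (@size_at0 j) rho0 fm; apply: near_cvg.
apply: filterS jE => n ->.
by under eq_bigr do rewrite lawXjE; rewrite (sum_pmean _ n (fun c => c%:R ^+ s)).
Qed.

End LimitLaws.

Unset Implicit Arguments.

Theorem theorem5 (R : realType) :
  (* X_{n-1} and C_n have the same law (parking functions of size n-1
     correspond to Cayley trees of size n; see NOTES.md) *)
  (forall n k : nat, (0 < n)%N -> lawX R n.-1 k = lawC R n k) /\
  (forall n j k : nat, (0 < j < n)%N -> lawXj R n.-1 j k = lawCj R n j k) /\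
  (* X_n / sqrt n converges in distribution to Rayleigh(1) *)
  cvg_in_dist (fun n x => \sum_(k < n.+1 | k%:R / Num.sqrt n%:R <= x) lawX R n k)
              (@rayleigh_cdf R) /\
  (* factorial moments, j = j(n) = o(n) *)
  (forall (s : nat) (j : nat -> nat), (0 < s)%N ->
     (forall n, (1 < n)%N -> (0 < j n < n)%N) ->
     (fun n => (j n)%:R / n%:R : R) @ \oo --> (0 : R) ->
     (fun n => fact_moment R n (j n) s /
        (lam R n (j n) ^+ s * powR 2 (s%:R / 2) * Gamma (s%:R / 2 + 1))) @ \oo --> (1 : R)) /\
  (* factorial moments are O(lambda^s) for 1 <= j(n) <= n-1 *)
  (forall (s : nat) (j : nat -> nat), (0 < s)%N ->
     (forall n, (1 < n)%N -> (0 < j n < n)%N) ->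
     exists C : R, \forall n \near \oo,
       `|fact_moment R n (j n) s| <= C * `|lam R n (j n) ^+ s|) /\
  (* (i) lambda -> oo : Rayleigh limit with convergence of all moments *)
  (forall j : nat -> nat,
     (forall n, (1 < n)%N -> (0 < j n < n)%N) ->
     (fun n => lam R n (j n)) @ \oo --> +oo ->
     cvg_in_dist (fun n x => \sum_(k < n.+1 | k%:R / lam R n (j n) <= x) lawXj R n (j n) k)
                 (@rayleigh_cdf R) /\
     (forall s : nat,
        (fun n => \sum_(k < n.+1) (k%:R / lam R n (j n)) ^+ s * lawXj R n (j n) k)
          @ \oo --> rayleigh_moment R s)) /\
  (* (ii) lambda -> rho in [0, oo) : mixed Poisson limit MPo(rho X) *)
  (forall (j : nat -> nat) (rho : R),
     (forall n, (1 < n)%N -> (0 < j n < n)%N) ->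
     0 <= rho ->
     (fun n => lam R n (j n)) @ \oo --> rho ->
     cvg_in_dist (fun n x => \sum_(k < n.+1 | k%:R <= x) lawXj R n (j n) k)
                 (mpo_cdf rho) /\
     (forall s : nat,
        (fun n => \sum_(k < n.+1) k%:R ^+ s * lawXj R n (j n) k)
          @ \oo --> mpo_moment rho s)).
Proof.
split; first by move=> n k; exact: lawX_lawC.
split; first by move=> n j k; exact: lawXj_lawCj.
split.
  apply: (proj1 (rayleigh_sum_limit (J := fun=> positive_jump) (l := fun n => Num.sqrt n%:R)
    (p := lawX R) _ _ _ (@inv_sqrt_cvg R) (@positive_fact_cvg R) _)) => //.
    by exists 1%N => // n /= n1; rewrite sqrtr_gt0 ltr0n.
  by apply: nearW => n k; exact: lawXE.
split; first by move=> s j _; exact: ratio_Gamma_cvg.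
split; first by move=> s j _; exact: fact_moment_bigO.
by split=> [j|j rho]; [exact: one_size_rayleigh|exact: one_size_mixed_poisson].
Qed.
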